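(* Let $X_1,\dots,X_n$ be independent $d$-dimensional random variables with density $f$, let $\alpha\in(0,1)$, and let $$D=\frac{2\sqrt2(2d+1)(d+1)}{\left(1-\frac{d}{d+1}\right)^{(d+1)/d}\Big[1-\frac{d^2}{2(2d+1)^2}\Big(-1+\big\{1+4(\tfrac{2d+1}{d})^2\big\}^{1/2}\Big)\Big]^{1/2}}.$$ Let $c,c_1>0$ be constants. Assume that for any mode $x_0\in\mathbb{R}^d$ of $f$ the density satisfies $c_1\ge f(x_0)>0$ and that there exist functions $g_{x_0}:\mathbb{R}^d\to\mathbb{R}$ and $\tilde f_{x_0}:\mathbb{R}\to\mathbb{R}$ such that $$f(x)=(1+g_{x_0}(x))\,\tilde f_{x_0}(\|x-x_0\|)$$ in a neighbourhood of $x_0$. Furthermore, let $g_{x_0}$ be differentiable in a neighbourhood of $x_0$ with $g_{x_0}(x)=o(1)$ and $\langle\nabla g_{x_0}(x),e_0\rangle=o(\|x-x_0\|^{1+\gamma})$ (for some $\gamma>0$) as $x\to x_0$, for all $e_0\in\mathbb{R}^d$ with $\|e_0\|=1$. In addition, let $\tilde f_{x_0}$ be differentiable in a neighbourhood of $0$ with $\tilde f_{x_0}'(h)\le -ch(1+o(1))$ for $h\to0$. Let $\mathcal K_n$ be the family of wedges described in the context, with constants $C_1,C_2$ satisfying $$C_1^{d+4}C_2^{d-1}>\frac{D^2}{c^2}\,\frac{c_1}{d+4}.$$ Then every mode $x_0$ of $f$ is detected with asymptotic probability one as $n\to\infty$; that is, for every mode $x_0$ of $f$, with the index set $\mathcal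 I_n=\mathcal I_n(x_0)$ defined in the context, all tests of the hypotheses ''$f$ is increasing on $K^i(0,N^i)$'' with $i\in\mathcal I_n$ reject with asymptotic probability one: $$\mathbb P\big(T_{K^i}<-\overline c_{K^i}(\alpha)\ \text{for all } i\in\mathcal I_n\big)\to1\qquad(n\to\infty).$$
   Context: Modes. $f$ has a mode at $x_0$ if for every $e\in\mathbb{R}^d$ with $\|e\|=1$ (Euclidean norm) the function $t\mapsto f(x_0+te)$, $t\ge0$, is strictly decreasing in a neighbourhood of $t=0$. Wedges. For $x_0,e\in\mathbb{R}^d$ with $\|e\|=1$, fix an orthonormal basis $\{e_1,\dots,e_{d-1}\}$ of $(\mathrm{span}\{e\})^\perp$ and put $P_ex:=\langle x-x_0,e\rangle$. The wedge with vertex $x_0$, direction $e$, length $l>0$ and angle $\varphi\in(0,\pi/2)$ is $K(x_0,e,\varphi):=\{x: 0<P_ex\le l,\ \langle x-x_0,e_i\rangle\in[-\tan(\varphi)P_ex,\tan(\varphi)P_ex],\ i=1,\dots,d-1\}$. Family $\mathcal K_n$. Let $l_n=(\log(n)/n)^{1/(d+4)}$, let $C_1,C_2,\varepsilon>0$ be constants and $\varphi_n=\frac{C_2}{2}\log(n)^{-1}$. Let $b_1,\dots,b_d$ be the standard unit vectors and let $\mathcal G_n$ be the grid of vertices $\sum_{j=1}^d(i_j(2+\varepsilon)C_1\log(n)l_n-n)b_j$ with $i_1,\dots,i_d\in\{0,\dots,\lceil 2n/((2+\varepsilon)C_1\log(n)l_n)\rceil\}$. Unit directions $e_n^1,\dots,e_n^{M_n}$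 are chosen successively: $e_n^1$ is arbitrary; once $e_n^1,\dots,e_n^{i-1}$ are specified, whenever possible a unit vector $e_n^i$ is chosen with $|\mathrm{angle}(e_n^i,e_n^j)|\ge(2+\varepsilon)\arctan(\sqrt{d-1}\tan(\varphi_n))$ for all $j<i$. $\mathcal K_n=\{K^1,\dots,K^{L_n}\}$ is the family of wedges with length $C_1\log(n)l_n$, angle $\varphi_n$, vertex in $\mathcal G_n$ and direction in $\{e_n^1,\dots,e_n^{M_n}\}$. Index set. Let $m_n=(\log n)^{5/2}$. For a mode $x_0$, $\mathcal I_n$ is the set of indices $i$ of the wedges $K^i\in\mathcal K_n$ whose vertex $x_0^n$ fulfils $C_1\log(n)l_n\le\|x_0^n-x_0\|\le m_nC_1\log(n)l_n$ and whose direction $e^n$ fulfils $\mathrm{angle}(x_0^n-x_0,e^n)=O(\log(n)^{-1})$, i.e. the angle is at most $B/\log(n)$ for an arbitrary fixed constant $B>0$ not depending on $n$ or $i$. Statistics. Let $\beta(z)=(2z-1)\mathbf 1_{(0,1)}(z)$ and $\Gamma(\delta)=\sqrt{2\log(\exp(1)/\delta)}$. For a wedge $K$ with vertex $x_0$ and direction $e$, let $X_{(1)},\dots,X_{(N)}$ be the observations in $K$ ordered by increasing $P_e$, $X_{(0)}:=x_0$, $K_N=\{x\in K:0<P_ex\le P_eX_{(N)}\}$, and for $0\le j<k\le N$, $k-j>1$, $K(j,k):=\{x\in K:P_eX_{(j)}<P_ex\le P_eX_{(k)}\}$. $f$ is increasing on $K(j,k)$ if $f(x_0+\tilde t_2e_0)\ge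 f(x_0+\tilde t_1e_0)$ for all unit $e_0$ and $\tilde t_2>\tilde t_1\ge0$ with $x_0+\tilde t_\ell e_0\in K(j,k)$, $\ell=1,2$. Put $T_K=T_{K(0,N)}=\sum_{j=1}^{N-1}\beta\big((P_eX_{(j)})^d/(P_eX_{(N)})^d\big)$ and $$T^U_{K(j,k)}=\sum_{l=j+1}^{k-1}\beta\left(\frac{\tilde F(P_eX_{(l)})-\tilde F(P_eX_{(j)})}{\tilde F(P_eX_{(k)})-\tilde F(P_eX_{(j)})}\right),\qquad \tilde F(z)=\mathbb P(P_eX\le z\mid N,X\in K_N,X_{(N)}),$$ with $X$ of density $f$ independent of the sample. For $K^i$, $N^i$ is the number of observations in $K^i$, and all quantities are those belonging to $K^i$. Critical values. $\overline\kappa_n(\alpha)$ is the $(1-\alpha)$-quantile of the conditional distribution, given $N^1,\dots,N^{L_n}$, of $$\max_{i=1,\dots,L_n}\ \max_{0\le j_i<k_i\le N^i,\,k_i-j_i>1}\Big(\sqrt{\tfrac{3}{k_i-j_i-1}}\,|T^U_{K^i(j_i,k_i)}|-\Gamma\big(\tfrac{k_i-j_i}{n-1}\big)\Big),$$ and $\overline c_{K^i}(\alpha)=\sqrt{\frac{N^i-1}{3}}\big(\overline\kappa_n(\alpha)+\Gamma(\frac{N^i}{n-1})\big)$. The test for $K^i$ rejects only if $N^i\ge2$. *)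

(* Defs.v *)
From HB Require Import structures.
From mathcomp Require Import all_boot all_order all_algebra.
From mathcomp Require Import all_classical all_reals all_analysis.

Set Implicit Arguments.
Unset Strict Implicit.
Unset Printing Implicit Defensive.

Import Order.TTheory GRing.Theory Num.Theory.
Import numFieldNormedType.Exports.

Local Open Scope classical_set_scope.
Local Open Scope ring_scope.

(* R^d is 'rV[R]_d, with the product sigma-algebra generated by the coordinate
   maps and with the d-fold product lebesgue_rV of Lebesgue measure. *)

Section measurable_rV.
Context {R : realType} (d : nat).

Let coord : 'I_d -> 'rV[R]_d -> R := fun i x => x 0 i.

Let rV_set0 : g_sigma_preimage coord set0.
Proof. exact: sigma_algebra0. Qed.

Let rV_setC A : g_sigma_preimage coord A -> g_sigma_preimage coord (~` A).
Proof. exact: sigma_algebraC. Qed.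

Let rV_bigcup (F : (set 'rV[R]_d)^nat) :
  (forall i, g_sigma_preimage coord (F i)) ->
  g_sigma_preimage coord (\bigcup_i (F i)).
Proof. exact: sigma_algebra_bigcup. Qed.

HB.instance Definition _ := @isMeasurable.Build
  (measure_tuple_display default_measure_display) 'rV[R]_d
  (g_sigma_preimage coord) rV_set0 rV_setC rV_bigcup.

Lemma measurable_coord (i : 'I_d) :
  measurable_fun [set: 'rV[R]_d] (fun x : 'rV[R]_d => x 0 i : R).
Proof.
move=> _ Y mY; rewrite setTI; apply: sub_sigma_algebra => /=.
rewrite -bigcup_seq/=; exists i => /=; first by rewrite mem_index_enum.
by exists Y => //; rewrite setTI.
Qed.

Lemma measurable_fun_rV d' (T : measurableType d') (f : T -> 'rV[R]_d) :
  (forall i, measurable_fun setT (fun t => f t 0 i : R)) ->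
  measurable_fun [set: T] f.
Proof.
move=> mf _ A mA; rewrite setTI.
have : smallest (sigma_algebra setT)
  (\big[setU/set0]_(i < d) preimage_set_system setT (coord i) measurable) A.
  exact: mA.
move=> /(_ [set B | measurable (f @^-1` B)]); apply; split.
- split => /=; first by rewrite preimage_set0.
  + by move=> B mB; rewrite setTD preimage_setC; exact: measurableC.
  + by move=> F mF; rewrite preimage_bigcup; exact: bigcup_measurable.
- move=> B; rewrite -bigcup_seq => -[/= i _ [C mC <-]].
  rewrite setTI /=; have := mf i measurableT C mC; rewrite setTI; exact.
Qed.

End measurable_rV.

Section lebesgue_rV.
Context {R : realType}.

Definition rV_cons (d : nat) (p : R * 'rV[R]_d) : 'rV[R]_d.+1 :=
  row_mx p.1%:M p.2.

Fixpoint lebesgue_rV (d : nat) : set 'rV[R]_d -> \bar R :=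
  match d return set 'rV[R]_d -> \bar R with
  | 0 => dirac (0 : 'rV[R]_0)
  | d'.+1 => pushforward (lebesgue_measure \x @lebesgue_rV d')%E (@rV_cons d')
  end.

Lemma rV_consE0 d (p : R * 'rV[R]_d) : rV_cons p 0 ord0 = p.1.
Proof.
have -> : (ord0 : 'I_d.+1) = lshift d (ord0 : 'I_1) by exact/val_inj.
by rewrite [LHS](@row_mxEl R 1 1 d) mxE eqxx.
Qed.

Lemma rV_consES d (p : R * 'rV[R]_d) (i : 'I_d) :
  rV_cons p 0 (lift ord0 i) = p.2 0 i.
Proof.
have -> : lift ord0 i = rshift 1 i by exact/val_inj.
by rewrite [LHS](@row_mxEr R 1 1 d).
Qed.

Lemma measurable_rV_cons d : measurable_fun setT (@rV_cons d).
Proof.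
apply: measurable_fun_rV => i; case: (unliftP ord0 i) => [j|] ->.
- under eq_fun do rewrite rV_consES.
  apply: (measurableT_comp (measurable_coord j)); exact: measurable_snd.
- by under eq_fun do rewrite rV_consE0; exact: measurable_fst.
Qed.

Definition rV_uncons (d : nat) (x : 'rV[R]_d.+1) : R * 'rV[R]_d :=
  (x 0 ord0, \row_i x 0 (lift ord0 i)).

Lemma rV_unconsK d : cancel (@rV_uncons d) (@rV_cons d).
Proof.
move=> x; apply/rowP => i; case: (unliftP ord0 i) => [j|] ->.
- by rewrite rV_consES mxE.
- by rewrite rV_consE0.
Qed.

Lemma rV_consK d : cancel (@rV_cons d) (@rV_uncons d).
Proof.
move=> [a x]; rewrite /rV_uncons rV_consE0; congr pair.
by apply/rowP => i; rewrite mxE rV_consES.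
Qed.

Lemma measurable_rV_uncons d : measurable_fun setT (@rV_uncons d).
Proof.
apply/measurable_fun_pairP; split; first exact: measurable_coord.
apply: measurable_fun_rV => i; rewrite /=.
by under eq_fun do rewrite mxE; exact: measurable_coord.
Qed.

Lemma product_measure1_sigma_finite d1 d2 (T1 : measurableType d1)
    (T2 : measurableType d2) (m1 : {sigma_finite_measure set T1 -> \bar R})
    (m2 : {sigma_finite_measure set T2 -> \bar R}) :
  sigma_finite setT (m1 \x m2)%E.
Proof.
have /sigma_finiteP[F [TF ndF Foo]] := sigma_finiteT m1.
have /sigma_finiteP[G [TG ndG Goo]] := sigma_finiteT m2.
exists (fun n => F n `*` G n).
  rewrite -setXTT TF TG predeqE => -[x y]; split.
    move=> [/= [n _ Fnx] [k _ Gky]]; exists (maxn n k) => //; split.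
    - by move: x Fnx; exact/subsetPset/ndF/leq_maxl.
    - by move: y Gky; exact/subsetPset/ndG/leq_maxr.
  by move=> [n _ []/= ? ?]; split; exists n.
move=> k; have [? ?] := Foo k; have [? ?] := Goo k.
split; first exact: measurableX.
by rewrite product_measure1E// lte_mul_pinfty// ge0_fin_numE.
Qed.

Lemma lebesgue_rV_measure d :
  exists mu : {sigma_finite_measure set 'rV[R]_d -> \bar R},
    (mu : set 'rV[R]_d -> \bar R) = @lebesgue_rV d.
Proof.
elim: d => [|d [mu muE]].
  by exists (dirac (0 : 'rV[R]_0)).
pose pm : {measure set (measurableTypeR R * 'rV[R]_d)%type -> \bar R} :=
  (lebesgue_measure \x mu)%E.
pose nu : {measure set 'rV[R]_d.+1 -> \bar R} :=
  measure_function_pushforward__canonical__measure_function_Measure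
    pm (@measurable_rV_cons d).
have nu_sf : sigma_finite setT nu.
  have [F FT mF] := product_measure1_sigma_finite lebesgue_measure mu.
  exists (fun n => @rV_uncons d @^-1` F n).
    by rewrite -preimage_bigcup -FT preimage_setT.
  move=> n; have [mFn Fn_oo] := mF n; split.
    by rewrite -[X in measurable X]setTI; exact: measurable_rV_uncons.
  rewrite /nu /= /pushforward.
  suff -> : @rV_cons d @^-1` (@rV_uncons d @^-1` F n) = F n by [].
  by apply/seteqP; split=> p /=; rewrite rV_consK.
pose H := @Measure_isSigmaFinite.Build _ _ _ nu nu_sf.
pose nu' : {sigma_finite_measure set 'rV[R]_d.+1 -> \bar R} :=
  HB.pack (nu : set 'rV[R]_d.+1 -> \bar R) (Measure.class nu) H.
by exists nu'; rewrite /= -muE.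
Qed.

Let lebesgue_rV_0 d : @lebesgue_rV d set0 = 0%E.
Proof. by have [mu <-] := lebesgue_rV_measure d; exact: measure0. Qed.

Let lebesgue_rV_ge0 d A : (0 <= @lebesgue_rV d A)%E.
Proof. by have [mu <-] := lebesgue_rV_measure d; exact: measure_ge0. Qed.

Let lebesgue_rV_sigma_additive d : semi_sigma_additive (@lebesgue_rV d).
Proof.
by have [mu <-] := lebesgue_rV_measure d; exact: measure_semi_sigma_additive.
Qed.

HB.instance Definition _ d := isMeasure.Build _ _ _ (@lebesgue_rV d)
  (@lebesgue_rV_0 d) (@lebesgue_rV_ge0 d) (@lebesgue_rV_sigma_additive d).

Let lebesgue_rV_sigma_finite d : sigma_finite setT (@lebesgue_rV d).
Proof. by have [mu <-] := lebesgue_rV_measure d; exact: sigma_finiteT. Qed.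

HB.instance Definition _ d := Measure_isSigmaFinite.Build _ _ _ (@lebesgue_rV d)
  (@lebesgue_rV_sigma_finite d).

Lemma lebesgue_rV_box d (A : 'I_d -> set R) :
  (forall i, measurable (A i)) ->
  lebesgue_rV [set x : 'rV[R]_d | forall i, A i (x 0 i)] =
  (\prod_(i < d) lebesgue_measure (A i))%E.
Proof.
elim: d A => [|d IH] A mA.
  by rewrite big_ord0 /= diracE mem_set// => -[].
rewrite big_ord_recl -IH; last by move=> i; exact: mA.
rewrite /= /pushforward.
pose B := [set x : 'rV[R]_d | forall i, A (lift ord0 i) (x 0 i)].
have mB : measurable B.
  have -> : B = \bigcap_(i in [set: 'I_d])
      ((fun x : 'rV[R]_d => x 0 i) @^-1` A (lift ord0 i)).
    by apply/seteqP; split=> x /= H i; [move=> _|]; exact: H.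
  apply: fin_bigcap_measurable => // i _.
  by rewrite -[X in measurable X]setTI; exact: measurable_coord.
have <- := product_measure1E (@lebesgue_measure R) (@lebesgue_rV d) (mA ord0) mB.
suff -> : @rV_cons d @^-1` [set x | forall i, A i (x 0 i)] = A ord0 `*` B by [].
apply/seteqP; split=> -[a x] /=.
- move=> H; split; first by have := H ord0; rewrite rV_consE0.
  by move=> i; have := H (lift ord0 i); rewrite rV_consES.
- move=> [Ha H] i; case: (unliftP ord0 i) => [j|] ->.
  + by rewrite rV_consES.
  + by rewrite rV_consE0.
Qed.

End lebesgue_rV.

Section euclid.
Context {R : realType} {d : nat}.
Implicit Types x y e : 'rV[R]_d.

Definition dot x y : R := \sum_(i < d) x 0 i * y 0 i.

(* The library norm on 'rV[R]_d is the sup norm. *)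
Definition enorm x : R := Num.sqrt (dot x x).

Definition angle x y : R := acos (dot x y / (enorm x * enorm y)).

Definition gradient (g : 'rV[R]_d -> R) x : 'rV[R]_d :=
  \row_i 'D_(delta_mx 0 i) g x.

Definition is_mode (f : 'rV[R]_d -> R) (x0 : 'rV[R]_d) : Prop :=
  forall e, enorm e = 1 ->
    exists2 delta : R, 0 < delta &
      forall s t : R, 0 <= s -> s < t -> t < delta ->
        f (x0 + t *: e) < f (x0 + s *: e).

(* Only positive arguments of ft occur in the factorisation of f off x0, so the
   slope condition on ft is required as h decreases to 0; r is its o(1). *)
Definition radial_shape (f : 'rV[R]_d -> R) (c : R) (x0 : 'rV[R]_d) : Prop :=
  exists (g : 'rV[R]_d -> R) (ft : R -> R),
    [/\ (\forall x \near x0, f x = (1 + g x) * ft (enorm (x - x0))),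
        (\forall x \near x0, differentiable g x) /\
        g =o_ (x0^') (fun=> 1 : R),
        (exists2 gamma : R, 0 < gamma & forall e0, enorm e0 = 1 ->
          (fun x => dot (gradient g x) e0) =o_ (x0^')
            (fun x => enorm (x - x0) `^ (1 + gamma))),
        (\forall h \near (0 : R), derivable ft h 1) &
        exists2 r : R -> R, r h @[h --> 0^'+] --> (0 : R) &
          \forall h \near 0^'+, derive1 ft h <= - c * h * (1 + r h)].

End euclid.

Section density.
Context {R : realType} {d : nat}.
Context {disp : measure_display} {T : measurableType disp}.
Context (P : probability T R).

Definition has_density (X : {RV P >-> 'rV[R]_d}) (f : 'rV[R]_d -> R) : Prop :=
  [/\ measurable_fun setT f, forall x, 0 <= f x &
      forall A : set 'rV[R]_d, measurable A ->
        distribution P X A = (\int[@lebesgue_rV R d]_(x in A) (f x)%:E)%E].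

Definition independent_RV (n : nat) (X : 'I_n -> {RV P >-> 'rV[R]_d}) : Prop :=
  forall (J : {set 'I_n}) (A : 'I_n -> set 'rV[R]_d),
    (forall i, measurable (A i)) ->
    P (\bigcap_(i in [set` J]) X i @^-1` A i) =
    (\prod_(i in J) P (X i @^-1` A i))%E.

End density.

Section wedge.
Context {R : realType} {d : nat}.

(* The rows of [wframe] are the orthonormal basis e_1, ..., e_(d-1) of the
   orthogonal complement of the direction. *)
Record wedge := Wedge {
  wvertex : 'rV[R]_d;
  wdir : 'rV[R]_d;
  wframe : 'M[R]_(d.-1, d);
  wlen : R;
  wangle : R }.

Definition orthonormal_frame (e : 'rV[R]_d) (B : 'M[R]_(d.-1, d)) : Prop :=
  (forall i, dot (row i B) e = 0) /\
  (forall i j, dot (row i B) (row j B) = (i == j)%:R).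

Definition wproj (K : wedge) (x : 'rV[R]_d) : R := dot (x - wvertex K) (wdir K).

Definition in_wedge (K : wedge) (x : 'rV[R]_d) : bool :=
  (0 < wproj K x <= wlen K) &&
  [forall i : 'I_d.-1,
    - tan (wangle K) * wproj K x <= dot (x - wvertex K) (row i (wframe K))
      <= tan (wangle K) * wproj K x].

End wedge.
Arguments wedge : clear implicits.

Section statistics.
Context {R : realType} {d : nat} (f : 'rV[R]_d -> R).

Definition beta_score (z : R) : R := (2 * z - 1) * \1_`]0, 1[ z.

Definition Gamma_penalty (delta : R) : R := Num.sqrt (2 * ln (expR 1 / delta)).

Section one_wedge.
Context (n : nat) (K : wedge R d) (x : 'I_n -> 'rV[R]_d).

Definition obs_in : seq 'rV[R]_d :=
  sort (fun y z => wproj K y <= wproj K z)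
    [seq x i | i <- enum 'I_n & in_wedge K (x i)].

Definition nobs : nat := size obs_in.

(* X_(0) is the vertex, X_(1), ..., X_(N) are the sorted observations in K. *)
Definition ostat (j : nat) : 'rV[R]_d :=
  nth (wvertex K) (wvertex K :: obs_in) j.

Definition pstat (j : nat) : R := wproj K (ostat j).

Definition KN : set 'rV[R]_d :=
  [set y | in_wedge K y /\ 0 < wproj K y <= pstat nobs].

(* The law of the additional observation X, which is independent of the
   sample. *)
Definition law (A : set 'rV[R]_d) : R :=
  fine (\int[@lebesgue_rV R d]_(y in A) (f y)%:E)%E.

(* As X is independent of the sample, conditioning on N, X_(N) and X in K_N
   amounts to conditioning the law of X on the set K_N. *)
Definition Ftilde (z : R) : R :=
  law (KN `&` [set y | wproj K y <= z]) / law KN.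

Definition Tstat : R :=
  \sum_(1 <= j < nobs) beta_score (pstat j ^+ d / pstat nobs ^+ d).

Definition TUstat (j k : nat) : R :=
  \sum_(j.+1 <= l < k)
    beta_score ((Ftilde (pstat l) - Ftilde (pstat j)) /
              (Ftilde (pstat k) - Ftilde (pstat j))).

End one_wedge.

Section critical_values.
Context (n : nat) (I : finType) (K : I -> wedge R d).

Definition counts (x : 'I_n -> 'rV[R]_d) : {ffun I -> nat} :=
  [ffun i => nobs (K i) x].

(* The maximum is -oo if no wedge contains two observations. *)
Definition maxstat (x : 'I_n -> 'rV[R]_d) : \bar R :=
  \big[maxe/-oo%E]_(i : I)
   \big[maxe/-oo%E]_(jk : 'I_(nobs (K i) x).+1 * 'I_(nobs (K i) x).+1
                     | (1 < jk.2 - jk.1)%N)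
    (Num.sqrt (3 / (jk.2 - jk.1 - 1)%N%:R) * `|TUstat (K i) x jk.1 jk.2|
     - Gamma_penalty ((jk.2 - jk.1)%N%:R / (n%:R - 1)))%:E.

Context {disp : measure_display} {T : measurableType disp}.
Context (P : probability T R) (X : 'I_n -> {RV P >-> 'rV[R]_d}).

Definition sample (w : T) : 'I_n -> 'rV[R]_d := fun i => X i w.

(* The counts are discrete: this is an elementary conditional probability,
   with junk value 0 if {counts = nu} is a null set. *)
Definition cond_cdf (nu : {ffun I -> nat}) (t : R) : R :=
  fine (P [set w | counts (sample w) = nu /\ (maxstat (sample w) <= t%:E)%E]) /
  fine (P [set w | counts (sample w) = nu]).

(* If all counts are at most 1 then the conditional law is the point mass at
   -oo, and kappa is a junk value; no test rejects in this case. *)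
Definition kappa (alpha : R) (nu : {ffun I -> nat}) : R :=
  inf [set t | 1 - alpha <= cond_cdf nu t].

Definition critval (alpha : R) (w : T) (i : I) : R :=
  let N := (nobs (K i) (sample w))%:R in
  Num.sqrt ((N - 1) / 3) *
    (kappa alpha (counts (sample w)) + Gamma_penalty (N / (n%:R - 1))).

Definition rejects (alpha : R) (w : T) (i : I) : Prop :=
  (2 <= nobs (K i) (sample w))%N /\
  Tstat (K i) (sample w) < - critval alpha w i.

End critical_values.
End statistics.

Section family.
Context {R : realType} (d : nat) (C1 C2 eps : R).

Definition lscale (n : nat) : R := (ln n%:R / n%:R) `^ (d%:R + 4)^-1.

Definition wlength (n : nat) : R := C1 * ln n%:R * lscale n.

Definition wphi (n : nat) : R := C2 / 2 * (ln n%:R)^-1.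

Definition grid_step (n : nat) : R := (2 + eps) * wlength n.

Definition grid_size (n : nat) : nat :=
  `|Num.ceil (2 * n%:R / grid_step n : R)|%N.

Definition grid_point (n : nat) (k : {ffun 'I_d -> 'I_(grid_size n).+1}) :
    'rV[R]_d :=
  \row_j ((k j)%:R * grid_step n - n%:R).

Definition separation (n : nat) : R :=
  (2 + eps) * atan (Num.sqrt (d%:R - 1) * tan (wphi n)).

(* Directions are chosen one after the other, as long as possible. For d >= 2
   the separation is positive and forces the directions to be distinct; for
   d = 1 it is 0, and [uniq] makes the family consist of the two unit vectors. *)
Definition greedy_directions (n : nat) (es : seq 'rV[R]_d) : Prop :=
  [/\ {in es, forall e, enorm e = 1},
      uniq es,
      pairwise (fun e e' => separation n <= `|angle e' e|) es &
      forall e, enorm e = 1 -> e \notin es ->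
        exists2 e', e' \in es & `|angle e e'| < separation n].

Context (frame : 'rV[R]_d -> 'rV[R]_d -> 'M[R]_(d.-1, d)).
Context (dirs : nat -> seq 'rV[R]_d).

Definition windex (n : nat) : finType :=
  ({ffun 'I_d -> 'I_(grid_size n).+1} * 'I_(size (dirs n)))%type.

Definition wedge_of (n : nat) (i : windex n) : wedge R d :=
  let v := grid_point i.1 in
  let e := (dirs n)`_i.2 in
  Wedge v e (frame v e) (wlength n) (wphi n).

Definition mscale (n : nat) : R := ln n%:R `^ (5 / 2).

(* The implied constant of angle = O(1 / log n) is B. *)
Definition near_mode (B : R) (x0 : 'rV[R]_d) (n : nat) (i : windex n) : bool :=
  let K := wedge_of i in
  [&& wlength n <= enorm (wvertex K - x0),
      enorm (wvertex K - x0) <= mscale n * wlength n &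
      angle (wvertex K - x0) (wdir K) <= B / ln n%:R].

End family.

Definition Dconst {R : realType} (d : nat) : R :=
  let d' := d%:R in
  2 * Num.sqrt 2 * (2 * d' + 1) * (d' + 1) /
  ((1 - d' / (d' + 1)) `^ ((d' + 1) / d') *
   Num.sqrt (1 - d' ^+ 2 / (2 * (2 * d' + 1) ^+ 2) *
                 (-1 + Num.sqrt (1 + 4 * ((2 * d' + 1) / d') ^+ 2)))).

(* Main.v *)
(* Write t = ln n. There are polynomially many wedges, so by Chernoff's bound and
   a union bound, outside an event of vanishing probability every slab of every
   wedge between two k/n-quantiles of P_e X contains n p + O(t (sqrt (n p) + t))
   observations, where p is its probability. Then the transformed order
   statistics are nearly equidistant, so the scores almost cancel and every
   multiscale statistic is at most 1000 t^2. Markov's inequality over the counts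
   turns this into the bound 1000 t^2 for the conditional critical value.

   A wedge of length L pointing away from the mode is homogeneous, so the
   distribution function of P_e X is z^d b(z), where b averages f over the
   wedge rescaled to length z. The shape condition makes f decrease with slope
   at least c' ||x - x0|| >= c' L there, because the radial slope dominates
   that of g and the rays of a narrow wedge are nearly radial. Hence b
   decreases at rate of order L, the order statistics are closer to the vertex
   than those of the uniform distribution, and T_K is below a negative multiple
   of N L^2. As n L^(d+4) = C1^(d+4) t^(d+5) and the unit wedge has volume of
   order t^(-d), this is of order at least t^(5/2) sqrt N, which beats the
   critical value of order t^2 sqrt N. *)
Require Import Defs.
From HB Require Import structures.
From mathcomp Require Import all_boot all_order all_algebra.
From mathcomp Require Import all_classical all_reals all_analysis.
From mathcomp Require Import measurable_realfun ring lra zify.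

Set Implicit Arguments.
Unset Strict Implicit.
Unset Printing Implicit Defensive.

Import Order.TTheory GRing.Theory Num.Theory.
Import numFieldNormedType.Exports.

Local Open Scope classical_set_scope.
Local Open Scope ring_scope.

(** * Chernoff bounds *)

(** A union bound cannot run over slabs whose end points are order statistics. The slabs are
    therefore cut at quantile points fixed before sampling, (n + 1)^2 pairs for each wedge, and each
    P_e X_(j) is enclosed afterwards between neighbouring quantiles; this costs at most 1 on the
    scale n G, where G is the distribution function of P_e X in the wedge. On the resulting event
    all claims about a sample are deterministic inequalities. A deviation at t = ln n has
    probability at most 2 exp(-(ln n)^2), which is below every power of 1/n.

    The conditional law given the counts is never computed: only its distribution function at a =
    1000 t^2 enters, through an average over the finitely many vectors of counts. *)

Section binomial_tail.
Context {R : realType}.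
Implicit Types (p t lam m : R) (n : nat).

Lemma card_setCn n (J : {set 'I_n}) : #|~: J| = (n - #|J|)%N.
Proof. by rewrite cardsCs finset.setCK card_ord. Qed.

(** The probability that a binomial variable satisfies Q, summed over the set of successes rather
    than their number; this matches the disjoint events obtained from independence. *)
Definition binom_tail n p (Q : pred nat) : R :=
  \sum_(J : {set 'I_n} | Q #|J|) p ^+ #|J| * (1 - p) ^+ (n - #|J|).

(** Invert 1 - lam <= exp(-lam) and use (1 - lam)(1 + lam + 2 lam^2) = 1 + lam^2 (1 - 2 lam) >= 1.
    Every negative lam is allowed, as the lower tail requires. *)
Lemma expR_le_quad lam : lam <= 1 / 2 -> expR lam <= 1 + lam + 2 * lam ^+ 2.
Proof.
move=> lam2.
have h : 1 - lam <= (expR lam)^-1 by rewrite -expRN expR_ge1Dx.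
have lam1 : 0 < 1 - lam by lra.
rewrite -[expR lam]invrK -[leRHS]invrK lef_pV2 ?posrE ?invr_gt0 ?expR_gt0//; last first.
  by nra.
apply: le_trans h.
rewrite invf_ple ?posrE//; last by nra.
rewrite -[leLHS]mul1r ler_pdivrMr//; nra.
Qed.

(** Exponential Markov inequality: [bigA_distr] expands the product of the factors p e^lam + 1 - p
    over subsets, and each factor is at most exp(p (e^lam - 1)). As the sign of lam is free, both
    tails are covered. *)
Lemma binom_tail_expR n p (Q : pred nat) lam m :
  0 <= p <= 1 -> (forall k, Q k -> m <= lam * k%:R) ->
  binom_tail n p Q <= expR (n%:R * (p * (expR lam - 1)) - m).
Proof.
move=> /andP[p0 p1] Qm; have q0 : 0 <= 1 - p by rewrite subr_ge0.
have -> : n%:R * (p * (expR lam - 1)) - m = - m + n%:R * (p * (expR lam - 1)).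
  by rewrite addrC.
rewrite expRD.
apply: (@le_trans _ _ (expR (- m) * \prod_(i < n) (p * expR lam + (1 - p)))); last first.
  rewrite ler_wpM2l ?expR_ge0// prodr_const card_ord.
  rewrite [n%:R * _]mulrC expRM_natr lerXn2r ?nnegrE ?expR_ge0//.
    by rewrite addr_ge0// mulr_ge0// expR_ge0.
  by apply: le_trans (expR_ge1Dx _); rewrite mulrBr mulr1; lra.
rewrite (bigA_distr _ +%R) mulr_sumr /binom_tail big_mkcond/=; apply: ler_sum => J _.
rewrite big_if/= !prodr_const.
have -> : #|[pred i in 'I_n | i \in J]| = #|J| by apply: eq_card => i; rewrite !inE.
have -> : #|[pred i in 'I_n | i \notin J]| = (n - #|J|)%N.
  rewrite -card_setCn; apply: eq_card => i; rewrite !inE//.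
rewrite exprMn -expRM_natr.
case: ifPn => [QJ|_]; last first.
  by rewrite mulr_ge0 ?expR_ge0// !mulr_ge0 ?expR_ge0 ?exprn_ge0.
rewrite mulrA ler_wpM2r ?exprn_ge0// mulrCA -[leLHS]mulr1 ler_wpM2l ?exprn_ge0//.
by rewrite -expRD; apply: le_trans (expR_ge1Dx _); rewrite lerDl addrC subr_ge0; exact: Qm.
Qed.

(** Bernstein form of the bound. The summand t next to the standard deviation keeps lam <= 1/2 even
    when n p is small. *)
Lemma binom_tail_dev n p t : 0 <= p <= 1 -> 0 < t ->
  binom_tail n p (fun k =>
    3 * t * (Num.sqrt (n%:R * p) + t) <= `|k%:R - n%:R * p|)
  <= 2 * expR (- t ^+ 2).
Proof.
move=> p01 t0; have /andP[p0 p1] := p01.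
set s := Num.sqrt _; have s0 : 0 <= s by rewrite sqrtr_ge0.
have sE : n%:R * p = s ^+ 2 by rewrite sqr_sqrtr// mulr_ge0.
have st0 : 0 < s + t by rewrite ltr_wpDl.
set a := 3 * t * _.
(* This lam makes the Chernoff exponent at most - t^2 for either sign. *)
pose lam := t / (2 * (s + t)).
have lam0 : 0 < lam by rewrite divr_gt0// mulr_gt0.
have lamE : lam * (s + t) = t / 2 by rewrite /lam; field; rewrite gt_eqF.
have lama : lam * a = 3 / 2 * t ^+ 2 by rewrite /a mulrCA lamE; field.
have lams : lam * s <= t / 2 by rewrite -lamE ler_wpM2l ?(ltW lam0)// lerDl (ltW t0).
have lamh : lam <= 1 / 2.
  by rewrite -(ler_pM2r st0) lamE; lra.
have key (sg : R) : sg ^+ 2 = 1 ->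
    binom_tail n p (fun k => a <= sg * (k%:R - n%:R * p)) <= expR (- t ^+ 2).
  move=> sg2.
  have sgle : sg * lam <= 1 / 2.
    have : (sg == 1) || (sg == -1) by rewrite -sqrf_eq1 sg2.
    by case/orP => /eqP ->; lra.
  have := @binom_tail_expR n p (fun k => a <= sg * (k%:R - n%:R * p))
    (sg * lam) (lam * a + sg * lam * (n%:R * p)) p01.
  move=> /(_ _)/le_trans; apply.
    move=> k /(ler_wpM2l (ltW lam0)); set x := n%:R * p; lra.
  rewrite ler_expR.
  have := expR_le_quad sgle; rewrite exprMn sg2 mul1r => el.
  have H : n%:R * (p * (expR (sg * lam) - 1)) <=
         s ^+ 2 * (sg * lam + 2 * lam ^+ 2).
    by rewrite mulrA sE ler_wpM2l ?sqr_ge0//; lra.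
  have : (lam * s) ^+ 2 <= (t / 2) ^+ 2.
    have h0 : 0 <= lam * s by rewrite mulr_ge0 ?(ltW lam0).
    by rewrite lerXn2r// nnegrE (le_trans h0).
  rewrite lama sE exprMn; lra.
apply: (@le_trans _ _ (binom_tail n p (fun k => a <= 1 * (k%:R - n%:R * p)) +
   binom_tail n p (fun k => a <= -1 * (k%:R - n%:R * p)))).
  rewrite /binom_tail [X in X <= _]big_mkcond [X in _ <= X + _]big_mkcond [X in _ <= _ + X]big_mkcond.
  rewrite -big_split/=; apply: ler_sum => J _.
  have z : 0 <= p ^+ #|J| * (1 - p) ^+ (n - #|J|).
    by rewrite mulr_ge0 ?exprn_ge0// subr_ge0.
  rewrite mul1r mulN1r ler_normr.
  by do !case: ifPn => //=; rewrite ?addr0 ?add0r ?lerDl ?lerDr ?addr_ge0.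
rewrite mulr2n mulrDl mul1r lerD// key// ?sqrrN ?expr1n//.
Qed.

End binomial_tail.

Lemma measure_bigsetU_le d (T : measurableType d) (R : realType)
    (mu : {measure set T -> \bar R}) (I : Type) (s : seq I) (Q : pred I)
    (F : I -> set T) : (forall i, measurable (F i)) ->
  (mu (\big[setU/set0]_(i <- s | Q i) F i) <= \sum_(i <- s | Q i) mu (F i))%E.
Proof.
move=> mF; elim: s => [|i s IH]; first by rewrite !big_nil measure0.
rewrite !big_cons; case: ifP => // _.
apply: le_trans (measureU2 _ _ _) _ => //; first exact: bigsetU_measurable.
by rewrite leeD2l.
Qed.

Definition hits {R : realType} d n (A : set 'rV[R]_d) (x : 'I_n -> 'rV[R]_d) : nat :=
  \sum_(i < n) (x i \in A).

Section iid_hits.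
Context {R : realType} {d : nat} {disp : measure_display}
  {T : measurableType disp} (P : probability T R) (n : nat)
  (X : 'I_n -> {RV P >-> 'rV[R]_d}).

Lemma hitsE A w : hits A (sample X w) = #|[set i | X i w \in A]%SET|.
Proof. by rewrite /hits -sum1dep_card [RHS]big_mkcond; apply: eq_bigr => i _; case: ifP. Qed.

Lemma measurable_hit A i : measurable A -> measurable (X i @^-1` A).
Proof.
by move=> mA; rewrite -[X in measurable X]setTI; exact: measurable_funP.
Qed.

Lemma measurable_hits A (Q : pred nat) : measurable A ->
  measurable [set w | Q (hits A (sample X w))].
Proof.
move=> mA.
have -> : [set w | Q (hits A (sample X w))] = \bigcup_(J in [set J : {set 'I_n} | Q #|J|])
    \bigcap_(i in [set: 'I_n]) X i @^-1` (if i \in J then A else ~` A).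
  apply/seteqP; split => w /=.
    rewrite hitsE => Qw; exists [set i | X i w \in A]%SET => // i _ /=.
    by rewrite inE; case: ifPn => [/set_mem|/negP h hA]//; apply: h; exact/mem_set.
  move=> [J QJ JX]; rewrite hitsE /=; suff -> : [set i | X i w \in A]%SET = J by [].
  apply/setP => i; rewrite inE; have /= := JX i Logic.I.
  by case: (i \in J) => [/mem_set|]// h; apply/negP => /set_mem.
apply: fin_bigcup_measurable => // J _; apply: fin_bigcap_measurable => // i _.
by apply: measurable_hit; case: ifP => // _; exact: measurableC.
Qed.

Lemma hits_binom_tail A p (Q : pred nat) : independent_RV X -> measurable A ->
  (forall i, P (X i @^-1` A) = p%:E) ->
  (P [set w | Q (hits A (sample X w))] <= (binom_tail n p Q)%:E)%E.
Proof.
move=> indep mA PA.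
(* J is the exact set of indices that hit A, so the index i contributes A or its complement, and
   independence is applied to all n indices. *)
pose E (J : {set 'I_n}) : set T :=
  \bigcap_(i in [set` [set: 'I_n]%SET]) X i @^-1` (if i \in J then A else ~` A).
have mE J : measurable (E J).
  apply: fin_bigcap_measurable => // i _.
  by apply: measurable_hit; case: ifP => // _; exact: measurableC.
have PE J : P (E J) = (p ^+ #|J| * (1 - p) ^+ (n - #|J|))%:E.
  rewrite /E indep; last by move=> i; case: ifP => // _; exact: measurableC.
  under eq_bigl do rewrite inE.
  rewrite (eq_bigr (fun i => (if i \in J then p else 1 - p)%:E)); last first.
    move=> i _; case: ifPn => _ //; rewrite preimage_setC probability_setC ?PA//.
    exact: measurable_hit.
  rewrite prodEFin big_if/= !prodr_const; congr (_%:E).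
  congr (_ ^+ _ * _ ^+ _).
  by rewrite -card_setCn; apply: eq_card => i; rewrite !inE.
apply: (@le_trans _ _ (P (\big[setU/set0]_(J : {set 'I_n} | Q #|J|) E J))).
  apply: le_measure; rewrite ?inE.
  - exact: measurable_hits.
  - exact: bigsetU_measurable.
  - move=> w /= Qw; rewrite -bigcup_seq_cond.
    exists [set i | X i w \in A]%SET; first by rewrite /= mem_index_enum -hitsE.
    move=> i _ /=; rewrite inE.
    by case: ifPn => [/set_mem|/negP h hA]//; apply: h; exact/mem_set.
rewrite /binom_tail -sumEFin (eq_bigr (fun J => P (E J))); last first.
  by move=> J _; rewrite PE.
exact: measure_bigsetU_le.
Qed.

Lemma hits_dev A p t : independent_RV X -> measurable A ->
  (forall i, P (X i @^-1` A) = p%:E) -> 0 <= p <= 1 -> 0 < t ->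
  (P [set w | (3 * t * (Num.sqrt (n%:R * p) + t) <=
               `|(hits A (sample X w))%:R - n%:R * p|)%R]
   <= (2 * expR (- t ^+ 2))%:E)%E.
Proof.
move=> indep mA PA p01 t0.
apply: le_trans (hits_binom_tail (fun k =>
  3 * t * (Num.sqrt (n%:R * p) + t) <= `|k%:R - n%:R * p|) indep mA PA) _.
by rewrite lee_fin binom_tail_dev.
Qed.

End iid_hits.

(** * Order statistics *)

Section order_statistics.
Context {R : realType}.

(** In a sorted list the entries at most z form an initial segment. This duality turns bounds on
    counts into bounds on order statistics. *)
Lemma nth_sorted_le_count (s : seq R) (z : R) (j : nat) :
  sorted <=%R s -> (j < size s)%N ->
  (nth 0 s j <= z) = (j < count (fun y : R => (y <= z)%R) s)%N.
Proof.
elim: s j => //= y s IH j ps js.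
have ss : sorted <=%R s := path_sorted ps.
have [yz|zy] := leP y z; rewrite /=.
  by case: j js => [|j] js //=; rewrite IH// add1n ltnS.
have allgt : {in y :: s, forall x, z < x}.
  move=> x; rewrite inE => /predU1P[->//|xs].
  move: ps; rewrite (path_sortedE le_trans) => /andP[/allP/(_ _ xs) yx _].
  exact: lt_le_trans yx.
have -> : count (fun x : R => (x <= z)%R) s = 0%N.
  apply/eqP; rewrite -leqn0 leqNgt -has_count; apply/hasPn => x xs.
  by rewrite -ltNge allgt// inE xs orbT.
by rewrite addn0 ltn0; apply/negbTE; rewrite -ltNge allgt// mem_nth.
Qed.

Context {d n : nat} (K : wedge R d) (x : 'I_n -> 'rV[R]_d).

Lemma dot0l (y : 'rV[R]_d) : dot 0 y = 0.
Proof. by rewrite /dot big1// => i _; rewrite mxE mul0r. Qed.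

Lemma wproj_vertex : wproj K (wvertex K) = 0.
Proof. by rewrite /wproj subrr dot0l. Qed.

Definition pobs : seq R := [seq wproj K y | y <- obs_in K x].

Lemma pstatE j : pstat K x j = nth 0 (0 :: pobs) j.
Proof.
rewrite /pstat /ostat /pobs -[X in nth 0 (X :: _)]wproj_vertex.
have [js|js] := ltnP j (size (wvertex K :: obs_in K x)).
  by rewrite -(nth_map (wvertex K) 0 (wproj K) js).
by rewrite !nth_default ?wproj_vertex//= size_map.
Qed.

Lemma pobs_sorted : sorted <=%R pobs.
Proof.
rewrite /pobs sorted_map /obs_in; apply: sort_sorted => y z.
exact: le_total.
Qed.

Lemma size_pobs : size pobs = nobs K x. Proof. by rewrite size_map. Qed.

Definition below (z : R) : set 'rV[R]_d :=
  [set y | in_wedge K y /\ wproj K y <= z].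

Lemma count_pobs z : count (fun y : R => (y <= z)%R) pobs = hits (below z) x.
Proof.
rewrite /pobs count_map /obs_in.
rewrite (permP (permEl (perm_sort _ _))) count_map count_filter.
rewrite /hits -sum1_count big_mkcond/= big_enum/=.
apply: eq_bigr => i _; case: ifPn => [/andP[/= h1 h2]|h].
  by rewrite mem_set.
rewrite memNset// => -[h1 h2]; move/negP: h; apply.
by rewrite /= h1 h2.
Qed.

Lemma pstat0 : pstat K x 0 = 0. Proof. by rewrite pstatE. Qed.

Lemma pstat_le z j : (0 < j <= nobs K x)%N ->
  (pstat K x j <= z) = (j <= hits (below z) x)%N.
Proof.
case: j => // j /= jN; rewrite pstatE/= nth_sorted_le_count ?size_pobs//.
  by rewrite count_pobs.
exact: pobs_sorted.
Qed.

Lemma pstat_default j : (nobs K x < j)%N -> pstat K x j = 0.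
Proof. by move=> Nj; rewrite pstatE nth_default//= size_pobs. Qed.

Lemma mem_pobs y : y \in pobs -> 0 < y <= wlen K.
Proof.
move=> /mapP[z zo ->]; move: zo; rewrite mem_sort => /mapP[i].
by rewrite mem_filter => /andP[/andP[]] + _ _ ->.
Qed.

Lemma pstat_gt0 j : (0 < j <= nobs K x)%N -> 0 < pstat K x j.
Proof.
case: j => // j /= jN; rewrite pstatE/=.
by have /mem_pobs/andP[] : nth 0 pobs j \in pobs by rewrite mem_nth// size_pobs.
Qed.

Lemma pstat_itv j : 0 < wlen K -> 0 <= pstat K x j <= wlen K.
Proof.
move=> L0; have [jN|jN] := leqP j (nobs K x); last first.
  by rewrite pstat_default// lexx ltW.
case: j jN => [|j] jN; first by rewrite pstat0 lexx ltW.
rewrite pstatE/=.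
have /mem_pobs/andP[/ltW->//] : nth 0 pobs j \in pobs.
by rewrite mem_nth// size_pobs.
Qed.

Lemma pstat_mono i j : (i <= j <= nobs K x)%N -> pstat K x i <= pstat K x j.
Proof.
move=> /andP[ij jN]; rewrite !pstatE.
have s0 : sorted <=%R (0 :: pobs).
  rewrite /= (path_sortedE le_trans) pobs_sorted andbT.
  by apply/allP => y /mem_pobs/andP[/ltW].
by apply: (sorted_leq_nth le_trans lexx _ s0); rewrite ?inE/= ?size_pobs ?ltnS// (leq_trans ij).
Qed.

Lemma hits_below0 : hits (below 0) x = 0%N.
Proof.
rewrite -count_pobs; apply/eqP; rewrite -leqn0 leqNgt -has_count.
by apply/hasPn => y /mem_pobs/andP[y0 _]; rewrite -ltNge.
Qed.

Lemma hits_below_len : hits (below (wlen K)) x = nobs K x.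
Proof.
by rewrite -count_pobs -size_pobs; apply/eqP; rewrite -all_count; apply/allP => y /mem_pobs/andP[].
Qed.

Definition slab (a b : R) : set 'rV[R]_d :=
  [set y | in_wedge K y /\ a < wproj K y <= b].

Lemma hits_slab a b : a <= b ->
  (hits (slab a b) x + hits (below a) x)%N = hits (below b) x.
Proof.
move=> ab; rewrite /hits -big_split/=; apply: eq_bigr => i _.
have slabE y : (y \in slab a b) = in_wedge K y && (a < wproj K y <= b).
  by apply/idP/idP => [/set_mem[-> ->]//|/andP[h1 h2]]; exact/mem_set.
have belowE c y : (y \in below c) = in_wedge K y && (wproj K y <= c).
  by apply/idP/idP => [/set_mem[-> ->]//|/andP[h1 h2]]; exact/mem_set.
rewrite slabE !belowE; case: in_wedge => //=.
have [h|h] := leP (wproj K (x i)) a; last by rewrite addn0.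
by rewrite (le_trans h ab).
Qed.

End order_statistics.

(** * Order statistics from counts at quantile points *)

Section quantiles.
Context {R : realType}.
Implicit Types (t a b : R).

(** The Chernoff threshold with the observed count m in place of its mean; the constant 25 pays for
    this exchange and for rounding to the grid of quantiles. *)
Definition dev t (m : nat) : R := 25 * t * (Num.sqrt m%:R + t).

Lemma dev_mono t m m' : 0 <= t -> (m <= m')%N -> dev t m <= dev t m'.
Proof.
move=> t0 mm; rewrite ler_wpM2l ?mulr_ge0// lerD2r ler_wsqrtr// ler_nat//.
Qed.

Lemma dev_ge0 t m : 0 <= t -> 0 <= dev t m.
Proof. by move=> t0; rewrite !mulr_ge0// addr_ge0// sqrtr_ge0. Qed.

(** The assumed bound forces sqrt s <= sqrt m + 5 t: otherwise s - 3 t sqrt s would exceed m + 10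
    t^2. Replacing sqrt s then costs 15 t^2, and 15 + 19/2 <= 25. *)
Lemma dev_of_sqrt t m s : 1 <= t -> 0 <= s ->
  `|m%:R - s| <= 3 * t * Num.sqrt s + 19 / 2 * t ^+ 2 -> `|m%:R - s| <= dev t m.
Proof.
move=> t1 s0; rewrite /dev.
have ssE : s = Num.sqrt s ^+ 2 by rewrite sqr_sqrtr.
have mE : m%:R = Num.sqrt (m%:R : R) ^+ 2 by rewrite sqr_sqrtr.
set y := Num.sqrt s in ssE *; set v := Num.sqrt _ in mE *.
have y0 : 0 <= y by rewrite sqrtr_ge0.
have v0 : 0 <= v by rewrite sqrtr_ge0.
move=> H; apply: (le_trans H).
have : s - m%:R <= 3 * t * y + 19 / 2 * t ^+ 2.
  by apply: le_trans H; rewrite distrC ler_norm.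
rewrite ssE mE => {}H.
have yv : y <= v + 5 * t.
  rewrite leNgt; apply/negP => h.
  have : (v + 5 * t) * (v + 2 * t) < y * (y - 3 * t).
    by apply: ltr_pM => //; lra.
  nra.
nra.
Qed.

(** The level must lie strictly below u, since G may be constant on intervals: only a strict
    inequality between levels orders the underlying points. At level 0 this is impossible, but there
    the count is 0 anyway. *)
Lemma grid_below (n : nat) (g u : R) : 0 <= u <= g -> g <= 1 -> (0 < n)%N ->
  exists a : nat, [/\ (a <= n)%N, a = 0%N \/ Num.min (a%:R / n%:R) g < u &
    n%:R * u - 1 <= n%:R * Num.min (a%:R / n%:R) g].
Proof.
move=> /andP[u0 ug] g1 n0; have n0' : 0 < n%:R :> R by rewrite ltr0n.
have [->|un0] := eqVneq u 0.
  exists 0%N; split => //; first by left.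
  by rewrite mulr0 mul0r min_l ?mulr0 ?(le_trans u0)//; lra.
have {}u0 : 0 < u by rewrite lt_neqAle eq_sym un0.
pose c := Num.ceil (n%:R * u).
have c0 : 0 < c by rewrite ceil_gt0 mulr_gt0.
have [c1 c2] : c%:~R - 1 < n%:R * u /\ n%:R * u <= c%:~R.
  by have := ceil_itv (n%:R * u); rewrite intrB => /andP[].
have cE : (`|c|%N%:R = c%:~R :> R) by rewrite natr_absz gtr0_norm.
have c1E : (`|c|.-1)%N%:R = c%:~R - 1 :> R.
  by rewrite -cE -subn1 natrB// absz_gt0 gt_eqF.
have qu : (`|c|.-1)%:R / n%:R < u.
  by rewrite ltr_pdivrMr// mulrC c1E.
exists `|c|.-1; split.
- rewrite -(ler_nat R) c1E ltW//; apply: lt_le_trans c1 _.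
  by rewrite -[leRHS]mulr1 ler_wpM2l//; lra.
- by right; rewrite gt_min qu.
- rewrite min_l; last by rewrite (le_trans (ltW qu)).
  by rewrite mulrCA divff ?gt_eqF// mulr1 c1E; lra.
Qed.

Lemma grid_above (n : nat) (g u : R) : 0 <= u <= g -> g <= 1 -> (0 < n)%N ->
  exists b : nat, [/\ (b <= n)%N, b = n \/ u < Num.min (b%:R / n%:R) g &
    n%:R * Num.min (b%:R / n%:R) g <= n%:R * u + 1].
Proof.
move=> /andP[u0 ug] g1 n0; have n0' : 0 < n%:R :> R by rewrite ltr0n.
have nu0 : 0 <= n%:R * u by rewrite mulr_ge0.
have /andP[c1 c2] := truncn_itv nu0.
set c := Num.truncn _ in c1 c2.
have uc : u < c.+1%:R / n%:R by rewrite ltr_pdivlMr// mulrC.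
have cu : n%:R * (c.+1%:R / n%:R) <= n%:R * u + 1.
  by rewrite mulrCA divff ?gt_eqF// mulr1 -natr1; lra.
(* Beyond the total mass g no level is strictly above u; the index n, whose point is the end of the
   wedge, takes over. *)
have [gc|cg] := leP g (c.+1%:R / n%:R).
  exists n; split => //; first by left.
  apply: le_trans cu; rewrite ler_wpM2l// ge_min; apply/orP; right => //.
exists c.+1; split.
- rewrite -(ler_nat R); rewrite -[leRHS]mulr1 mulrC -ler_pdivrMr//.
  exact: ltW (lt_le_trans cg g1).
- by right; rewrite lt_min uc (lt_trans uc).
- by apply: le_trans cu; rewrite ler_wpM2l// ge_min lexx.
Qed.

End quantiles.

(** Truncation at the mass g of the wedge lets the same indices 0, ..., n serve all wedges. *)
Definition level {R : realType} (n : nat) (g : R) (k : nat) : R :=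
  Num.min (k%:R / n%:R) g.

(* [zz k] stands for a point at which the distribution function of P_e X takes
   the value [level n g k]. *)
Definition balanced {R : realType} (n : nat) (t g : R) (cnt : R -> nat)
    (zz : nat -> R) : Prop :=
  forall k l, (k <= l <= n)%N ->
    `|((cnt (zz l))%:R - (cnt (zz k))%:R) - n%:R * (level n g l - level n g k)|
    <= 3 * t * (Num.sqrt (n%:R * (level n g l - level n g k)) + t).

Section quantile_property.
Context {R : realType} (n N : nat) (t g L : R).
Context (cnt : R -> nat) (G : R -> R) (p : nat -> R) (zz : nat -> R).
Hypothesis n0 : (0 < n)%N.
Hypothesis t1 : 1 <= t.
Hypothesis g1 : g <= 1.
Hypothesis G_mono : forall a b, 0 <= a -> a <= b -> b <= L -> G a <= G b.
Hypothesis G0 : G 0 = 0.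
Hypothesis GL : G L = g.
Hypothesis p0 : p 0 = 0.
Hypothesis p_itv : forall j, 0 <= p j <= L.
Hypothesis p_mono : forall i j, (i <= j <= N)%N -> p i <= p j.
Hypothesis cnt0 : cnt 0 = 0%N.
Hypothesis cntL : cnt L = N.
Hypothesis p_cnt : forall z j, (0 < j <= N)%N -> (p j <= z) = (j <= cnt z)%N.
Hypothesis zz_itv : forall k, (k <= n)%N -> 0 <= zz k <= L.
Hypothesis zz0 : zz 0 = 0.
Hypothesis zzn : zz n = L.
Hypothesis Gzz : forall k, (k <= n)%N -> G (zz k) = level n g k.
Hypothesis bal : balanced n t g cnt zz.

Let u j := G (p j).

Let u_itv j : 0 <= u j <= g.
Proof.
have /andP[pj0 pL] := p_itv j.
by rewrite /u -{1}G0 -GL; apply/andP; split; apply: G_mono.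
Qed.

Let level_lt k j : (k <= n)%N -> level n g k < u j -> zz k < p j.
Proof.
move=> kn; rewrite -Gzz// => h; rewrite ltNge; apply/negP => pz.
by have /andP[pj0 _] := p_itv j; have /andP[_ zL] := zz_itv kn; move: h; rewrite ltNge G_mono.
Qed.

Let lt_level k j : (k <= n)%N -> u j < level n g k -> p j < zz k.
Proof.
move=> kn; rewrite -Gzz// => h; rewrite ltNge; apply/negP => pz.
by have /andP[_ pL] := p_itv j; have /andP[z0 _] := zz_itv kn; move: h; rewrite ltNge G_mono.
Qed.

Let cnt_le k j : (k <= n)%N -> (j <= N)%N -> k = 0%N \/ level n g k < u j ->
  (cnt (zz k) <= j)%N.
Proof.
move=> kn jN [->|/(level_lt kn) h]; first by rewrite zz0 cnt0.
case: j jN h => [|j] jN h.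
  by exfalso; move: h; rewrite p0 ltNge; have /andP[->] := zz_itv kn.
by rewrite ltnW// ltnNge -p_cnt ?jN// -ltNge.
Qed.

Let le_cnt k j : (k <= n)%N -> (j <= N)%N -> k = n \/ u j < level n g k ->
  (j <= cnt (zz k))%N.
Proof.
move=> kn jN [->|/(lt_level kn) h]; first by rewrite zzn cntL.
by case: j jN h => // j jN h; rewrite -p_cnt ?jN// ltW.
Qed.

Let level_mono k l : (k <= l)%N -> level n g k <= level n g l.
Proof.
move=> kl; rewrite /level le_min !ge_min lexx orbT andbT.
by rewrite ler_pM2r ?invr_gt0 ?ltr0n// ler_nat kl.
Qed.

Let u_mono i j : (i <= j <= N)%N -> u i <= u j.
Proof.
move=> h; have /andP[pi0 _] := p_itv i; have /andP[_ pjL] := p_itv j.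
by apply: G_mono => //; exact: p_mono.
Qed.

Let sqrtD2 (s : R) : 0 <= s -> Num.sqrt (s + 2) <= Num.sqrt s + 3 / 2.
Proof.
move=> s0; have := sqrtr_ge0 s; have := sqr_sqrtr s0; set y := Num.sqrt s => yE y0.
have h : 0 <= y + 3 / 2 by lra.
rewrite -[leRHS](ger0_norm h) -sqrtr_sqr ler_wsqrtr//; nra.
Qed.

Let level_le k j : k = 0%N \/ level n g k < u j -> level n g k <= u j.
Proof.
case=> [->|/ltW//]; have /andP[uj0 _] := u_itv j.
by rewrite /level mul0r ge_min uj0.
Qed.

Let le_level k j : k = n \/ u j < level n g k -> u j <= level n g k.
Proof.
case=> [->|/ltW//]; have /andP[_ ujg] := u_itv j.
by rewrite /level divff ?pnatr_eq0 ?gtn_eqF// le_min ujg (le_trans ujg).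
Qed.

(** Enclose u j and u l between neighbouring levels and apply [bal] to these. Rounding changes s by
    at most 2, which gives 3 t (sqrt s + 3/2 + t) + 2 <= 3 t sqrt s + 19/2 t^2. *)
Lemma quantile_dev j l : (j <= l <= N)%N ->
  `|(l - j)%:R - n%:R * (u l - u j)| <= dev t (l - j).
Proof.
move=> jlN; have /andP[jl lN] := jlN; have jN := leq_trans jl lN.
have n0' : 0 < n%:R :> R by rewrite ltr0n.
have ujl := u_mono jlN.
have jl' : j%:R <= l%:R :> R by rewrite ler_nat.
set s := n%:R * _; have s0 : 0 <= s by rewrite mulr_ge0// subr_ge0.
have sE : s = n%:R * u l - n%:R * u j by rewrite /s mulrBr.
have y0 := sqrtr_ge0 s.
have t0 : 0 <= t by apply: le_trans t1.
have ty0 : 0 <= t * Num.sqrt s by rewrite mulr_ge0.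
have tt : t <= t ^+ 2 by rewrite expr2 ler_peMl.
have t1' : (1 : R) <= t := t1.
apply: dev_of_sqrt => //; rewrite natrB// ler_norml; apply/andP; split.
(* Lower bound on l - j: levels just inside the interval from u j to u l. If they cross, then s <= 2
   and the bound is trivial. *)
- have [a [an aP aE]] := grid_above (u_itv j) g1 n0.
  have [b [bn bP bE]] := grid_below (u_itv l) g1 n0.
  have ja := le_cnt an jN aP; have bl := cnt_le bn lN bP.
  have [ab|ba] := leqP a b; last first.
    have := level_mono (ltnW ba); rewrite /level -(ler_pM2l n0') => lba.
    lra.
  have := bal (introT andP (conj ab bn)).
  rewrite ler_norml => /andP[+ _].
  set S := n%:R * (_ - _) => hS.
  have SE : S = n%:R * level n g b - n%:R * level n g a by rewrite /S mulrBr.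
  have Ss : S <= s.
    by rewrite SE sE lerB// ler_wpM2l ?(ltW n0')// ?level_le ?le_level.
  have tS : t * Num.sqrt S <= t * Num.sqrt s.
    by rewrite ler_wpM2l ?ler_wsqrtr.
  have sS : s - 2 <= S by rewrite SE sE /level; lra.
  have c1 : j%:R <= (cnt (zz a))%:R :> R by rewrite ler_nat.
  have c2 : (cnt (zz b))%:R <= l%:R :> R by rewrite ler_nat.
  lra.
(* Upper bound on l - j: levels just outside; these cannot cross. *)
- have [a [an aP aE]] := grid_below (u_itv j) g1 n0.
  have [b [bn bP bE]] := grid_above (u_itv l) g1 n0.
  have ja := cnt_le an jN aP; have bl := le_cnt bn lN bP.
  have ab : (a <= b)%N.
    rewrite leqNgt; apply/negP => ba.
    case: aP => [a0|aP]; first by rewrite a0 in ba.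
    case: bP => [bn'|bP]; first by rewrite bn' ltnNge an in ba.
    have := level_mono (ltnW ba); rewrite leNgt => /negP; apply.
    exact: lt_trans aP (le_lt_trans ujl bP).
  have := bal (introT andP (conj ab bn)).
  rewrite ler_norml => /andP[_ +].
  set S := n%:R * (_ - _) => hS.
  have SE : S = n%:R * level n g b - n%:R * level n g a by rewrite /S mulrBr.
  have sS : S <= s + 2 by rewrite SE sE /level; lra.
  have tS : t * Num.sqrt S <= t * (Num.sqrt s + 3 / 2).
    rewrite ler_wpM2l ?(le_trans (ler_wsqrtr sS)) ?sqrtD2//.
  have c1 : (cnt (zz a))%:R <= j%:R :> R by rewrite ler_nat.
  have c2 : l%:R <= (cnt (zz b))%:R :> R by rewrite ler_nat.
  nra.
Qed.

End quantile_property.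

(** * Sums of scores *)

Section score_bounds.
Context {R : realType}.
Implicit Types (a E : R) (v : nat -> R).

(** At z = 1 the score 0 lies below 2 z - 1 = 1; at z = 0 it would lie above, hence the strict lower
    bound. *)
Lemma beta_score_le z : 0 < z <= 1 -> @beta_score R z <= 2 * z - 1.
Proof.
move=> /andP[z0]; rewrite le_eqVlt /beta_score indicE => /predU1P[->|z1].
  by rewrite memNset/= ?mulr0; [lra|rewrite in_itv/= ltxx andbF].
by rewrite mem_set ?mulr1//= in_itv/= z0.
Qed.

Lemma beta_score_dev z : 0 <= z <= 1 ->
  `|@beta_score R z - (2 * z - 1)| <= (z == 0)%:R + (z == 1)%:R.
Proof.
move=> /andP[z0 z1]; rewrite /beta_score indicE.
have [->|zn0] := eqVneq z 0.
  rewrite memNset/= ?in_itv/= ?ltxx// !mulr0 !sub0r opprK normr1 eq_sym oner_eq0.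
  by rewrite addr0.
have [->|zn1] := eqVneq z 1.
  rewrite memNset/= ?in_itv/= ?ltxx ?andbF// mulr0 sub0r.
  by rewrite normrN mulr1 [X in `|X|](_ : _ = 1) ?normr1 ?add0r//; ring.
rewrite mem_set/= ?in_itv/= ?mulr1 ?subrr ?normr0 ?addr0//.
by rewrite !lt_neqAle zn1 z1 z0 eq_sym zn0.
Qed.

(** The second bound carries the induction: when the new term counts, m + 1 <= a, and the sum is at
    most m + 1. *)
Lemma sum_indic_le a m : 0 <= a ->
  \sum_(1 <= i < m.+1) (i%:R <= a)%R%:R <= a /\
  \sum_(1 <= i < m.+1) (i%:R <= a)%R%:R <= m%:R :> R.
Proof.
move=> a0; elim: m => [|m [IH1 IH2]]; first by rewrite big_geq.
rewrite big_nat_recr//=; case: (leP m.+1%:R a) => ma; rewrite ?addr0/=.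
  have h : \sum_(1 <= i < m.+1) (i%:R <= a)%R%:R + 1%:R <= m.+1%:R :> R.
    by rewrite -[leRHS]natr1 lerD2r.
  by split; [exact: le_trans h ma|].
by split=> //; apply: le_trans IH2 _; rewrite ler_nat.
Qed.

Lemma sum_score_sym m : \sum_(1 <= i < m.+1) (2 * i%:R - m.+1%:R) = 0 :> R.
Proof.
have h k : \sum_(1 <= i < k.+1) (2 * i%:R : R) = k%:R * k.+1%:R.
  elim: k => [|k IH]; first by rewrite big_geq// mul0r.
  by rewrite big_nat_recr//= IH -!natr1; ring.
by rewrite big_split/= h sumr_const_nat subSS subn0 mulNrn -[X in _ - X]mulr_natl subrr.
Qed.

(* Near-equidistance makes the ratio within 2E/M of i/M, and the scores of the
   equidistant points cancel. *)
Lemma sum_score_le (n M : nat) v E : (0 < M)%N -> 0 <= E ->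
  (forall i, (i <= M)%N -> v 0%N <= v i <= v M) ->
  (forall i, (i <= M)%N -> `|i%:R - n%:R * (v i - v 0%N)| <= E) ->
  `|\sum_(1 <= i < M) beta_score ((v i - v 0%N) / (v M - v 0%N))| <= 8 * E.
Proof.
case: M => // m _ E0 vm vE; set M := m.+1 in vm vE *.
set D := v M - v 0%N.
(* If the interval has mass 0, division by 0 makes every argument 0, where the score vanishes. *)
have [D0|Dn0] := eqVneq D 0.
  rewrite big1 ?normr0 ?mulr_ge0// => i _.
  rewrite D0 invr0 mulr0 /beta_score indicE memNset ?mulr0//=.
  by rewrite in_itv/= ltxx.
have D0 : 0 < D by rewrite lt_neqAle eq_sym Dn0 subr_ge0; have /andP[] := vm _ (leqnn M).
pose y i := (v i - v 0%N) / D.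
have y01 i : (i <= M)%N -> 0 <= y i <= 1.
  move=> iM; have /andP[v0 v1] := vm _ iM.
  rewrite /y ler_pdivrMr// mul1r lerD2r v1 andbT.
  by rewrite divr_ge0 ?(ltW D0)// subr_ge0.
have M0 : 0 < M%:R :> R by rewrite ltr0n.
have yE i : (i <= M)%N -> `|M%:R * y i - i%:R| <= 2 * E.
  move=> iM; have /andP[yi0 yi1] := y01 _ iM.
  have e1 := vE _ iM; have e2 := vE _ (leqnn M).
  have -> : M%:R * y i - i%:R = (M%:R - n%:R * D) * y i - (i%:R - n%:R * (v i - v 0%N)).
    by rewrite /y; field; rewrite gt_eqF.
  have -> : 2 * E = E + E by ring.
  rewrite (le_trans (ler_normB _ _))// lerD//.
  rewrite normrM (ger0_norm yi0); apply: le_trans e2.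
  by rewrite -[leRHS]mulr1 ler_wpM2l.
have H1 : `|\sum_(1 <= i < M) (2 * y i - 1)| <= 4 * E.
  rewrite -(ler_pM2l M0) -[X in X * `|_|](ger0_norm (ltW M0)) -normrM mulr_sumr.
  rewrite (eq_big_nat _ _ (F2 := fun i => 2 * (M%:R * y i - i%:R) + (2 * i%:R - M%:R))); last first.
    by move=> i _; ring.
  rewrite big_split/= sum_score_sym addr0 (le_trans (ler_norm_sum _ _ _))//.
  apply: (@le_trans _ _ (\sum_(1 <= i < M) (4 * E))).
    rewrite big_nat [leRHS]big_nat; apply: ler_sum => i /andP[_ iM].
    by rewrite normrM ger0_norm//; have := yE _ (ltnW iM); lra.
  rewrite sumr_const_nat -[leLHS]mulr_natl ler_wpM2r ?mulr_ge0// ler_nat leq_subr//.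
(* The score differs from 2 y - 1 only where y i is 0 or 1; such an i lies within 2E of 0 or of M,
   which leaves at most 2E indices at each end. *)
have H2 : `|\sum_(1 <= i < M) (beta_score (y i) - (2 * y i - 1))| <= 4 * E.
  rewrite (le_trans (ler_norm_sum _ _ _))//.
  apply: (@le_trans _ _ (\sum_(1 <= i < M) ((i%:R <= 2 * E)%R%:R + ((M - i)%:R <= 2 * E)%R%:R))).
    rewrite big_nat [leRHS]big_nat; apply: ler_sum => i /andP[_ iM].
    apply: le_trans (beta_score_dev (y01 _ (ltnW iM))) _.
    have := yE _ (ltnW iM); have [->|_] := eqVneq (y i) 0.
      rewrite eq_sym oner_eq0 addr0 mulr0 sub0r normrN ger0_norm// => ->.
      by rewrite lerDl.
    have [->|_] := eqVneq (y i) 1; last by rewrite addr0 addr_ge0.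
    rewrite mulr1 -natrB ?(ltnW iM)// ger0_norm// => ->.
    by rewrite add0r lerDr.
  rewrite big_split/=.
  have [s1 _] := @sum_indic_le (2 * E) m (mulr_ge0 (ler0n _ 2) E0).
  have -> : \sum_(1 <= i < M) ((M - i)%:R <= 2 * E)%R%:R = \sum_(1 <= i < M) (i%:R <= 2 * E)%R%:R :> R.
    rewrite big_nat_rev/= big_nat [RHS]big_nat; apply: eq_bigr => i /andP[i1 iM].
    by rewrite add1n subSS subKn// ltnW.
  lra.
have -> : \sum_(1 <= i < M) beta_score (y i) =
   \sum_(1 <= i < M) (beta_score (y i) - (2 * y i - 1)) + \sum_(1 <= i < M) (2 * y i - 1).
  by rewrite -big_split/=; apply: eq_bigr => i _; rewrite subrK.
by rewrite (le_trans (ler_normD _ _))//; lra.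
Qed.

End score_bounds.

Lemma law_ge0 {R : realType} {d : nat} (f : 'rV[R]_d -> R) A :
  (forall y, 0 <= f y) -> 0 <= law f A.
Proof. by move=> f0; apply: fine_ge0; apply: integral_ge0 => y _; rewrite lee_fin. Qed.

(** * Deterministic bounds for the multiscale statistics *)

Section interval_statistics.
Context {R : realType} {d : nat} (f : 'rV[R]_d -> R) (n : nat)
  (K : wedge R d) (x : 'I_n -> 'rV[R]_d) (t : R).

Let N := nobs K x.
Let p := pstat K x.
Let u j := law f (below K (p j)).

Definition quantile_close : Prop := forall j l, (j <= l <= N)%N ->
  `|(l - j)%:R - n%:R * (u l - u j)| <= dev t (l - j).

Lemma KN_below z : z <= p N -> KN K x `&` [set y | wproj K y <= z] = below K z.
Proof.
move=> zN; apply/seteqP; split=> y /=; first by move=> [[]].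
move=> [yK yz]; split=> //; split=> //; rewrite (le_trans yz)// andbT.
by move: yK => /andP[/andP[]].
Qed.

Lemma Ftilde_pstat l : (l <= N)%N -> Ftilde f K x (p l) = u l / u N.
Proof.
move=> lN; rewrite /Ftilde KN_below; last by apply: pstat_mono; rewrite lN leqnn.
congr (_ / law f _); rewrite -(KN_below (lexx _)); apply/seteqP; split=> y /=.
  by move=> h; split=> //; case: h => _ /andP[].
by case.
Qed.

Hypothesis t1 : (1 : R) <= t.
Hypothesis u_mono : forall i j, (i <= j <= N)%N -> u i <= u j.
Hypothesis uQ : quantile_close.

Hypothesis f0 : forall y, 0 <= f y.

Let u_ge0 j : 0 <= u j.
Proof. exact: law_ge0. Qed.

Lemma TUstat_le j k : (j < k <= N)%N -> `|TUstat f K x j k| <= 8 * dev t (k - j).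
Proof.
move=> /andP[jk kN]; have t0 : 0 <= t by apply: le_trans t1.
rewrite /TUstat -[j.+1]addn1 addnC big_addn.
rewrite (eq_big_nat _ _ (F2 := fun i => beta_score
   ((u (i + j)%N - u (0 + j)%N) / (u (k - j + j)%N - u (0 + j)%N)))); last first.
  move=> i /andP[_ ik]; rewrite add0n subnK ?(ltnW jk)//.
  have ijk : (i + j <= k)%N by lia.
  rewrite !Ftilde_pstat ?(leq_trans _ kN)// ?(ltnW jk)//.
  rewrite -!mulrBl invfM mulrACA invrK; congr beta_score.
  (* The normalisation by u N cancels from the ratio; if u N = 0, then all u vanish by monotonicity
     and both ratios are 0. *)
  have [uN0|uN0] := eqVneq (u N) 0; last by rewrite mulVf// mulr1.
  have uz i' : (i' <= N)%N -> u i' = 0.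
    by move=> iN; apply/eqP; rewrite eq_le u_ge0 andbT -uN0 u_mono// iN leqnn.
  by rewrite !uz ?subrr ?mul0r// ?(leq_trans _ kN)// ltnW.
apply: (@sum_score_le R n (k - j) (fun i => u (i + j)%N)).
- by rewrite subn_gt0.
- exact: dev_ge0.
- by move=> i ik; rewrite !u_mono//; lia.
- move=> i ik; have := uQ (j := j) (l := i + j); rewrite addnK add0n.
  move=> /(_ _)/le_trans; apply; first by lia.
  by apply: dev_mono.
Qed.

(** The prefactor offsets the square root in [dev]: as k - j <= 2 (k - j - 1), their product is at
    most 3, and the prefactor itself at most 2. What remains is 200 t (3 + 2 t) <= 1000 t^2. *)
Lemma TUstat_scaled j k : (j < k <= N)%N -> (1 < k - j)%N ->
  Num.sqrt (3 / (k - j - 1)%N%:R) * `|TUstat f K x j k| <= 1000 * t ^+ 2.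
Proof.
move=> jkN kj; have t0 : 0 <= t by apply: le_trans t1.
have m0 : 0 < (k - j - 1)%:R :> R by rewrite ltr0n subn_gt0.
have := TUstat_le jkN; move/(ler_wpM2l (sqrtr_ge0 (3 / (k - j - 1)%N%:R))) => /le_trans; apply.
set s := Num.sqrt _.
have s2 : s <= 2.
  rewrite -[leRHS]ger0_norm// -sqrtr_sqr ler_wsqrtr// ler_pdivrMr//.
  have : 1 <= (k - j - 1)%:R :> R by rewrite ler1n subn_gt0.
  lra.
have sk : s * Num.sqrt (k - j)%:R <= 3.
  rewrite -sqrtrM ?divr_ge0// ?(ltW m0)// -[leRHS]ger0_norm// -sqrtr_sqr ler_wsqrtr//.
  rewrite mulrAC ler_pdivrMr// -[(3 : R) in leLHS]/(3%:R) -!natrX -!natrM ler_nat; lia.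
rewrite /dev; have -> : s * (8 * (25 * t * (Num.sqrt (k - j)%:R + t))) =
  200 * t * (s * Num.sqrt (k - j)%:R + s * t) by ring.
have s0 : 0 <= s by apply: sqrtr_ge0.
have st : s * t <= 2 * t by rewrite ler_wpM2r.
have t1' : (1 : R) <= t by [].
have : 200 * t * (s * Num.sqrt (k - j)%:R + s * t) <= 200 * t * (3 + 2 * t).
  by rewrite ler_wpM2l ?mulr_ge0// lerD.
move=> /le_trans; apply; nra.
Qed.

End interval_statistics.

Lemma maxstat_le {R : realType} {d : nat} (f : 'rV[R]_d -> R) (n : nat)
    (I : finType) (K : I -> wedge R d) (x : 'I_n -> 'rV[R]_d) (a : R) :
  (maxstat f K x <= a%:E)%E <->
  forall i (jk : 'I_(nobs (K i) x).+1 * 'I_(nobs (K i) x).+1), (1 < jk.2 - jk.1)%N ->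
    Num.sqrt (3 / (jk.2 - jk.1 - 1)%N%:R) * `|TUstat f (K i) x jk.1 jk.2|
     - Gamma_penalty ((jk.2 - jk.1)%N%:R / (n%:R - 1)) <= a.
Proof.
split=> [H i jk jkP|H]; last first.
  apply/bigmax_leP; split; first exact: leNye.
  by move=> i _; apply/bigmax_leP; split; [exact: leNye|move=> jk jkP; rewrite lee_fin H].
rewrite -lee_fin; apply: le_trans H.
by apply: le_trans (le_bigmax_cond _ _ _) => //; apply: le_bigmax_cond.
Qed.

Section signal.
Context {R : realType} {d : nat} (f : 'rV[R]_d -> R) (n : nat)
  (K : wedge R d) (x : 'I_n -> 'rV[R]_d).

Let N := nobs K x.
Let p := pstat K x.

(* r plays the role of G(p_j)/G(p_N), and the ratio of b(p_N) = G(p_N)/p_N^d to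
   b(p_j) is at most 1 - theta (p_N - p_j): each is at most the share of an
   equidistant sample, shrunk by the decrease of the density. *)
Lemma Tstat_le (r : nat -> R) (theta E : R) : (0 < d)%N -> (12 <= N)%N ->
  0 <= theta -> 0 <= E -> 2 * E <= N%:R / 8 ->
  (forall j, (0 < j < N)%N -> 0 <= r j) ->
  (forall j, (0 < j < N)%N -> `|N%:R * r j - j%:R| <= 2 * E) ->
  (forall j, (0 < j < N)%N ->
     p j ^+ d / p N ^+ d <= r j * (1 - theta * (p N - p j))) ->
  Tstat K x <= 4 * E - theta * N%:R * p N / (128 * d%:R).
Proof.
move=> d0 N12 th0 E0 EN r0 rE pr.
have N0 : 0 < N%:R :> R by rewrite ltr0n (leq_trans _ N12).
have pN0 : 0 < p N by apply: pstat_gt0; rewrite leqnn andbT (leq_trans _ N12).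
have pj0 j : (0 < j < N)%N -> 0 < p j <= p N.
  move=> /andP[j0 jN]; rewrite pstat_gt0 ?j0 1?ltnW//= pstat_mono// ltnW//=.
have d0' : 0 < d%:R :> R by rewrite ltr0n.
pose w j := r j * (p N - p j).
have w0 j : (0 < j < N)%N -> 0 <= w j.
  by move=> jN; rewrite mulr_ge0 ?r0// subr_ge0; have /andP[] := pj0 _ jN.
have H1 : \sum_(1 <= j < N) (2 * r j - 1) <= 4 * E.
  rewrite -(ler_pM2l N0) mulr_sumr.
  rewrite (eq_big_nat _ _ (F2 := fun j => 2 * (N%:R * r j - j%:R) + (2 * j%:R - N%:R))); last first.
    by move=> i _; ring.
  rewrite big_split/=; have := @sum_score_sym R N.-1; rewrite prednK ?(leq_trans _ N12)// => ->.
  rewrite addr0; apply: (@le_trans _ _ (\sum_(1 <= i < N) (4 * E))).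
    rewrite big_nat [leRHS]big_nat; apply: ler_sum => i iN.
    by have := rE _ iN; rewrite ler_norml => /andP[_]; lra.
  by rewrite sumr_const_nat -[leLHS]mulr_natl ler_wpM2r ?mulr_ge0// ler_nat leq_subr.
(* Only the middle third of the indices is used. It has h >= N/4 members, each with r j >= 1/8 and p
   N - p j >= p N / (8 d). *)
have H2 : N%:R * p N / (256 * d%:R) <= \sum_(1 <= j < N) w j.
  have [h [h1 hN hN']] : exists h, [/\ (4 <= h)%N, (h * 3 <= N)%N & (N < h.+1 * 3)%N].
    by exists (N %/ 3)%N; rewrite leq_trunc_div ltn_ceil// leq_divRL.
  have hhN : (h + h <= N)%N by clear -h1 hN; lia.
  have hN1 : (h <= N)%N by clear -h1 hN; lia.
  rewrite (big_cat_nat (n := h) (leq_trans _ h1) hN1)//=.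
  rewrite [X in _ + X](big_cat_nat (n := h + h) (leq_addr _ _) hhN)/=.
  have s1 : 0 <= \sum_(1 <= i < h) w i.
    by rewrite big_nat; apply: sumr_ge0 => i /andP[i1 ih]; rewrite w0// i1 (leq_trans ih).
  have s2 : 0 <= \sum_(h + h <= i < N) w i.
    rewrite big_nat; apply: sumr_ge0 => i /andP[ih iN]; rewrite w0// iN andbT.
    by clear -h1 ih; lia.
  suff : N%:R * p N / (256 * d%:R) <= \sum_(h <= i < h + h) w i by lra.
  apply: (@le_trans _ _ (\sum_(h <= i < h + h) (1 / 8 * (p N / (8 * d%:R))))).
    rewrite sumr_const_nat addnK -[leRHS]mulr_natl.
    have -> : N%:R * p N / (256 * d%:R) = N%:R / 4 * (1 / 8 * (p N / (8 * d%:R))).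
      by field; rewrite gt_eqF.
    rewrite ler_wpM2r ?mulr_ge0 ?invr_ge0// ?(ltW pN0)//.
    by rewrite ler_pdivrMr// -natrM ler_nat; clear -h1 hN'; lia.
  rewrite big_nat [leRHS]big_nat; apply: ler_sum => j hj.
  have jN : (0 < j < N)%N by clear -hj h1 hhN; lia.
  have rj := rE _ jN; rewrite ler_norml in rj; have /andP[rj1 rj2] := rj.
  have jl : N%:R <= 4 * j%:R :> R by rewrite -natrM ler_nat; clear -hj hN' h1; lia.
  have ju : 3 * j%:R <= 2 * N%:R :> R by rewrite -!natrM ler_nat; clear -hj hN h1; lia.
  have r1 : 1 / 8 <= r j by rewrite -(ler_pM2l N0); lra.
  have r2 : r j <= 7 / 8 by rewrite -(ler_pM2l N0); lra.
  have /andP[pj1 pj2] := pj0 _ jN.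
  apply: ler_pM => //; first by rewrite divr_ge0// ?mulr_ge0// ltW.
  (* Were p j closer to p N, Bernoulli's inequality would give (p j / p N)^d > (1 - 1/(8d))^d >=
     7/8, whereas this ratio is at most r j <= 7/8. *)
  rewrite lerBrDr -lerBrDl leNgt; apply/negP => hlt.
  have hq : 1 - (8 * d%:R)^-1 < p j / p N.
    by rewrite ltr_pdivlMr// mulrBl mul1r mulrC.
  have d8 : (8 * d%:R)^-1 <= 1 :> R.
    rewrite invf_le1 ?mulr_gt0// ; have : 1 <= d%:R :> R by rewrite ler1n.
    lra.
  have : (1 - (8 * d%:R)^-1) ^+ d < (p j / p N) ^+ d.
    by rewrite ltrXn2r -?lt0n// subr_ge0.
  rewrite expr_div_n ltNge => /negP; apply.
  apply: (le_trans (pr _ jN)).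
  apply: (@le_trans _ _ (r j)).
    rewrite -[leRHS]mulr1 ler_wpM2l ?r0// lerBlDr lerDl mulr_ge0// subr_ge0//.
  apply: (le_trans r2).
  have bern m (y : R) : 0 <= y <= 1 -> 1 - m%:R * y <= (1 - y) ^+ m.
    move=> /andP[y0 y1]; elim: m => [|m IH]; first by rewrite mul0r subr0 expr0.
    rewrite exprS -natr1.
    have : (1 - y) * (1 - m%:R * y) <= (1 - y) * (1 - y) ^+ m.
      by rewrite ler_wpM2l// subr_ge0.
    have : 0 <= m%:R * (y * y) by rewrite !mulr_ge0.
    lra.
  apply: le_trans (bern d _ _); last by rewrite d8 invr_ge0 mulr_ge0.
  have -> : d%:R * (8 * d%:R)^-1 = 1 / 8 :> R by field; rewrite gt_eqF.
  lra.
have : Tstat K x <= \sum_(1 <= j < N) ((2 * r j - 1) + (- (2 * theta)) * w j).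
  rewrite /Tstat big_nat [leRHS]big_nat; apply: ler_sum => j jN.
  have /andP[pj1 pj2] := pj0 _ jN.
  apply: (@le_trans _ _ (2 * (p j ^+ d / p N ^+ d) - 1)).
    apply: beta_score_le; rewrite divr_gt0 ?exprn_gt0//= ler_pdivrMr ?exprn_gt0// mul1r.
    by rewrite lerXn2r// nnegrE ltW.
  have := pr _ jN; rewrite /w; lra.
move=> /le_trans; apply; rewrite big_split/= -mulr_sumr.
have := ler_wpM2l th0 H2.
have -> : theta * N%:R * p N / (128 * d%:R) = 2 * (theta * (N%:R * p N / (256 * d%:R))).
  by field; rewrite gt_eqF.
lra.
Qed.

End signal.

(** * Geometry and volume of wedges *)

Section affine_change_of_variables.
Context {R : realType}.

Lemma measurable_affine1 (a z : R) :
  measurable_fun [set: measurableTypeR R] (fun y : measurableTypeR R => a + z * y : measurableTypeR R).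
Proof.
apply: measurable_funD; first exact: measurable_cst.
by apply: measurable_funM; [exact: measurable_cst|exact: measurable_id].
Qed.

Lemma lebesgue_affine1 (a z : R) (A : set (measurableTypeR R)) : 0 < z ->
  measurable A ->
  (z%:E * lebesgue_measure ((fun y : measurableTypeR R => (a + z * y)%R : measurableTypeR R) @^-1` A) =
   lebesgue_measure A)%E.
Proof.
move=> z0 mA.
pose mu : {measure set (measurableTypeR R) -> \bar R} :=
  mscale (NngNum (ltW z0)) (measure_function_pushforward__canonical__measure_function_Measure
     (@lebesgue_measure R) (measurable_affine1 a z)).
symmetry; apply: (@lebesgue_measure_unique R mu) mA => X /ocitvP[->|].
  by rewrite !measure0.
move=> [[b c] /= bc ->].
rewrite /mu/= /mscale/= /pushforward/=.
have -> : (fun y : R => a + z * y) @^-1` `]b, c] = [set` `](b - a) / z, (c - a) / z]].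
  apply/seteqP; split=> y /=; rewrite !in_itv/= ltr_pdivrMr// ler_pdivlMr//.
    by rewrite ltrBlDr lerBrDr ![z * y]mulrC ![_ + a]addrC.
  by rewrite ltrBlDr lerBrDr ![z * y]mulrC ![_ + a]addrC.
rewrite !lebesgue_measure_itv/= !lte_fin bc.
rewrite ltr_pM2r ?invr_gt0// ltrD2r bc -!EFinB -EFinM; congr EFin.
by field; rewrite gt_eqF.
Qed.

Definition affine {d} (v : 'rV[R]_d) (z : R) (y : 'rV[R]_d) : 'rV[R]_d := v + z *: y.

Lemma affineE d (v : 'rV[R]_d) z y i : affine v z y 0 i = v 0 i + z * y 0 i.
Proof. by rewrite !mxE. Qed.

Lemma measurable_affine d (v : 'rV[R]_d) z : measurable_fun setT (affine v z).
Proof.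
apply: measurable_fun_rV => i.
under eq_fun do rewrite affineE.
apply: measurable_funD; first exact: measurable_cst.
by apply: measurable_funM; [exact: measurable_cst|exact: measurable_coord].
Qed.

(** Through [rV_cons] the map splits into its action on the first coordinate and on the others;
    uniqueness of product measures reduces the claim to rectangles, where induction applies. *)
Lemma lebesgue_rV_affine d (v : 'rV[R]_d) (z : R) (A : set 'rV[R]_d) :
  0 < z -> measurable A ->
  ((z ^+ d)%:E * lebesgue_rV (affine v z @^-1` A) = lebesgue_rV A)%E.
Proof.
move=> z0; elim: d v A => [|d IH] v A mA.
  rewrite expr0 mul1e /=; congr dirac.
  by apply/seteqP; split=> y /=; rewrite (_ : affine v z y = y)//; apply/rowP => -[].
rewrite /= /pushforward.
pose S (p : measurableTypeR R * 'rV[R]_d) : measurableTypeR R * 'rV[R]_d :=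
  (v 0 ord0 + z * p.1, affine (rV_uncons v).2 z p.2).
have mS : measurable_fun setT S.
  apply/measurable_fun_pairP; split.
    exact: (measurableT_comp (measurable_affine1 (v 0 ord0) z) measurable_fst).
  exact: (measurableT_comp (measurable_affine (rV_uncons v).2 z) measurable_snd).
have SE p : affine v z (rV_cons p) = rV_cons (S p).
  apply/rowP => i; rewrite affineE; case: (unliftP ord0 i) => [j|] ->.
    by rewrite !rV_consES affineE mxE.
  by rewrite !rV_consE0.
pose pm : {measure set (measurableTypeR R * 'rV[R]_d)%type -> \bar R} :=
  (lebesgue_measure \x @lebesgue_rV R d)%E.
have zd0 : 0 <= z ^+ d.+1 by rewrite exprn_ge0// ltW.
pose m' : {measure set (measurableTypeR R * 'rV[R]_d)%type -> \bar R} :=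
  mscale (NngNum zd0) (measure_function_pushforward__canonical__measure_function_Measure
     pm mS).
have m'E : forall X, measurable X -> (lebesgue_measure \x @lebesgue_rV R d)%E X = m' X.
  apply: product_measure_unique => B C mB mC.
  rewrite /m'/= /mscale/= /pushforward.
  have -> : S @^-1` (B `*` C) =
      ((fun y : measurableTypeR R => (v 0 ord0 + z * y)%R : measurableTypeR R) @^-1` B) `*`
      (affine (rV_uncons v).2 z @^-1` C) by [].
  rewrite /pm/= product_measure1E; last 2 first.
  - by rewrite -[X in measurable X]setTI; exact: measurable_affine1.
  - by rewrite -[X in measurable X]setTI; exact: measurable_affine.
  rewrite exprS EFinM muleACA (lebesgue_affine1 _ z0 mB).
  by rewrite [X in (_ * X)%E](IH _ _ mC).
have -> : @rV_cons R d @^-1` (affine v z @^-1` A) = S @^-1` (@rV_cons R d @^-1` A).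
  by apply/seteqP; split=> p /=; rewrite SE.
have mcA : measurable (@rV_cons R d @^-1` A).
  by rewrite -[X in measurable X]setTI; exact: measurable_rV_cons.
by have /= -> := m'E _ mcA.
Qed.

Lemma integral_affine d (v : 'rV[R]_d) (z : R) (A : set 'rV[R]_d) (f : 'rV[R]_d -> \bar R) :
  0 < z -> measurable A -> measurable_fun A f -> (forall y, 0 <= f y)%E ->
  (\int[@lebesgue_rV R d]_(x in A) f x =
   (z ^+ d)%:E * \int[@lebesgue_rV R d]_(y in affine v z @^-1` A) f (affine v z y))%E.
Proof.
move=> z0 mA mf f0.
have zd0 : 0 <= z ^+ d by rewrite exprn_ge0// ltW.
pose nu := measure_function_pushforward__canonical__measure_function_Measure
     (@lebesgue_rV R d) (measurable_affine v z).
rewrite -(ge0_integral_pushforward (measurable_affine v z) _ mA mf)//; last first.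
rewrite -[RHS](@ge0_integral_mscale _ _ _ nu A mA (NngNum zd0) f mf)//.
apply: eq_measure_integral => B mB _.
exact/esym/lebesgue_rV_affine.
Qed.

End affine_change_of_variables.

(** An intermediate value theorem for the distribution function of h: z is the supremum of the
    points with mass at most q. Continuity from below and the null level set give mass <= q at z;
    continuity from above, with finite mass, gives >= q. *)
Lemma diffuse_level {R : realType} disp (T : measurableType disp)
    (mu : {measure set T -> \bar R}) (D : set T) (h : T -> R) (L q : R) :
  measurable D -> measurable_fun setT h -> (forall y, D y -> 0 < h y <= L) ->
  (mu D < +oo)%E ->
  (forall z, mu (D `&` [set y | h y = z]) = 0%E) ->
  0 <= L -> 0 <= q -> (q%:E <= mu D)%E ->
  exists2 z, 0 <= z <= L & mu (D `&` [set y | h y <= z]) = q%:E.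
Proof.
move=> mD mh Dh Dfin mu0 L0 q0 qD.
pose F z := D `&` [set y | h y <= z].
have mF z : measurable (F z).
  apply: measurableI => //.
  have := mh measurableT [set` `]-oo, z]] (measurable_itv _).
  by rewrite setTI; congr measurable; apply/seteqP; split=> y; rewrite /= in_itv.
have meq z : measurable (D `&` [set y | h y = z]).
  apply: measurableI => //.
  by have := mh measurableT [set z] (measurable_set1 _); rewrite setTI.
have Fmono a b : a <= b -> F a `<=` F b.
  by move=> ab y [Dy ya]; split=> //; exact: le_trans ab.
have muF a b : a <= b -> (mu (F a) <= mu (F b))%E.
  by move=> ab; apply: le_measure; rewrite ?inE//; exact: Fmono.
have F0 : F 0 = set0.
  by rewrite -subset0 => y [/Dh/andP[y0 _]] /=; rewrite leNgt y0.
have FL : F L = D.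
  by apply/seteqP; split=> [y []//|y Dy]; split=> //=; case/andP: (Dh _ Dy).
have Ffin z : (mu (F z) < +oo)%E.
  by apply: le_lt_trans Dfin; apply: le_measure; rewrite ?inE// => y [].
pose S := [set z | 0 <= z <= L /\ (mu (F z) <= q%:E)%E].
have S0 : S 0 by split; rewrite ?lexx// F0 measure0 lee_fin.
have supS : has_sup S.
  by split; [exists 0|exists L => z [/andP[]]].
pose z := sup S.
have z0 : 0 <= z by apply: ub_le_sup => //; case: supS.
have zL : z <= L by apply: ge_sup; [exists 0|move=> s [/andP[]]].
exists z; first by rewrite z0.
apply/eqP; rewrite eq_le; apply/andP; split.
- pose G (n : nat) := F (z - n.+1%:R^-1).
  have GE : \bigcup_n G n = D `&` [set y | h y < z].
    apply/seteqP; split=> y.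
      move=> [n _ [Dy /= yn]]; split=> //=; apply: le_lt_trans yn _.
      by rewrite ltrBlDr ltrDl invr_gt0.
    move=> [Dy /= yz]; have zy0 : 0 < z - h y by rewrite subr_gt0.
    have [n _ Hn] := near_infty_natSinv_lt (PosNum zy0).
    exists n => //; split=> //=; have hn : n.+1%:R^-1 < z - h y := Hn n (leqnn n).
    by rewrite lerBrDr -lerBrDl ltW.
  have Gmono : nondecreasing_seq G.
    move=> m n mn; apply/subsetPset; apply: Fmono.
    by rewrite lerD2l lerN2 lef_pV2 ?posrE// ler_nat ltnS.
  have mU : measurable (\bigcup_n G n) by apply: bigcupT_measurable => n; exact: mF.
  have cv := nondecreasing_cvg_mu (mu := mu) (fun n => mF _) mU Gmono.
  have Gq : (mu (\bigcup_n G n) <= q%:E)%E.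
    rewrite -(cvg_lim _ cv)//; apply: lime_le; first by apply/cvg_ex; eexists; exact: cv.
    near=> n => /=.
    have [s [s0 sq] ns] : exists2 s, S s & z - n.+1%:R^-1 < s.
      by apply: sup_adherent => //; rewrite invr_gt0.
    by apply: le_trans sq; apply: muF; exact: ltW.
  rewrite (_ : D `&` _ = (\bigcup_n G n) `|` (D `&` [set y | h y = z])); last first.
    rewrite GE; apply/seteqP; split=> y /=.
      by move=> [Dy]; rewrite le_eqVlt => /predU1P[|]; [right|left].
    by case=> -[Dy]; [move/ltW|move->].
  apply: le_trans (measureU2 _ _ _) _ => //.
  by rewrite [X in (_ + X)%E]mu0 adde0.
- have [zLe|zLn] := eqVneq z L; first by rewrite zLe -/(F L) FL.
  have {}zL : z < L by rewrite lt_neqAle zLn.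
  pose G (n : nat) := F (z + n.+1%:R^-1).
  have GE : \bigcap_n G n = F z.
    apply/seteqP; split=> y.
      move=> yG; have [Dy _] := yG 0%N Logic.I; split=> //=.
      rewrite leNgt; apply/negP => zy; have zy0 : 0 < h y - z by rewrite subr_gt0.
      have [n _ Hn] := near_infty_natSinv_lt (PosNum zy0).
      have hn : n.+1%:R^-1 < h y - z := Hn n (leqnn n).
      by have [_ /=] := yG n Logic.I; rewrite leNgt -ltrBrDl hn.
    move=> [Dy /= yz] n _; split=> //=; apply: le_trans yz _.
    by rewrite lerDl invr_ge0.
  have Gmono : nonincreasing_seq G.
    move=> m n mn; apply/subsetPset; apply: Fmono.
    by rewrite lerD2l lef_pV2 ?posrE// ler_nat ltnS.
  have mI : measurable (\bigcap_n G n) by rewrite GE.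
  have cv := nonincreasing_cvg_mu (mu := mu) (Ffin _) (fun n => mF _) mI Gmono.
  rewrite -/(F z) -GE -(cvg_lim _ cv)//; apply: lime_ge; first by apply/cvg_ex; eexists; exact: cv.
  near=> n => /=.
  rewrite leNgt; apply/negP => lq.
  have : S (Num.min L (z + n.+1%:R^-1)).
    split.
      rewrite le_min L0/= ge_min lexx/= andbT addr_ge0//.
    apply: le_trans (ltW lq); apply: muF; rewrite ge_min lexx orbT//.
  move=> /(ub_le_sup (proj2 supS)); rewrite -/z leNgt => /negP; apply.
  by rewrite lt_min zL/= ltrDl invr_gt0.
Unshelve. all: by end_near.
Qed.

Section dot_product.
Context {R : realType} {d : nat}.
Implicit Types (x y z e : 'rV[R]_d) (a : R).

Lemma dotC x y : dot x y = dot y x.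
Proof. by apply: eq_bigr => i _; rewrite mulrC. Qed.

Lemma dotDl x y z : dot (x + y) z = dot x z + dot y z.
Proof. by rewrite -big_split; apply: eq_bigr => i _; rewrite mxE mulrDl. Qed.

Lemma dotZl a x y : dot (a *: x) y = a * dot x y.
Proof. by rewrite mulr_sumr; apply: eq_bigr => i _; rewrite mxE mulrA. Qed.

Lemma dotDr x y z : dot x (y + z) = dot x y + dot x z.
Proof. by rewrite dotC dotDl !(dotC _ x). Qed.

Lemma dotZr a x y : dot x (a *: y) = a * dot x y.
Proof. by rewrite dotC dotZl dotC. Qed.

Lemma dotNl x y : dot (- x) y = - dot x y.
Proof. by rewrite -scaleN1r dotZl mulN1r. Qed.

Lemma dotBl x y z : dot (x - y) z = dot x z - dot y z.
Proof. by rewrite dotDl dotNl. Qed.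

Lemma dot_ge0 x : 0 <= dot x x.
Proof. by apply: sumr_ge0 => i _; rewrite -expr2 sqr_ge0. Qed.

Lemma enorm_ge0 x : 0 <= enorm x. Proof. exact: sqrtr_ge0. Qed.

Lemma enorm_sqr x : enorm x ^+ 2 = dot x x.
Proof. by rewrite sqr_sqrtr// dot_ge0. Qed.

Lemma cauchy_schwarz x y : `|dot x y| <= enorm x * enorm y.
Proof.
have xx := dot_ge0 x; have yy := dot_ge0 y.
rewrite -ler_sqr ?nnegrE ?mulr_ge0 ?enorm_ge0// exprMn !enorm_sqr real_normK ?num_real//.
have [y0|y0] := eqVneq (dot y y) 0.
  have yz i : y 0 i = 0.
    apply/eqP; rewrite -(sqrf_eq0 (y 0 i)) expr2.
    have := y0; rewrite /dot => /eqP; rewrite psumr_eq0 => [/allP/(_ i)|]; last by move=> ? _; rewrite -expr2 sqr_ge0.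
    by move=> /(_ (mem_index_enum _)).
  by rewrite y0 mulr0 /dot big1 ?expr0n// => i _; rewrite yz mulr0.
have {}y0 : 0 < dot y y by rewrite lt_neqAle eq_sym y0.
have := dot_ge0 (dot y y *: x - dot x y *: y).
rewrite dotBl ![dot _ (_ - _)]dotC !dotBl !dotZl ![dot _ (_ *: _)]dotC !dotZl (dotC y x).
move=> H; rewrite -subr_ge0 -(pmulr_rge0 _ y0); apply: le_trans H _.
by rewrite le_eqVlt; apply/orP; left; apply/eqP; ring.
Qed.

Lemma enormD x y : enorm (x + y) <= enorm x + enorm y.
Proof.
rewrite -ler_sqr ?nnegrE ?addr_ge0 ?enorm_ge0// enorm_sqr dotDl !dotDr (dotC y x).
have := cauchy_schwarz x y; rewrite ler_norml => /andP[_].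
rewrite -!enorm_sqr; lra.
Qed.

Lemma enormZ a x : enorm (a *: x) = `|a| * enorm x.
Proof. by rewrite /enorm dotZl dotZr mulrA -expr2 sqrtrM ?sqr_ge0// sqrtr_sqr. Qed.

Lemma coord_le_enorm x i : `|x 0 i| <= enorm x.
Proof.
rewrite -ler_sqr ?nnegrE ?enorm_ge0// enorm_sqr real_normK ?num_real//.
rewrite /dot (bigD1 i)//= -expr2 lerDl; apply: sumr_ge0 => j _.
by rewrite -expr2 sqr_ge0.
Qed.

Lemma enorm_le_coord x a : 0 <= a -> (forall i, `|x 0 i| <= a) ->
  enorm x <= Num.sqrt d%:R * a.
Proof.
move=> a0 xa; rewrite -ler_sqr ?nnegrE ?mulr_ge0 ?enorm_ge0 ?sqrtr_ge0//.
rewrite enorm_sqr exprMn sqr_sqrtr// /dot.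
apply: (@le_trans _ _ (\sum_(i < d) a ^+ 2)).
  apply: ler_sum => i _; rewrite -expr2 -real_normK ?num_real//.
  by rewrite lerXn2r// nnegrE.
by rewrite sumr_const card_ord -[leLHS]mulr_natl.
Qed.

Lemma measurable_dotl e : measurable_fun [set: 'rV[R]_d] (fun y => dot y e).
Proof.
apply: measurable_sum => i; apply: measurable_funM => //; exact: measurable_coord.
Qed.

End dot_product.

(** The direction stacked on the frame is a square matrix M with M M^T = 1. Hence M^T M = 1, and y =
    y M^T M is the expansion. *)
Lemma orthonormal_decomp {R : realType} {d : nat} (e : 'rV[R]_d)
    (B : 'M[R]_(d.-1, d)) (y : 'rV[R]_d) : (0 < d)%N ->
  enorm e = 1 -> orthonormal_frame e B ->
  y = dot y e *: e + \sum_i dot y (row i B) *: row i B.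
Proof.
case: d e B y => // d e B y _ e1 [Be BB].
have ee : dot e e = 1 by rewrite -enorm_sqr e1 expr1n.
pose M : 'M[R]_(1 + d, d.+1) := col_mx e B.
have rE (x z : 'rV[R]_d.+1) : (x *m z^T) = (dot x z)%:M.
  apply/matrixP => i j; rewrite !ord1 !mxE eqxx mulr1n; apply: eq_bigr => k _.
  by rewrite mxE.
have MM : M *m M^T = 1%:M.
  rewrite /M tr_col_mx mul_col_row rE ee.
  have -> : B *m e^T = 0.
    apply/row_matrixP => i; rewrite row_mul rE Be row0.
    by apply/rowP => j; rewrite !mxE !ord1 mul0rn.
  have -> : e *m B^T = 0.
    apply/matrixP => i j; rewrite [RHS]mxE -(Be j) dotC ord1 mxE; apply: eq_bigr => k _.
    by rewrite !mxE.
  have -> : B *m B^T = 1%:M.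
    apply/matrixP => i j; rewrite [RHS]mxE -BB mxE; apply: eq_bigr => k _.
    by rewrite !mxE.
  by rewrite -scalar_mx_block.
have MM' : M^T *m M = 1%:M := @mulmx1C R d.+1 M M^T MM.
rewrite -[LHS]mulmx1 -MM' mulmxA /M tr_col_mx mul_mx_row mul_row_col.
rewrite rE mul_scalar_mx; congr (_ + _).
rewrite mulmx_sum_row; apply: eq_bigr => i _; congr (_ *: _).
by rewrite mxE; apply: eq_bigr => k _; rewrite !mxE.
Qed.

Lemma measurable_le_set {R : realType} disp (T : measurableType disp) (g h : T -> R) :
  measurable_fun setT g -> measurable_fun setT h -> measurable [set y | g y <= h y].
Proof.
move=> mg mh; have := measurable_funB mh mg => /(_ measurableT).
move=> /(_ [set` `[0, +oo[] (measurable_itv _)); rewrite setTI; congr measurable.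
by apply/seteqP; split=> y /=; rewrite in_itv/= andbT subr_ge0.
Qed.

Lemma measurable_lt_set {R : realType} disp (T : measurableType disp) (g h : T -> R) :
  measurable_fun setT g -> measurable_fun setT h -> measurable [set y | g y < h y].
Proof.
move=> mg mh; rewrite (_ : [set y | _] = ~` [set y | h y <= g y]).
  by apply: measurableC; exact: measurable_le_set.
by apply/seteqP; split=> y /=; rewrite ltNge => /negP.
Qed.

Lemma measurable_box {R : realType} d (A : 'I_d -> set R) :
  (forall i, measurable (A i)) ->
  measurable [set x : 'rV[R]_d | forall i, A i (x 0 i)].
Proof.
move=> mA; have -> : [set x : 'rV[R]_d | forall i, A i (x 0 i)] =
    \bigcap_(i in [set: 'I_d]) ((fun y : 'rV[R]_d => y 0 i) @^-1` A i).
  by apply/seteqP; split=> y h i; [move=> _|]; exact: h.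
apply: fin_bigcap_measurable => // i _; rewrite -[X in measurable X]setTI.
exact: measurable_coord.
Qed.

(** * Wedges as scaled copies of the unit wedge *)

Section wedge_measure.
Context {R : realType} {d : nat} (K : wedge R d).
Local Notation vol := (@lebesgue_rV R d).
Local Notation e := (wdir K).
Local Notation v := (wvertex K).
Local Notation tn := (tan (wangle K)).

Definition wedge_set : set 'rV[R]_d := [set y | in_wedge K y].

Lemma measurable_wproj : measurable_fun setT (wproj K).
Proof.
rewrite (_ : wproj K = fun y => dot y e - dot v e); last first.
  by apply/funext => y; rewrite /wproj dotBl.
by apply: measurable_funB; [exact: measurable_dotl|exact: measurable_cst].
Qed.

Lemma wedge_setP y : wedge_set y <->
  [/\ 0 < wproj K y, wproj K y <= wlen K & forall i,
   `|dot (y - v) (row i (wframe K))| <= tn * wproj K y].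
Proof.
rewrite /wedge_set/= /in_wedge; split.
  move=> /andP[/andP[-> ->] /forallP h]; split=> // i.
  by rewrite ler_norml -mulNr h.
move=> [-> -> h]; apply/forallP => i.
by have := h i; rewrite ler_norml -mulNr.
Qed.

Lemma measurable_wedge : measurable wedge_set.
Proof.
have -> : wedge_set = [set y | 0 < wproj K y] `&` [set y | wproj K y <= wlen K] `&`
    \bigcap_(i in [set: 'I_d.-1])
      [set y | `|dot (y - v) (row i (wframe K))| <= tn * wproj K y].
  apply/seteqP; split=> y.
    by move=> /wedge_setP[? ? h]; split; [split|move=> i _ /=; exact: h].
  by move=> [[? ?] h]; apply/wedge_setP; split=> // i; exact: h.
have mp := measurable_wproj.
apply: measurableI.
  apply: measurableI; first by apply: measurable_lt_set => //; exact: measurable_cst.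
  by apply: measurable_le_set => //; exact: measurable_cst.
apply: fin_bigcap_measurable => // i _; apply: measurable_le_set.
  apply: measurableT_comp => //=.
  under eq_fun do rewrite dotBl.
  by apply: measurable_funB; [exact: measurable_dotl|exact: measurable_cst].
by apply: measurable_funM => //; exact: measurable_cst.
Qed.

Lemma measurable_below z : measurable (below K z).
Proof.
apply: measurableI; first exact: measurable_wedge.
by apply: measurable_le_set; [exact: measurable_wproj|exact: measurable_cst].
Qed.

Lemma measurable_slab a b : measurable (slab K a b).
Proof.
have -> : slab K a b = below K b `\` below K a.
  apply/seteqP; split=> y.
    by move=> [yK /andP[ay yb]]; split=> // -[_]; rewrite leNgt ay.
  move=> [[yK /= yb] nb]; split=> //; rewrite yb andbT ltNge; apply/negP => ya.
  exact: nb.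
by apply: measurableD; exact: measurable_below.
Qed.

Definition unit_wedge : wedge R d := Wedge 0 e (wframe K) 1 (wangle K).

End wedge_measure.

Section unit_wedge_volume.
Context {R : realType} {d : nat} (K : wedge R d).
Local Notation vol := (@lebesgue_rV R d).
Local Notation e := (wdir K).
Local Notation v := (wvertex K).
Local Notation tn := (tan (wangle K)).
Local Notation W := (wedge_set (unit_wedge K)).

Lemma unit_wedgeP y : W y <->
  [/\ 0 < dot y e, dot y e <= 1 & forall i,
   `|dot y (row i (wframe K))| <= tn * dot y e].
Proof.
split => [/wedge_setP[]|[y0 y1 h]].
  by rewrite /wproj /= subr0 => ? ? h; split=> // i; have := h i; rewrite subr0.
by apply/wedge_setP; rewrite /wproj /= subr0; split=> // i.
Qed.

Lemma affine_sub z y : affine v z y - v = z *: y.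
Proof. by rewrite /affine addrC addKr. Qed.

Lemma wproj_affine z y : wproj K (affine v z y) = z * dot y e.
Proof. by rewrite /wproj affine_sub dotZl. Qed.

(** Homogeneity: the lateral constraints scale with P_e, and z <= wlen K makes the length constraint
    follow from P_e <= z. *)
Lemma below_affine z : 0 < z <= wlen K ->
  affine v z @^-1` below K z = W.
Proof.
move=> /andP[z0 zL]; apply/seteqP; split=> y.
  move=> [/wedge_setP[]] /=; rewrite wproj_affine pmulr_rgt0//.
  move=> yp yL h; rewrite -[leRHS]mulr1 ler_pM2l// => y1.
  apply/wedge_setP; rewrite /wproj/= subr0; split=> // i.
  have := h i; rewrite affine_sub dotZl mulrCA normrM (ger0_norm (ltW z0)) ler_pM2l//.
move=> /wedge_setP; rewrite /wproj/= subr0 => -[yp y1 h].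
have zy : z * dot y e <= z by rewrite -[leRHS]mulr1 ler_pM2l.
split; last by rewrite /= wproj_affine.
apply/wedge_setP; rewrite wproj_affine; split.
- by rewrite mulr_gt0.
- exact: le_trans zL.
- by move=> i; rewrite affine_sub dotZl mulrCA normrM (ger0_norm (ltW z0)) ler_pM2l.
Qed.

Hypothesis d0 : (0 < d)%N.
Hypothesis e1 : enorm e = 1.
Hypothesis eB : orthonormal_frame e (wframe K).

Lemma enorm_frame i : enorm (row i (wframe K)) = 1.
Proof. by rewrite /enorm (proj2 eB) eqxx sqrtr1. Qed.

Lemma vol_unit_wedge_lty : (vol W < +oo)%E.
Proof.
pose M : R := 1 + \sum_(i < d.-1) `|tn|.
apply: (@le_lt_trans _ _ (vol [set y | forall i, [set` `[- M, M]] (y 0 i)])).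
  apply: le_measure; rewrite ?inE; [exact: measurable_wedge| |].
    by apply: (measurable_box (A := fun=> [set` `[- M, M]])) => i; exact: measurable_itv.
  move=> y /unit_wedgeP[y0 y1 h] i; rewrite /= in_itv/= -ler_norml.
  rewrite [y in leLHS](orthonormal_decomp y d0 e1 eB) mxE (le_trans (ler_normD _ _))// lerD//.
    rewrite mxE normrM -[leRHS]mulr1 ler_pM// -?e1 ?coord_le_enorm//.
    by rewrite ger0_norm ?e1// ltW.
  rewrite summxE (le_trans (ler_norm_sum _ _ _))//; apply: ler_sum => j _.
  rewrite mxE normrM -[leRHS]mulr1 ler_pM// -?(enorm_frame j) ?coord_le_enorm//.
  rewrite (le_trans (h j))// (le_trans (ler_norm _))// normrM -[leRHS]mulr1 ler_wpM2l//.
  by rewrite ger0_norm// ltW.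
rewrite (@lebesgue_rV_box R d (fun=> [set` `[- M, M]])); last by move=> i; exact: measurable_itv.
have -> : \big[*%E/1%E]_(i < d) lebesgue_measure [set` `[- M, M]] = \big[*%E/1%E]_(i < d) (M - - M)%:E.
  apply: eq_bigr => i _; rewrite lebesgue_measure_itv/= lte_fin gtrN ?EFinB//.
  by rewrite ltr_pwDl// sumr_ge0.
by rewrite prodEFin ltry.
Qed.

(** A cube centred at e/2 with half diagonal tn/4 fits: on it P_e >= 1/4, so the lateral constraint
    allows tn/4. The true order is tn^(d-1); the cube loses one factor tn. *)
Lemma vol_unit_wedge_ge : 0 < tn <= 1 ->
  (((tn / (2 * Num.sqrt d%:R)) ^+ d)%:E <= vol W)%E.
Proof.
move=> /andP[t0 t1].
have sd0 : 0 < Num.sqrt d%:R :> R by rewrite sqrtr_gt0 ltr0n.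
pose r : R := tn / (4 * Num.sqrt d%:R).
have r0 : 0 < r by rewrite divr_gt0// mulr_gt0.
have rE : tn / (2 * Num.sqrt d%:R) = r + r by rewrite /r; field; rewrite gt_eqF.
pose I i := `[e 0 i / 2 - r, e 0 i / 2 + r].
have -> : ((tn / (2 * Num.sqrt d%:R)) ^+ d)%:E = vol [set y | forall i, [set` I i] (y 0 i)].
  rewrite (@lebesgue_rV_box R d (fun i => [set` I i])); last by move=> i; exact: measurable_itv.
  rewrite rE (eq_bigr (fun=> (r + r)%:E)).
    by rewrite prodEFin prodr_const card_ord.
  move=> i _; rewrite lebesgue_measure_itv/= lte_fin ltrD2l gtrN// -EFinB.
  by congr EFin; ring.
apply: le_measure; rewrite ?inE; [|exact: measurable_wedge|].
  by apply: (measurable_box (A := fun i => [set` I i])) => i; exact: measurable_itv.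
move=> y yI.
pose z := y - 2^-1 *: e.
have yE : y = 2^-1 *: e + z by rewrite /z addrC subrK.
have zn : enorm z <= tn / 4.
  have -> : tn / 4 = Num.sqrt d%:R * r by rewrite /r; field; rewrite gt_eqF.
  apply: enorm_le_coord; first exact: ltW.
  move=> i; have := yI i; rewrite /= in_itv/= !mxE ler_norml => /andP[h1 h2].
  by apply/andP; split; lra.
have ez : `|dot z e| <= tn / 4.
  by rewrite (le_trans (cauchy_schwarz _ _))// e1 mulr1.
have ye : dot y e = 2^-1 + dot z e.
  by rewrite {1}yE dotDl dotZl -enorm_sqr e1 expr1n mulr1.
move: ez; rewrite ler_norml => /andP[ez1 ez2].
apply/unit_wedgeP; split; [by rewrite ye; lra..|move=> i].
have -> : dot y (row i (wframe K)) = dot z (row i (wframe K)).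
  by rewrite {1}yE dotDl dotZl dotC (proj1 eB) mulr0 add0r.
rewrite (le_trans (cauchy_schwarz _ _))// enorm_frame mulr1 (le_trans zn)//.
by rewrite ler_wpM2l ?(ltW t0)// ye; lra.
Qed.

Lemma vol_below z : 0 < z <= wlen K ->
  vol (below K z) = ((z ^+ d)%:E * vol W)%E.
Proof.
move=> zL; have /andP[z0 _] := zL.
by rewrite -(lebesgue_rV_affine v z0 (measurable_below K z)) below_affine.
Qed.

(** For every a < z the slice lies between the truncations at a and z, so its volume is at most (z^d
    - a^d) vol W, which tends to 0 as a increases to z. *)
Lemma vol_slice z : vol (wedge_set K `&` [set y | wproj K y = z]) = 0%E.
Proof.
have [zL|zL] := boolP (0 < z <= wlen K); last first.
  rewrite (_ : _ `&` _ = set0) ?measure0// -subset0 => y [/wedge_setP[y0 y1 _] /= yz].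
  by move/negP: zL; apply; rewrite -yz y0.
have /andP[z0 zle] := zL.
have ms : measurable (wedge_set K `&` [set y | wproj K y = z]).
  apply: measurableI; first exact: measurable_wedge.
  have := measurable_wproj K => /(_ measurableT [set z] (measurable_set1 _)).
  by rewrite setTI.
set A := _ `&` _ in ms *.
have Wfin : vol W \is a fin_num by rewrite ge0_fin_numE// vol_unit_wedge_lty.
have key a : 0 < a < z -> (vol A <= ((z ^+ d - a ^+ d) * fine (vol W))%:E)%E.
  move=> /andP[a0 az].
  have aL : 0 < a <= wlen K by rewrite a0 (le_trans (ltW az)).
  have : (vol A + vol (below K a) <= vol (below K z))%E.
    rewrite -measureU//; first last.
    - rewrite -subset0 => y [[_ /= yz] [_ ya]]; move: ya; rewrite yz leNgt az//.
    - exact: measurable_below.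
    apply: le_measure; rewrite ?inE; [by apply: measurableU => //; exact: measurable_below|exact: measurable_below|].
    move=> y [[yK /= yz]|[yK /= ya]]; split=> //=; first by rewrite yz.
    exact: le_trans ya (ltW az).
  rewrite !vol_below// -(fineK Wfin) -!EFinM.
  by rewrite -leeBrDr// -EFinB -mulrBl.
have Afin : vol A \is a fin_num.
  rewrite ge0_fin_numE//; apply: le_lt_trans (key (z / 2) _) _; last exact: ltry.
  by apply/andP; split; lra.
rewrite -(fineK Afin); congr EFin; apply/eqP; rewrite eq_le fine_ge0// andbT.
set w := fine (vol W) in key.
have w0 : 0 <= w by rewrite fine_ge0.
have h : (z ^+ d - a ^+ d) * w @[a --> z^'-] --> (z ^+ d - z ^+ d) * w.
  apply: cvg_at_left_filter; apply: cvgM; last exact: cvg_cst.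
  by apply: cvgB; [exact: cvg_cst|exact: exprn_continuous].
rewrite subrr mul0r in h.
apply: (cvgr_to_ge h); near=> a.
rewrite -lee_fin fineK// key//; apply/andP; split.
  by near: a; exact: nbhs_left_gt.
by near: a; exact: nbhs_left_lt.
Unshelve. all: by end_near.
Qed.

End unit_wedge_volume.

(** * The law of P_e X in a wedge *)

Section density_on_wedge.
Context {R : realType} {d : nat} (mu : probability 'rV[R]_d R) (f : 'rV[R]_d -> R).
Local Notation vol := (@lebesgue_rV R d).
Hypothesis mf : measurable_fun setT f.
Hypothesis f0 : forall y, 0 <= f y.
Hypothesis muE : forall A, measurable A -> mu A = (\int[vol]_(y in A) (f y)%:E)%E.

Let mfE A : measurable_fun A (fun y => (f y)%:E).
Proof. by apply/measurable_EFinP; exact: measurable_funTS. Qed.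

Lemma lawE A : measurable A -> (law f A)%:E = mu A.
Proof. by move=> mA; rewrite /law -muE// fineK// fin_num_measure. Qed.

Lemma law_le A B : measurable A -> measurable B -> A `<=` B -> law f A <= law f B.
Proof. by move=> mA mB AB; rewrite -lee_fin !lawE// le_measure ?inE. Qed.

Lemma law_le1 A : measurable A -> law f A <= 1.
Proof. by move=> mA; rewrite -lee_fin lawE// probability_le1. Qed.

Context (K : wedge R d).
Local Notation e := (wdir K).
Local Notation v := (wvertex K).
Local Notation L := (wlen K).
Local Notation W := (wedge_set (unit_wedge K)).

Lemma law_slab a b : a <= b ->
  law f (slab K a b) = law f (below K b) - law f (below K a).
Proof.
move=> ab; apply/eqP; rewrite eq_sym subr_eq; apply/eqP.
apply: EFin_inj; rewrite EFinD !lawE; try exact: measurable_below; try exact: measurable_slab.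
rewrite -measureU//; [|exact: measurable_slab|exact: measurable_below|].
  congr (mu _); apply/seteqP; split=> y.
    move=> [yK /= yb]; have [ya|ya] := leP (wproj K y) a; first by right.
    by left; split=> //; rewrite ya.
  move=> [[yK /andP[_ yb]]|[yK /= ya]]; split=> //=.
  exact: le_trans ab.
rewrite -subset0 => y [[_ /andP[ay _]] [_ /=]].
by rewrite leNgt ay.
Qed.

Lemma law_below_mono a b : a <= b -> law f (below K a) <= law f (below K b).
Proof.
move=> ab; apply: law_le; try exact: measurable_below.
by move=> y [yK /= ya]; split=> //; exact: le_trans ab.
Qed.

Lemma law_below0 : law f (below K 0) = 0.
Proof.
rewrite (_ : below K 0 = set0) /law ?integral_set0//.
rewrite -subset0 => y [/wedge_setP[y0 _ _] /=]; by rewrite leNgt y0.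
Qed.

Lemma below_len : below K L = wedge_set K.
Proof.
by apply/seteqP; split=> y; [case|move=> yK; split=> //; case/wedge_setP: yK].
Qed.

Hypothesis d0 : (0 < d)%N.
Hypothesis e1 : enorm e = 1.
Hypothesis eB : orthonormal_frame e (wframe K).
Hypothesis L0 : 0 < L.

Lemma law_level q : 0 <= q <= law f (below K L) ->
  exists2 z, 0 <= z <= L & law f (below K z) = q.
Proof.
move=> /andP[q0 qL].
have := @diffuse_level R _ _ mu (wedge_set K) (wproj K) L q
  (measurable_wedge K) (measurable_wproj K).
case=> //.
- by move=> y /wedge_setP[-> ->].
- by rewrite (le_lt_trans (probability_le1 _ (measurable_wedge K)))// ltry.
- move=> z; have mS : measurable (wedge_set K `&` [set y | wproj K y = z]).
    apply: measurableI; first exact: measurable_wedge.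
    have := measurable_wproj K => /(_ measurableT [set z] (measurable_set1 _)).
    by rewrite setTI.
  apply: etrans (muE mS) _; apply: null_set_integral => //; exact: vol_slice.
- exact: ltW.
- apply: (@le_trans _ _ (law f (wedge_set K))%:E); first by rewrite lee_fin -below_len.
  by rewrite lawE; [exact: lexx|exact: measurable_wedge].
move=> z zL zq; exists z => //; apply: EFin_inj; apply: etrans zq.
by apply: lawE; exact: measurable_below.
Qed.

(** Not divided by the volume of W, so that the distribution function is z^d times this integral
    without a further factor. *)
Definition bint z : R := fine (\int[vol]_(y in W) (f (affine v z y))%:E)%E.

Let mfa z A : measurable_fun A (fun y => (f (affine v z y))%:E).
Proof.
apply/measurable_EFinP; apply: measurable_funTS.
exact: (measurableT_comp mf (measurable_affine v z)).
Qed.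

(** Finiteness is inherited from the probability of [below K z], which equals z^d times this
    integral with z^d > 0. *)
Lemma bintE z : 0 < z <= L ->
  (\int[vol]_(y in W) (f (affine v z y))%:E)%E = (bint z)%:E.
Proof.
move=> zL; have /andP[z0 _] := zL.
have zd : 0 < z ^+ d by rewrite exprn_gt0.
rewrite /bint fineK// ge0_fin_numE; last first.
  by apply: integral_ge0 => y _; rewrite lee_fin.
have : (mu (below K z) < +oo)%E.
  by rewrite (le_lt_trans (probability_le1 _ (measurable_below K z)))// ltry.
rewrite muE; last exact: measurable_below.
rewrite (integral_affine v z0 (measurable_below K z) (@mfE _)).
  rewrite below_affine//.
  move=> h; rewrite ltey; apply/eqP => I; move: h.
  by rewrite I gt0_muley ?lte_fin.
by move=> y; rewrite lee_fin.
Qed.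

Lemma law_below_bint z : 0 < z <= L -> law f (below K z) = z ^+ d * bint z.
Proof.
move=> zL; have /andP[z0 _] := zL; apply: EFin_inj.
rewrite lawE ?muE; [|exact: measurable_below..].
rewrite (integral_affine v z0 (measurable_below K z) (@mfE _)).
  by rewrite below_affine// bintE// EFinM.
by move=> y; rewrite lee_fin.
Qed.

Let w := fine (vol W).

Let wE : vol W = w%:E.
Proof. by rewrite fineK// ge0_fin_numE// vol_unit_wedge_lty. Qed.

Lemma bint_ge z m : 0 < z <= L -> 0 <= m ->
  (forall y, W y -> m <= f (affine v z y)) -> m * w <= bint z.
Proof.
move=> zL m0 h; rewrite -lee_fin -bintE// EFinM -wE.
rewrite -(integral_cst vol (measurable_wedge _)); apply: ge0_le_integral => //.
exact: measurable_wedge.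
Qed.

Lemma bint_le z m : 0 < z <= L ->
  (forall y, W y -> f (affine v z y) <= m) -> bint z <= m * w.
Proof.
move=> zL h; rewrite -lee_fin -bintE// EFinM -wE.
rewrite -(integral_cst vol (measurable_wedge _)); apply: ge0_le_integral => //.
- exact: measurable_wedge.
- by move=> y _; rewrite lee_fin.
Qed.

Let H : set 'rV[R]_d := W `\` below (unit_wedge K) (1 / 2).

Let mH : measurable H.
Proof. by apply: measurableD; [exact: measurable_wedge|exact: measurable_below]. Qed.

(* By homogeneity the lower half of the unit wedge has volume 2^-d vol W. *)
Lemma vol_upper_half : w / 2 <= fine (vol H).
Proof.
have mW := measurable_wedge (unit_wedge K).
have mb := measurable_below (unit_wedge K) (1 / 2).
have bE : vol (below (unit_wedge K) (1 / 2)) = ((1 / 2) ^+ d * w)%:E.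
  by rewrite EFinM -wE; apply: vol_below => /=; lra.
have HE : vol H = (w - (1 / 2) ^+ d * w)%:E.
  have Wlt : (vol W < +oo)%E by rewrite wE ltry.
  apply: etrans (measureD mW mb Wlt) _.
  have -> : W `&` below (unit_wedge K) (1 / 2) = below (unit_wedge K) (1 / 2).
    by apply/seteqP; split=> y; [case|move=> [h1 h2]; split].
  by rewrite EFinB; congr (_ - _)%E; [exact: wE|exact: bE].
rewrite HE/=.
have w0 : 0 <= w by rewrite fine_ge0.
have : (1 / 2 : R) ^+ d <= 1 / 2.
  by rewrite -[leRHS]expr1 ler_wiXn2l//; lra.
by move=> /(ler_wpM2r w0); lra.
Qed.

(** The decrease of f along a ray y is proportional to P_e y. It is exploited only where P_e y >
    1/2, which carries at least half of the volume. *)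
Lemma bint_slope z z' a : 0 < z <= L -> 0 < z' <= L -> 0 <= a ->
  (forall y, W y -> f (affine v z' y) <= f (affine v z y)) ->
  (forall y, W y -> 1 / 2 < dot y e -> f (affine v z' y) + a <= f (affine v z y)) ->
  bint z' + a * (w / 2) <= bint z.
Proof.
move=> zL zL' a0 h1 h2.
apply: (@le_trans _ _ (bint z' + a * fine (vol H))).
  by rewrite lerD2l ler_wpM2l// vol_upper_half.
have Hfin : vol H = (fine (vol H))%:E.
  rewrite fineK// ge0_fin_numE//; apply: (@le_lt_trans _ _ (vol W)).
    by apply: le_measure; rewrite ?inE//; [exact: measurable_wedge|move=> y []].
  by rewrite wE ltry.
rewrite -lee_fin -bintE// EFinD -bintE// EFinM -Hfin.
have mW := measurable_wedge (unit_wedge K).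
have mI : measurable_fun W (fun y => (\1_H y)%:E : \bar R).
  by apply/measurable_EFinP; exact: measurable_indic.
have <- : (\int[vol]_(y in W) (a * \1_H y)%:E = a%:E * vol H)%E.
  under eq_integral do rewrite EFinM.
  rewrite (ge0_integralZl vol mW mI)//.
  rewrite integral_indic//; congr (_ * vol _)%E.
  by apply/seteqP; split=> y; [case|move=> [h nb]; split].
have ma : measurable_fun W (fun y => (a * \1_H y)%:E).
  apply/measurable_EFinP; apply: measurable_funM; first exact: measurable_cst.
  by apply: measurable_funTS; exact: measurable_indic.
have h0 z0 y : W y -> (0 <= (f (affine v z0 y))%:E)%E by rewrite lee_fin.
have i0 y : W y -> (0 <= (a * \1_H y)%:E)%E by rewrite lee_fin mulr_ge0.
rewrite -(ge0_integralD vol mW (@h0 z') (@mfa z' _) i0 ma).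
apply: ge0_le_integral => //.
- by move=> y Wy; rewrite adde_ge0 ?h0 ?i0.
- exact: emeasurable_funD.
- move=> y Wy; rewrite -EFinD lee_fin indicE.
  have [yH|yH] := boolP (y \in H); last by rewrite mulr0 addr0; exact: h1.
  rewrite mulr1; apply: h2 => //; move: yH; rewrite inE => -[_ nb].
  rewrite ltNge; apply/negP => h; apply: nb; split=> //=.
  by rewrite /wproj/= subr0.
Qed.

End density_on_wedge.

(** * Decrease of the density near a mode *)

Section local_shape.
Context {R : realType}.

(** Neighbourhoods come from the sup norm, which the Euclidean norm dominates. *)
Lemma near_enorm d (x0 : 'rV[R]_d) (Q : 'rV[R]_d -> Prop) :
  (\forall x \near x0, Q x) ->
  exists2 rho : R, 0 < rho & forall x, enorm (x - x0) < rho -> Q x.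
Proof.
move=> /nbhs_ballP[rho /= rho0 H]; exists rho => // x xr; apply: H.
split=> // i j; rewrite ord1 /ball/= distrC.
by apply: le_lt_trans xr; apply: le_trans (coord_le_enorm _ j); rewrite !mxE.
Qed.

Lemma dnear_enorm d (x0 : 'rV[R]_d) (Q : 'rV[R]_d -> Prop) :
  (\forall x \near x0^', Q x) ->
  exists2 rho : R, 0 < rho & forall x, 0 < enorm (x - x0) < rho -> Q x.
Proof.
rewrite near_withinE => /near_enorm[rho rho0 H]; exists rho => // x /andP[x0' xr].
apply: H => //; apply: contraTneq x0' => ->.
by rewrite subrr /enorm dot0l sqrtr0 ltxx.
Qed.

Lemma near0_radius (Q : R -> Prop) :
  (\forall h \near (0 : R), Q h) ->
  exists2 rho : R, 0 < rho & forall h, `|h| < rho -> Q h.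
Proof.
move=> /nbhs_ballP[rho /= rho0 H]; exists rho => // x xr; apply: H.
by rewrite /ball/= sub0r normrN.
Qed.

Lemma near0_right (Q : R -> Prop) :
  (\forall h \near (0 : R)^'+, Q h) ->
  exists2 rho : R, 0 < rho & forall h, 0 < h < rho -> Q h.
Proof.
rewrite near_withinE => /near0_radius[rho rho0 H]; exists rho => // h /andP[h0 hr].
by apply: H => //; rewrite gtr0_norm.
Qed.

Lemma derive_gradient d (g : 'rV[R]_d -> R) x u : differentiable g x ->
  'D_u g x = dot (gradient g x) u.
Proof.
move=> dg; rewrite deriveE// {1}(row_sum_delta u) linear_sum/=.
by apply: eq_bigr => j _; rewrite linearZ/= mxE deriveE//; exact: mulrC.
Qed.

Lemma dot_delta d (u : 'rV[R]_d) j : dot u (delta_mx 0 j) = u 0 j.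
Proof.
rewrite /dot (bigD1 j)//= mxE !eqxx mulr1 big1 ?addr0// => i ij.
by rewrite mxE eqxx (negbTE ij) mulr0.
Qed.

Lemma enorm_delta d j : enorm (delta_mx 0 j : 'rV[R]_d) = 1.
Proof. by rewrite /enorm dot_delta mxE !eqxx sqrtr1. Qed.

Lemma is_derive_line d (g : 'rV[R]_d -> R) x u t : differentiable g (x + t *: u) ->
  is_derive t 1 (fun t => g (x + t *: u)) ('D_u g (x + t *: u)).
Proof.
move=> dg; have dv : derivable g (x + t *: u) u by apply: diff_derivable.
have E : (fun h : R => h^-1 *: (((fun t => g (x + t *: u)) \o shift t) (h *: 1) - g (x + t *: u))) =
  (fun h : R => h^-1 *: ((g \o shift (x + t *: u)) (h *: u) - g (x + t *: u))).
  apply/funext => h /=; congr (_ *: (g _ - _)).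
  by rewrite scalerDl [h *: 1]mulr1 addrCA.
by split; rewrite /derivable /derive E.
Qed.

Lemma segment_increment d (g : 'rV[R]_d -> R) x u (s M : R) : 0 <= s ->
  (forall t, 0 <= t <= s -> differentiable g (x + t *: u)) ->
  (forall t, 0 <= t <= s -> `|'D_u g (x + t *: u)| <= M) ->
  `|g (x + s *: u) - g x| <= M * s.
Proof.
move=> s0 dg gM.
have [] := @MVT_segment R (fun t => g (x + t *: u)) (fun t => 'D_u g (x + t *: u)) 0 s s0.
- move=> t; rewrite in_itv/= => /andP[t0 ts]; apply: is_derive_line; apply: dg.
  by rewrite !ltW.
- apply: derivable_within_continuous => t; rewrite in_itv/= => ts.
  by have [] := is_derive_line (dg _ ts).
- move=> t; rewrite in_itv/= => ts; rewrite scale0r addr0 subr0 => ->.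
  by rewrite normrM (ger0_norm s0) ler_wpM2r// gM.
Qed.

(** A direction within 60 degrees of the radial one gains at least half of each step in radius. *)
Lemma radius_growth d (z u : 'rV[R]_d) (s : R) : 0 <= s -> enorm u = 1 ->
  enorm z / 2 <= dot z u -> 0 < enorm z ->
  enorm z + s / 2 <= enorm (z + s *: u) <= enorm z + s.
Proof.
move=> s0 u1 zu z0; apply/andP; split; last first.
  by rewrite (le_trans (enormD _ _))// enormZ u1 mulr1 ger0_norm.
have h : 0 <= enorm z + s / 2 by rewrite addr_ge0 ?enorm_ge0// divr_ge0.
rewrite -ler_sqr ?nnegrE ?enorm_ge0// enorm_sqr dotDl !dotDr !dotZl !dotZr (dotC u z).
rewrite -!enorm_sqr u1 expr1n.
have : s * (enorm z / 2) <= s * dot z u by rewrite ler_wpM2l.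
have : 0 <= s ^+ 2 by rewrite sqr_ge0.
lra.
Qed.

(** With r the distance to the mode, a step s raises the radius by at least s/2, so [ft] drops by at
    least c r s / 4 and, as 1 + g >= 1/2, f by c r s / 8. The change of g takes back at most c r s /
    16. The bound s <= 3 r keeps the radius below 4 r. *)
Lemma radial_shape_decrease d (f : 'rV[R]_d -> R) (c : R) (x0 : 'rV[R]_d) :
  (0 < d)%N -> 0 < c -> (forall y, 0 <= f y) -> radial_shape f c x0 ->
  exists rho m M c', [/\ 0 < rho, 0 < m, 0 < c',
    forall x, 0 < enorm (x - x0) < rho -> m <= f x <= M &
    forall x u s, enorm u = 1 -> 0 < enorm (x - x0) -> 4 * enorm (x - x0) < rho ->
      0 <= s <= 3 * enorm (x - x0) -> enorm (x - x0) / 2 <= dot (x - x0) u ->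
      f (x + s *: u) + c' * enorm (x - x0) * s <= f x].
Proof.
move=> d0 c0 f0 [g [ft [/near_enorm[r1 r1p fE] [/near_enorm[r2 r2p dg] go]]]].
move=> [gam gam0 gradg] /near0_radius[r3 r3p dft] [rr rr0 dle].
have [r4 r4p gsm] : exists2 rho : R, 0 < rho &
    forall x, 0 < enorm (x - x0) < rho -> `|g x| <= 1 / 2.
  have h2 : 0 < 1 / 2 :> R by rewrite divr_gt0.
  have /eqoP/(_ _ h2)/dnear_enorm[rho rho0 H] := go.
  by exists rho => // x /H; rewrite normr1 mulr1.
have [r5 r5p ftd] : exists2 rho : R, 0 < rho &
    forall h, 0 < h < rho -> ft^`()%classic h <= - (c / 2) * h.
  have : \forall h \near 0^'+, - (1 / 2) <= rr h.
    by apply: (cvgr_ge _ rr0); lra.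
  move=> /near0_right[ra ra0 Ha]; move: dle => /near0_right[rb rb0 Hb].
  exists (Num.min ra rb); first by rewrite lt_min ra0.
  move=> h /andP[h0]; rewrite lt_min => /andP[hra hrb].
  have := Hb h; rewrite h0 hrb => /(_ isT)/le_trans; apply.
  have := Ha h; rewrite h0 hra => /(_ isT) H.
  have : 0 <= c * h * (rr h + 1 / 2) by rewrite mulr_ge0 ?mulr_ge0 ?(ltW c0) ?(ltW h0)//; lra.
  lra.
pose rm := Num.min r1 (Num.min r2 (Num.min r3 (Num.min r4 r5))).
have rm0 : 0 < rm by rewrite !lt_min r1p r2p r3p r4p r5p.
have rmE h : h < rm -> [/\ h < r1, h < r2, h < r3, h < r4 & h < r5].
  by rewrite !lt_min => /and5P[? ? ? ? ?].
have ft_drop a b : 0 <= a -> a <= b -> b < rm -> ft b + c / 2 * a * (b - a) <= ft a.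
  move=> a0 ab brm; have [_ _ b3 _ b5] := rmE _ brm.
  have dd t : a <= t <= b -> derivable ft t 1.
    by move=> /andP[at_ tb]; apply: dft; rewrite ger0_norm ?(le_lt_trans tb)// (le_trans a0).
  have [->|anb] := eqVneq a b; first by rewrite subrr mulr0 addr0.
  have {anb}ab' : a < b by rewrite lt_neqAle anb.
  have [] := @MVT R ft ft^`()%classic a b ab'.
  - move=> t; rewrite in_itv/= => /andP[at_ tb]; rewrite derive1E.
    by apply/derivableP/dd; rewrite !ltW.
  - by apply: derivable_within_continuous => t; rewrite in_itv/=; exact: dd.
  move=> t; rewrite in_itv/= => /andP[at_ tb] E.
  have H : ft^`()%classic t <= - (c / 2) * t.
    by apply: ftd; rewrite (le_lt_trans a0)//= (lt_trans tb).
  have ba : 0 <= b - a by rewrite subr_ge0.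
  have := ler_wpM2r ba H; rewrite -E.
  have : 0 <= c / 2 * (t - a) * (b - a) by rewrite !mulr_ge0// ?subr_ge0 ltW.
  lra.
(* The sign of [ft] is read off from f >= 0 at a point at distance h from the mode, where 1 + g >=
   1/2. *)
have ft_ge0 h : 0 < h < rm -> 0 <= ft h.
  move=> /andP[h0 hrm]; have [b1 _ _ b4 _] := rmE _ hrm.
  pose x := x0 + h *: delta_mx 0 (Ordinal d0).
  have xE : enorm (x - x0) = h.
    by rewrite /x addrC addKr enormZ enorm_delta mulr1 gtr0_norm.
  have := f0 x; rewrite fE ?xE// pmulr_rge0//.
  have := gsm x; rewrite xE h0 b4 => /(_ isT); rewrite ler_norml => /andP[h1 _].
  lra.
(* Positive because [ft] still drops strictly from rm/4 to rm/2 and is nonnegative there. *)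
pose m0 := ft (rm / 4).
have m0p : 0 < m0.
  have h1 : 0 <= ft (rm / 2) by apply: ft_ge0; apply/andP; split; lra.
  have h2 : 0 < c / 2 * (rm / 4) * (rm / 2 - rm / 4) by rewrite !mulr_gt0//; lra.
  apply: lt_le_trans (ft_drop (rm / 4) (rm / 2) _ _ _); lra.
have ft_itv h : 0 <= h <= rm / 4 -> m0 <= ft h <= ft 0.
  move=> /andP[h0 hr]; apply/andP; split.
    apply: le_trans (ft_drop h (rm / 4) h0 hr _); last by lra.
    by rewrite lerDl !mulr_ge0// ?subr_ge0// ltW.
  by have := ft_drop 0 h (lexx _) h0; rewrite mulr0 mul0r addr0; apply; lra.
have M0p : 0 < ft 0 by apply: (lt_le_trans m0p); have /andP[] := ft_itv 0 ltac:(apply/andP; split; lra).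
(* Chosen so that d coordinates of size at most eta (4 r), times the step s and the bound ft 0, add
   up to c r s / 16. *)
pose eta := c / (64 * d%:R * ft 0).
have d0' : 0 < d%:R :> R by rewrite ltr0n.
have eta0 : 0 < eta by rewrite divr_gt0// !mulr_gt0.
have [r6 r6p gsl] : exists2 rho : R, 0 < rho &
    forall x, 0 < enorm (x - x0) < rho -> forall j, `|gradient g x 0 j| <= eta * enorm (x - x0).
  have : \forall x \near x0^', forall j, `|gradient g x 0 j| <= eta * (enorm (x - x0) `^ (1 + gam)).
    apply: filter_forall => j.
    have /eqoP/(_ eta eta0) := gradg _ (enorm_delta j); apply: filterS => x.
    by rewrite dot_delta (ger0_norm (powR_ge0 _ _)).
  (* A radius below 1 gives r^(1 + gam) <= r, so the bound on the gradient becomes linear in r. *)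
  move=> /dnear_enorm[rho rho0 H]; exists (Num.min 1 rho); first by rewrite lt_min rho0 ltr01.
  move=> x /andP[xp]; rewrite lt_min => /andP[x1 xr] j.
  have := H x; rewrite xp xr => /(_ isT j)/le_trans; apply.
  rewrite ler_wpM2l ?(ltW eta0)// powRD ?(gt_eqF xp) ?implybT// powRr1 ?(ltW xp)//.
  rewrite -[leRHS]mulr1 ler_wpM2l ?(ltW xp)//.
  apply: (@le_trans _ _ (1 `^ gam)); last by rewrite powR1.
  by apply: ge0_ler_powR; rewrite ?nnegrE// ltW.
exists (Num.min (rm / 4) r6), (m0 / 2), (3 / 2 * ft 0), (c / 16); split.
- by rewrite lt_min r6p andbT divr_gt0.
- by rewrite divr_gt0.
- by rewrite divr_gt0.
- move=> x /andP[xp]; rewrite lt_min => /andP[xr _].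
  have [b1 _ _ b4 _] := rmE (enorm (x - x0)) ltac:(lra).
  have := gsm x; rewrite xp b4 => /(_ isT); rewrite ler_norml => /andP[g1 g2].
  have /andP[f1 f2] : m0 <= ft (enorm (x - x0)) <= ft 0 by apply: ft_itv; rewrite !ltW.
  by rewrite fE//; clear -f1 f2 g1 g2 m0p; apply/andP; split; nra.
move=> x u s u1 xp; rewrite lt_min => /andP[xr xr6] /andP[s0 s3] xu.
set r := enorm (x - x0) in xp xr xr6 s3 xu *.
have zE t : x + t *: u - x0 = (x - x0) + t *: u by rewrite addrAC.
have grow t : 0 <= t -> r + t / 2 <= enorm (x + t *: u - x0) <= r + t.
  by move=> t0; rewrite zE; apply: radius_growth.
have /andP[gr1 gr2] := grow s s0; set r' := enorm (x + s *: u - x0) in gr1 gr2.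
have rr' : r <= r' by clear -gr1 s0; lra.
have r'rm : r' <= rm / 4 by clear -gr2 s3 xr; lra.
have r'm : r' < rm by clear -r'rm rm0; lra.
have rrm : 4 * r < rm by clear -xr xp; lra.
have ftd' := ft_drop r r' (ltW xp) rr' r'm.
have /andP[f1 f2] : m0 <= ft r' <= ft 0 by apply: ft_itv; rewrite r'rm andbT (le_trans (ltW xp)).
have [b1 _ _ b4 _] := rmE r (le_lt_trans rr' r'm).
have [b1' _ _ _ _] := rmE r' r'm.
have := gsm x; rewrite -/r xp b4 => /(_ isT); rewrite ler_norml => /andP[g1 g2].
rewrite !fE// -/r -/r'.
have gi : `|g (x + s *: u) - g x| <= d%:R * (eta * (4 * r)) * s.
  have zr t : 0 <= t <= s -> 0 < enorm (x + t *: u - x0) <= 4 * r.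
    by move=> /andP[t0 ts]; have /andP[q1 q2] := grow t t0; clear -xp q1 q2 t0 ts s3; apply/andP; split; lra.
  have dgz t : 0 <= t <= s -> differentiable g (x + t *: u).
    by move=> /zr/andP[q1 q2]; apply: dg; have [_ h _ _ _] := rmE _ rrm; exact: le_lt_trans h.
  apply: segment_increment => // t ts.
  rewrite derive_gradient; last exact: dgz.
  apply: le_trans (ler_norm_sum _ _ _) _.
  have /andP[q1 q2] := zr t ts.
  apply: (@le_trans _ _ (\sum_(j < d) eta * (4 * r))); last by rewrite sumr_const card_ord -[leLHS]mulr_natl.
  apply: ler_sum => j _; rewrite normrM -[leRHS]mulr1 ler_pM//.
    apply: le_trans (gsl _ _ j) _; first by rewrite q1; exact: le_lt_trans xr6.
    by rewrite ler_wpM2l// ltW.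
  by rewrite -u1 coord_le_enorm.
have etaE : d%:R * (eta * (4 * r)) * s = c * r * s / (16 * ft 0).
  by rewrite /eta; field; rewrite !gt_eqF.
rewrite etaE in gi.
have k1 : ft r' * (g (x + s *: u) - g x) <= c * r * s / 16.
  apply: (@le_trans _ _ (ft 0 * (c * r * s / (16 * ft 0)))).
    rewrite (le_trans (ler_norm _))// normrM ler_pM// ger0_norm//.
    by rewrite (le_trans _ f1)// ltW.
  by rewrite le_eqVlt; apply/orP; left; apply/eqP; field; rewrite gt_eqF.
have k2 : c / 2 * r * (s / 2) <= ft r - ft r'.
  have : c / 2 * r * (s / 2) <= c / 2 * r * (r' - r).
    have cr : 0 <= c / 2 * r by apply: ltW; rewrite !(divr_gt0, mulr_gt0).
    by apply: (ler_wpM2l cr); clear -gr1; lra.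
  by clear -ftd'; lra.
have k3 : 1 / 2 * (c / 2 * r * (s / 2)) <= (1 + g x) * (ft r - ft r').
  apply: ler_pM k2 => //; last by clear -g1; lra.
  by apply: mulr_ge0; [apply: ltW; rewrite !(divr_gt0, mulr_gt0)|rewrite divr_ge0].
have -> : (1 + g (x + s *: u)) * ft r' = (1 + g x) * ft r' + ft r' * (g (x + s *: u) - g x).
  by ring.
by clear -k1 k3; lra.
Qed.

End local_shape.

Lemma sum_enorm {R : realType} d (I : finType) (F : I -> 'rV[R]_d) :
  enorm (\sum_i F i) <= \sum_i enorm (F i).
Proof.
elim/big_ind2 : _ => //.
  by rewrite /enorm dot0l sqrtr0.
by move=> x a y b xa yb; rewrite (le_trans (enormD _ _))// lerD.
Qed.

Section wedge_near_mode.
Context {R : realType} {d : nat} (f : 'rV[R]_d -> R) (K : wedge R d) (x0 : 'rV[R]_d).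
Context (rho m M c' : R).
Local Notation e := (wdir K).
Local Notation v := (wvertex K).
Local Notation L := (wlen K).
Local Notation tn := (tan (wangle K)).
Local Notation W := (wedge_set (unit_wedge K)).

Hypothesis d0 : (0 < d)%N.
Hypothesis e1 : enorm e = 1.
Hypothesis eB : orthonormal_frame e (wframe K).
Hypothesis L0 : (0 : R) < L.
Hypothesis tn0 : (0 : R) < tn.
Hypothesis tn1 : d%:R * tn <= 1 / 10.
Hypothesis vL : L <= enorm (v - x0).
Hypothesis ve : 9 / 10 * enorm (v - x0) <= dot (v - x0) e.
Hypothesis vrho : 4 * (enorm (v - x0) + 2 * L) < rho.
Hypothesis c'0 : (0 : R) < c'.
Hypothesis f_bound : forall x, 0 < enorm (x - x0) < rho -> m <= f x <= M.
Hypothesis f_dec : forall x u s, enorm u = 1 -> 0 < enorm (x - x0) ->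
  4 * enorm (x - x0) < rho -> 0 <= s <= 3 * enorm (x - x0) ->
  enorm (x - x0) / 2 <= dot (x - x0) u ->
  f (x + s *: u) + c' * enorm (x - x0) * s <= f x.

(** The part of y orthogonal to e is at most d tn P_e y <= P_e y / 10. As the cosine between e and v
    - x0 is at least 9/10, the product of v - x0 with y is at least 8/10 |v - x0| P_e y, which
    exceeds half of 11/10 |v - x0| P_e y. *)
Lemma unit_wedge_axis y : W y ->
  [/\ 0 < dot y e, dot y e <= enorm y, enorm y <= 11 / 10 * dot y e &
      enorm (v - x0) * enorm y / 2 <= dot (v - x0) y].
Proof.
move=> /unit_wedgeP[p0 p1 h].
pose q := \sum_i dot y (row i (wframe K)) *: row i (wframe K).
have yE : y = dot y e *: e + q := orthonormal_decomp y d0 e1 eB.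
set p := dot y e in p0 p1 h yE *.
have qp : enorm q <= p / 10.
  apply: le_trans (sum_enorm _) _.
  apply: (@le_trans _ _ (\sum_(i < d.-1) tn * p)).
    by apply: ler_sum => i _; rewrite enormZ (enorm_frame eB) mulr1.
  rewrite sumr_const card_ord -[leLHS]mulr_natl.
  have : d.-1%:R * tn <= d%:R * tn :> R by rewrite ler_wpM2r ?ler_nat ?leq_pred// ltW.
  move=> h'; have : d.-1%:R * tn * p <= 1 / 10 * p.
    by rewrite ler_wpM2r ?(ltW p0)// (le_trans h' tn1).
  lra.
have py : p <= enorm y.
  rewrite -[p]gtr0_norm// (le_trans (cauchy_schwarz _ _))// e1 mulr1//.
have yp : enorm y <= 11 / 10 * p.
  rewrite {1}yE (le_trans (enormD _ _))// enormZ e1 mulr1 gtr0_norm//; lra.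
split => //.
rewrite [y in dot _ y]yE dotDr dotZr.
have := cauchy_schwarz (v - x0) q; rewrite ler_norml => /andP[cs _].
have ve' := ve; have vL' := vL; set r := enorm (v - x0) in ve' vL' cs *.
have r0 : 0 < r by apply: lt_le_trans vL'.
have : p * (9 / 10 * r) <= p * dot (v - x0) e by rewrite ler_wpM2l// ltW.
have : r * enorm q <= r * (p / 10) by rewrite ler_wpM2l// ltW.
have : r * enorm y <= r * (11 / 10 * p) by rewrite ler_wpM2l// ltW.
have : 0 <= p * r by rewrite mulr_ge0// ltW.
move: cs; rewrite -/r.
lra.
Qed.

Let point y z (yW : W y) (z0 : 0 <= z <= L) :
  [/\ L / 2 <= enorm (affine v z y - x0), enorm (affine v z y - x0) <= enorm (v - x0) + 2 * L &
     enorm (affine v z y - x0) * enorm y / 2 <= dot (affine v z y - x0) y].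
Proof.
have /unit_wedgeP[_ p1 _] := yW.
have [p0 py yp vy] := unit_wedge_axis yW.
have y0 : 0 < enorm y by apply: lt_le_trans py.
have /andP[z1 z2] := z0.
have xE : affine v z y - x0 = (v - x0) + z *: y by rewrite /affine addrAC.
have up : enorm (affine v z y - x0) <= enorm (v - x0) + z * enorm y.
  by rewrite xE (le_trans (enormD _ _))// enormZ ger0_norm.
have dE : dot (affine v z y - x0) y = dot (v - x0) y + z * enorm y ^+ 2.
  by rewrite xE dotDl dotZl enorm_sqr.
have zy2 : 0 <= z * enorm y ^+ 2 by rewrite mulr_ge0// sqr_ge0.
split.
- have := cauchy_schwarz (affine v z y - x0) y; rewrite ler_norml => /andP[_].
  rewrite dE => cs; rewrite -(ler_pM2r y0).
  have : L * enorm y <= enorm (v - x0) * enorm y by rewrite ler_wpM2r// ltW.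
  lra.
- apply: (le_trans up); rewrite lerD2l.
  apply: (@le_trans _ _ (L * enorm y)); first by rewrite ler_wpM2r// ltW.
  by rewrite mulrC ler_wpM2r ?(ltW L0)//; lra.
- have := ler_wpM2r (ltW y0) up; rewrite dE => up'; lra.
Qed.

Lemma wedge_decrease y z z' : W y -> 0 <= z -> z <= z' -> z' <= L ->
  f (affine v z' y) + c' * L / 2 * (z' - z) * dot y e <= f (affine v z y).
Proof.
move=> yW z0 zz zL.
have /unit_wedgeP[_ p1 _] := yW.
have [p0 py yp vy] := unit_wedge_axis yW.
have y0 : 0 < enorm y by apply: lt_le_trans py.
have z0L : 0 <= z <= L by rewrite z0 (le_trans zz).
have [x1 x2 x3] := point yW z0L.
set x := affine v z y in x1 x2 x3 *.
have zz' : 0 <= z' - z by rewrite subr_ge0.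
have xx : 0 < enorm (x - x0) by apply: lt_le_trans x1; rewrite divr_gt0.
pose u := (enorm y)^-1 *: y; pose s := (z' - z) * enorm y.
have xE : affine v z' y = x + s *: u.
  rewrite /x /u /s /affine scalerA -mulrA mulfV ?gt_eqF// mulr1 -addrA -scalerDl.
  by rewrite [z + _]addrC subrK.
have u1 : enorm u = 1.
  by rewrite enormZ gtr0_norm ?invr_gt0// mulVf// gt_eqF.
have s0 : 0 <= s by rewrite mulr_ge0// ltW.
(* The distance of x from the mode is at least L/2, so s stays within the admissible three times
   this distance. *)
have sL : s <= 11 / 10 * L.
  have q1 : enorm y <= 11 / 10 by lra.
  have q2 : z' - z <= L by lra.
  by rewrite /s mulrC ler_pM// ltW.

have H1 : f (affine v z' y) + c' * enorm (x - x0) * s <= f x.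
  have LL : (0 : R) < L := L0.
  rewrite xE; apply: f_dec => //; [move: vrho; lra|by rewrite s0/=; lra|].
  by rewrite dotZr [leRHS]mulrC ler_pdivlMr// mulrAC.
apply: le_trans H1; rewrite lerD2l.
have k1 : L / 2 * ((z' - z) * dot y e) <= enorm (x - x0) * s.
  apply: ler_pM => //; [lra|by rewrite mulr_ge0// ltW|].
  by rewrite ler_wpM2l.
have := ler_wpM2l (ltW c'0) k1; lra.
Qed.

Lemma wedge_bounds y z : W y -> 0 <= z <= L -> m <= f (affine v z y) <= M.
Proof.
move=> yW zL; have [x1 x2 _] := point yW zL; apply: f_bound.
rewrite (lt_le_trans _ x1) ?divr_gt0//=; apply: le_lt_trans x2 _.
have LL : (0 : R) < L := L0; have r0 := enorm_ge0 (v - x0); move: vrho; lra.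
Qed.

End wedge_near_mode.

(** * The test statistic of an outward wedge *)

Section signal_near_mode.
Context {R : realType} {d n : nat} (f : 'rV[R]_d -> R) (K : wedge R d)
  (x : 'I_n -> 'rV[R]_d) (b : R -> R) (t m M w c' : R).
Local Notation L := (wlen K).
Local Notation N := (nobs K x).
Local Notation p := (pstat K x).
Local Notation G z := (law f (below K z)).
Local Notation A := (n%:R * (L ^+ d * (m * w))).
Local Notation K0 := (c' * m / (64 * 64 * d%:R * M ^+ 2)).

(** A bounds the expected count from below. Its first lower bound makes N at least 99/100 of the
    mean and the error E at most 26 t sqrt N; the second makes the drift exceed 1400 t^2 sqrt N. The
    noise 4 E <= 104 t sqrt N leaves more than 1200 t^2 sqrt N. *)
Lemma Tstat_near_mode : (0 < d)%N -> 0 < L -> 1 <= t :> R ->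
  0 < w -> 0 < m -> 0 < M -> 0 < c' ->
  (forall z, 0 < z <= L -> G z = z ^+ d * b z) ->
  (forall z, 0 < z <= L -> m * w <= b z <= M * w) ->
  (forall z z', 0 < z -> z <= z' -> z' <= L ->
     b z' + c' * L / 4 * (z' - z) * (w / 2) <= b z) ->
  (forall z z', 0 <= z -> z <= z' -> z' <= L -> G z <= G z') ->
  quantile_close f K x t -> G 0 = 0 ->
  `|N%:R - n%:R * G L| <= 3 * t * (Num.sqrt (n%:R * G L) + t) ->
  (30 * (100 * t)) ^+ 2 <= A -> (14 * (100 * t ^+ 2)) ^+ 2 < (K0 * L ^+ 2) ^+ 2 * (A / 2) ->
  (12 <= N)%N /\ Tstat K x < - (12 * (100 * t ^+ 2) * Num.sqrt N%:R).
Proof.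
move=> d0 L0 t1 w0 m0 M0 c'0 Gb bb bs Gm uQ G00 NG At AK.
have d0' : 0 < d%:R :> R by rewrite ltr0n.
have t0 : 0 < t by lra.
have LL : 0 < L <= L by rewrite L0 lexx.
have n0 : 0 <= n%:R :> R by [].
have AG : A <= n%:R * G L.
  by rewrite ler_wpM2l// Gb// ler_wpM2l ?exprn_ge0 ?(ltW L0)//; have /andP[] := bb _ LL.
pose a := Num.sqrt (n%:R * G L).
have a0 : 0 <= a by apply: sqrtr_ge0.
have aE : a ^+ 2 = n%:R * G L.
  by rewrite sqr_sqrtr// (le_trans _ AG)// (le_trans _ At)// sqr_ge0.
have a3 : 30 * (100 * t) <= a.
  rewrite -ler_sqr ?nnegrE ?mulr_ge0 ?(ltW t0)//; by rewrite aE (le_trans At).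
move: NG; rewrite -/a -aE ler_norml => /andP[N1 N2].
have ta : t * (30 * (100 * t)) <= t * a by rewrite ler_wpM2l// ltW.
have aa : 30 * (100 * t) * a <= a * a by rewrite ler_wpM2r.
pose q := Num.sqrt (N%:R : R).
have q0 : 0 <= q by apply: sqrtr_ge0.
have qE : q ^+ 2 = N%:R by rewrite sqr_sqrtr.
have Nlo : 99 / 100 * a ^+ 2 <= N%:R by rewrite expr2 in N1 *; clear -N1 N2 ta aa a0 t0 t1 a3 f x b t m M w c'; lra.
have q3 : 29 * (100 * t) <= q.
  have h : 29 * (100 * t) <= 99 / 100 * a by clear -a3 t0 f x b t m M w c'; lra.
  rewrite -ler_sqr ?nnegrE ?mulr_ge0 ?(ltW t0)// qE.
  apply: le_trans Nlo; rewrite expr2 [a ^+ 2]expr2.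
  apply: (@le_trans _ _ (99 / 100 * a * (99 / 100 * a))).
    by apply: ler_pM => //; rewrite !mulr_ge0// ltW.
  have : 0 <= a * a by rewrite mulr_ge0.
  by clear -f x b t m M w c'; lra.
have N12 : (12 <= N)%N.
  have h : 12 <= q by clear -q3 t1 f x b t m M w c'; lra.
  rewrite -(ler_nat R) -qE expr2; apply: le_trans h _.
  by rewrite ler_peMl//; clear -q3 t1 f x b t m M w c'; lra.
split=> //.
pose E := dev t N.
have EE : E <= 26 * t * q.
  rewrite /E /dev -/q; have : t * (29 * (100 * t)) <= t * q by rewrite ler_wpM2l// ltW.
  have : 0 <= t * t by rewrite mulr_ge0// ltW.
  by clear -f x b t m M w c'; lra.
have E0 : 0 <= E by rewrite dev_ge0// ltW.
have tq : 29 * (100 * t) * q <= N%:R by rewrite -qE expr2 ler_wpM2r.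
have N0 : 0 < N%:R :> R by rewrite ltr0n (leq_trans _ N12).
have pN : 0 < p N <= L.
  rewrite pstat_gt0 ?leqnn ?andbT ?(leq_trans _ N12)//=.
  by have /andP[] := pstat_itv x N L0.
have pj j : (0 < j <= N)%N -> 0 < p j <= p N.
  by move=> jN; rewrite pstat_gt0//= pstat_mono//; case/andP: jN => _ ->; rewrite leqnn.
have pL j : (0 < j <= N)%N -> 0 < p j <= L.
  by move=> /pj/andP[-> h]; rewrite (le_trans h)//; case/andP: pN.
have bN0 : 0 < b (p N) by have /andP[h _] := bb _ pN; apply: lt_le_trans h; rewrite mulr_gt0.
pose u j := G (p j).
have uN0 : 0 < u N by rewrite /u Gb// mulr_gt0// exprn_gt0//; case/andP: pN.
have uE j : (j <= N)%N -> `|j%:R - n%:R * u j| <= E.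
  move=> jN; have := uQ 0%N j; rewrite jN leq0n subn0 pstat0 G00 subr0 => /(_ isT)/le_trans; apply.
  by apply: dev_mono => //; exact: ltW.
have := uE _ (leqnn _); rewrite ler_norml => /andP[eN1 eN2].
have uj j : (0 < j <= N)%N -> 0 <= u j <= u N.
  move=> jN; have /andP[h1 h2] := pj _ jN; have /andP[h3 h4] := pL _ jN; have /andP[h5 h6] := pN.
  by rewrite -{1}G00 !Gm// ltW.
(* p_N is comparable to L because G(p_N) is comparable to G(L). *)
have pNL : m / (4 * M) * L <= p N.
  have /andP[pN0 pN1] := pN.
  have h1 : 9 / 10 * (n%:R * G L) <= n%:R * u N.
    by rewrite -aE expr2; rewrite expr2 in N1 N2 Nlo; clear -eN1 eN2 N1 N2 Nlo EE q0 t0 tq aa a3 ta a0 t1 f x b t m M w c'; lra.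
  have nn0 : 0 < n%:R :> R.
    rewrite lt_neqAle n0 andbT; apply/eqP => n0'; move: At; rewrite -n0' mul0r.
    have : 0 < (30 * (100 * t)) ^+ 2 by rewrite exprn_gt0// !mulr_gt0.
    by rewrite ltNge => /negP.
  have h2 : 9 / 10 * G L <= u N by rewrite -(ler_pM2l nn0); clear -h1 f x b t m M w c'; lra.
  have h3 : 9 / 10 * (L ^+ d * (m * w)) <= p N ^+ d * (M * w).
    apply: (@le_trans _ _ (9 / 10 * G L)).
      by rewrite ler_wpM2l// Gb// ler_wpM2l ?exprn_ge0 ?(ltW L0)//; have /andP[] := bb _ LL.
    apply: (le_trans h2); rewrite /u Gb// ler_wpM2l ?exprn_ge0 ?(ltW pN0)//.
    by have /andP[] := bb _ pN.
  pose y := p N / L.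
  have y0 : 0 <= y by rewrite divr_ge0// ltW.
  have y1 : y <= 1 by rewrite ler_pdivrMr// mul1r.
  have yd : y ^+ d <= y by rewrite -[leRHS]expr1 ler_wiXn2l.
  have Ld : 0 < L ^+ d by rewrite exprn_gt0.
  have h4 : 9 / 10 * m <= y ^+ d * M.
    have -> : y ^+ d = p N ^+ d / L ^+ d by rewrite expr_div_n.
    rewrite -(ler_pM2r w0) -(ler_pM2l Ld).
    have -> : L ^+ d * (p N ^+ d / L ^+ d * M * w) = p N ^+ d * (M * w) by field; rewrite gt_eqF.
    by clear -h3 f x b t m M w c'; lra.
  have h5 : m / (4 * M) <= y.
    rewrite ler_pdivrMr ?mulr_gt0//.
    have : y ^+ d * M <= y * M by rewrite ler_wpM2r// ltW.
    by clear -h4 m0 f x b t m M w c'; lra.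
  by move: h5; rewrite /y ler_pdivlMr.
have theta0 : 0 <= c' * L / (8 * M) by rewrite divr_ge0 ?mulr_ge0 ?ltW.
have T1 : Tstat K x <= 4 * E - c' * L / (8 * M) * N%:R * p N / (128 * d%:R).
  (* Here theta is the slope c' L w / 8 of b divided by the upper bound M w of b. *)
  apply: (@Tstat_le R d n K x (fun j => u j / u N)) => //.
  - by clear -EE tq E0 q0 t0 f x b t m M w c'; lra.
  - move=> j /andP[j0 jN]; have /andP[h1 _] := uj j ltac:(by rewrite j0 ltnW).
    exact: divr_ge0 h1 (ltW uN0).
  - move=> j /andP[j0 jN]; have /andP[h1 h2] := uj j ltac:(by rewrite j0 ltnW).
    have r0 : 0 <= u j / u N by exact: divr_ge0 h1 (ltW uN0).
    have r1 : u j / u N <= 1 by rewrite ler_pdivrMr// mul1r.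
    have -> : N%:R * (u j / u N) - j%:R = (N%:R - n%:R * u N) * (u j / u N) - (j%:R - n%:R * u j).
      by field; rewrite (gt_eqF uN0).
    have -> : 2 * E = E + E by ring.
    rewrite (le_trans (ler_normB _ _))// lerD ?uE ?(ltnW jN)//.
    rewrite normrM (ger0_norm r0) -[leRHS]mulr1 ler_pM ?uE//.
  - move=> j /andP[j0 jN]; have jN' : (0 < j <= N)%N by rewrite j0 ltnW.
    have /andP[p1 p2] := pj _ jN'; have pjL := pL _ jN'; have /andP[pN0 pN1] := pN.
    have /andP[bj1 bj2] := bb _ pjL.
    have bj0 : 0 < b (p j) by apply: lt_le_trans bj1; rewrite mulr_gt0.
    have -> : p j ^+ d / p N ^+ d = u j / u N * (b (p N) / b (p j)).
      by rewrite /u !Gb//; field; rewrite !gt_eqF ?exprn_gt0.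
    have /andP[h1 h2] := uj _ jN'.
    apply: (ler_wpM2l (divr_ge0 h1 (ltW uN0))); rewrite (ler_pdivrMr _ _ bj0) mulrBl mul1r.
    have := bs _ _ p1 p2 pN1.
    set D := p N - p j; have D0 : 0 <= D by rewrite subr_ge0.
    have : c' * L / (8 * M) * D * b (p j) <= c' * L / (8 * M) * D * (M * w).
      by rewrite ler_wpM2l// mulr_ge0.
    have -> : c' * L / (8 * M) * D * (M * w) = c' * L / 4 * D * (w / 2).
      by field; rewrite gt_eqF.
    by clear -f x b t m M w c'; lra.
have K0p : 0 < K0 by rewrite !(divr_gt0, mulr_gt0, exprn_gt0).
(* Inserting p N >= m L / (4 M) gives the denominator 8 * 4 * 128 = 64 * 64 of K0. *)
have T2 : K0 * L ^+ 2 * N%:R <= c' * L / (8 * M) * N%:R * p N / (128 * d%:R).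
  have -> : K0 * L ^+ 2 * N%:R = c' * L / (8 * M) * N%:R / (128 * d%:R) * (m / (4 * M) * L).
    by field; rewrite !gt_eqF.
  have -> : c' * L / (8 * M) * N%:R * p N / (128 * d%:R) = c' * L / (8 * M) * N%:R / (128 * d%:R) * p N.
    by ring.
  apply: ler_wpM2l pNL; apply: divr_ge0; last by rewrite mulr_ge0.
  by apply: mulr_ge0 theta0 (ler0n _ _).
have T3 : 14 * (100 * t ^+ 2) < K0 * L ^+ 2 * q.
  have h0 : 0 <= K0 * L ^+ 2 by rewrite mulr_ge0 ?sqr_ge0// ltW.
  have hA : 0 <= 14 * (100 * t ^+ 2) by rewrite !mulr_ge0// ltW.
  have hB : 0 <= K0 * L ^+ 2 * q by rewrite mulr_ge0.
  rewrite -ltr_sqr ?nnegrE//; apply: (lt_le_trans AK).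
  rewrite [leRHS]exprMn qE ler_wpM2l ?sqr_ge0//.
  by have := sqr_ge0 a; move: AG; rewrite -aE; clear -Nlo f x b t m M w c'; lra.
have q0' : 0 < q by clear -q3 t0 f x b t m M w c'; lra.
have T4 : 14 * (100 * t ^+ 2) * q < K0 * L ^+ 2 * N%:R by rewrite -qE [q ^+ 2]expr2 [ltRHS]mulrA ltr_pM2r.
have T5 : t * q <= t ^+ 2 * q by rewrite ler_wpM2r// expr2 ler_peMl ?(ltW t0)//; lra.
have tq0 : 0 <= t * q := mulr_ge0 (ltW t0) q0.
by rewrite -/q; clear -T1 T2 T4 T5 EE tq0 f x b t m M w c'; lra.
Qed.

End signal_near_mode.

(** * The good event *)

Section level_points.
Context {R : realType} {d : nat} (mu : probability 'rV[R]_d R) (f : 'rV[R]_d -> R).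
Hypothesis mf : measurable_fun setT f.
Hypothesis f0 : forall y, 0 <= f y.
Hypothesis muE : forall A, measurable A ->
  mu A = (\int[@lebesgue_rV R d]_(y in A) (f y)%:E)%E.
Context (K : wedge R d).
Local Notation L := (wlen K).
Local Notation G z := (law f (below K z)).
Local Notation g := (law f (below K (wlen K))).
Hypothesis d0 : (0 < d)%N.
Hypothesis e1 : enorm (wdir K) = 1.
Hypothesis eB : orthonormal_frame (wdir K) (wframe K).
Hypothesis L0 : 0 < L.

Lemma level_itv n k : 0 <= level n g k <= g.
Proof.
by rewrite /level le_min divr_ge0//= law_ge0//= ge_min lexx orbT.
Qed.

(** A flat part of G leaves the point of a level undetermined. Choosing it as a function of the
    level sends equal levels to one point, and larger levels to larger points since G is monotone.
    The ends are set to 0 and L, where the counts are 0 and N. *)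
Lemma level_points n : (0 < n)%N -> exists zz : nat -> R,
  [/\ zz 0%N = 0, zz n = L, forall k, (k <= n)%N -> 0 <= zz k <= L,
    forall k, (k <= n)%N -> G (zz k) = level n g k &
    forall k l, (k <= l <= n)%N -> zz k <= zz l].
Proof.
move=> n0.
have H (q : R) : exists z, 0 <= q <= g -> 0 <= z <= L /\ G z = q.
  have [qg|qg] := boolP (0 <= q <= g); last by exists 0.
  by have [z zL zq] := law_level mf muE d0 e1 eB L0 qg; exists z.
have [zeta zetaP] := choice H.
have g0 : 0 <= g := law_ge0 _ f0.
have g1 : g <= 1 by apply: (law_le1 muE); exact: measurable_below.
have L0' := ltW L0.
pose zz k := if k == 0%N then 0 else if k == n then L else zeta (level n g k).
have zzL k : 0 <= zz k <= L.
  rewrite /zz; case: eqP => _; first by rewrite lexx.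
  case: eqP => _; first by rewrite lexx andbT.
  by have [] := zetaP _ (level_itv n k).
have Gz k : G (zz k) = level n g k.
  rewrite /zz; case: eqP => [->|_].
    by rewrite law_below0 /level mul0r min_l.
  case: eqP => [->|_]; last by have [] := zetaP _ (level_itv n k).
  by rewrite /level divff ?min_r// pnatr_eq0 gtn_eqF.
exists zz; split => //.
- by rewrite /zz gtn_eqF// eqxx.
- move=> k l /andP[kl ln].
  have [k0|k0] := eqVneq k 0%N; first by rewrite {1}/zz k0 eqxx; have /andP[] := zzL l.
  have [ln'|ln'] := eqVneq l n.
    rewrite [leRHS]/zz ln' gtn_eqF// eqxx; have /andP[] := zzL k; done.
  have l0 : l != 0%N by rewrite -lt0n (leq_trans _ kl)// lt0n.
  have kn : k != n by rewrite neq_ltn (leq_ltn_trans kl)// ltn_neqAle ln' ln.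
  have lev : level n g k <= level n g l.
    rewrite /level le_min !ge_min lexx orbT andbT.
    by rewrite ler_pM2r ?invr_gt0 ?ltr0n// ler_nat kl.
  have [elev|nlev] := eqVneq (level n g k) (level n g l).
    by rewrite /zz (negbTE k0) (negbTE l0) (negbTE kn) (negbTE ln') elev.
  have {nlev}lev : level n g k < level n g l by rewrite lt_neqAle nlev.
  rewrite leNgt; apply/negP => /ltW /(law_below_mono muE K).
  by rewrite !Gz leNgt lev.
Qed.

End level_points.

Section good_event.
Context {R : realType} {d : nat} {disp : measure_display} {T : measurableType disp}
  (P : probability T R) (n : nat) (X : 'I_n -> {RV P >-> 'rV[R]_d})
  (f : 'rV[R]_d -> R) (I : finType) (K : I -> wedge R d).
Hypothesis n0 : (0 < n)%N.
Hypothesis d0 : (0 < d)%N.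
Hypothesis indep : independent_RV X.
Hypothesis dens : forall i, has_density (X i) f.
Hypothesis Kdir : forall i, enorm (wdir (K i)) = 1.
Hypothesis Kframe : forall i, orthonormal_frame (wdir (K i)) (wframe (K i)).
Hypothesis Klen : forall i, 0 < wlen (K i).
Local Notation g i := (law f (below (K i) (wlen (K i)))).

(** One bad event for each wedge and each pair k <= l of its quantile points. The slabs do not
    depend on the sample, so Chernoff's bound applies to each. *)
Lemma good_event t : (1 : R) <= t -> exists Om : set T,
  [/\ measurable Om,
    (P (~` Om) <= (#|I|%:R * n.+1%:R ^+ 2 * (2 * expR (- t ^+ 2)))%:E)%E,
    forall w, Om w -> forall i, quantile_close f (K i) (sample X w) t &
    forall w, Om w -> forall i,
      `|(nobs (K i) (sample X w))%:R - n%:R * g i| <=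
        3 * t * (Num.sqrt (n%:R * g i) + t)].
Proof.
move=> t1; have t0 : 0 < t by apply: lt_le_trans t1.
have [mf f0 _] := dens (Ordinal n0).
pose mu : probability 'rV[R]_d R := distribution P (X (Ordinal n0)).
have muE A : measurable A -> mu A = (\int[@lebesgue_rV R d]_(y in A) (f y)%:E)%E.
  by have [_ _ h] := dens (Ordinal n0); exact: h.
have H i := level_points mf f0 muE d0 (Kdir i) (Kframe i) (Klen i) n0.
have [zz zzP] := choice H.
pose lev i k := level n (g i) k.
pose Sl i k l := slab (K i) (zz i k) (zz i l).
pose bad i (k l : nat) (h : nat) : bool :=
  3 * t * (Num.sqrt (n%:R * (lev i l - lev i k)) + t) <=
  `|h%:R - n%:R * (lev i l - lev i k)|.
pose Bad (j : I * ('I_n.+1 * 'I_n.+1)) : set T :=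
  if (j.2.1 <= j.2.2)%N then [set w | bad j.1 j.2.1 j.2.2 (hits (Sl j.1 j.2.1 j.2.2) (sample X w))]
  else set0.
have mBad j : measurable (Bad j).
  rewrite /Bad; case: ifP => // _; apply: (measurable_hits X (bad j.1 j.2.1 j.2.2)).
  exact: measurable_slab.
have PBad j : (P (Bad j) <= (2 * expR (- t ^+ 2))%:E)%E.
  rewrite /Bad; case: ifPn => [kl|_]; last by rewrite measure0 lee_fin mulr_ge0// expR_ge0.
  case: j kl => i [k l] /= kl.
  have [zz0 zzn zzL Gzz zzm] := zzP i.
  have zkl : zz i k <= zz i l by apply: zzm; rewrite kl -ltnS ltn_ord.
  have lawS : law f (Sl i k l) = lev i l - lev i k.
    by rewrite (law_slab muE)// !Gzz// -ltnS ltn_ord.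
  have mS : measurable (Sl i k l) by exact: measurable_slab.
  apply: (hits_dev (A := Sl i k l) (p := lev i l - lev i k)) => //.
    move=> a; rewrite -lawS (lawE muE)//.
    by have [_ _ h] := dens a; rewrite muE// -h.
  by rewrite -lawS law_ge0//= (law_le1 muE).
pose Om : set T := ~` \big[setU/set0]_(j <- enum {: I * ('I_n.+1 * 'I_n.+1)}) Bad j.
have mU : measurable (\big[setU/set0]_(j <- enum {: I * ('I_n.+1 * 'I_n.+1)}) Bad j).
  exact: bigsetU_measurable.
have OmE w : Om w -> forall i (k l : nat), (k <= l <= n)%N ->
    ~~ bad i k l (hits (Sl i k l) (sample X w)).
  move=> Omw i k l /andP[kl ln]; apply/negP => h; apply: Omw.
  have kn : (k < n.+1)%N by rewrite ltnS (leq_trans kl).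
  rewrite -bigcup_seq; exists (i, (Ordinal kn, Ordinal (ln : (l < n.+1)%N))).
    by rewrite /= mem_enum.
  by rewrite /Bad /= kl.
have bal w i : Om w -> balanced n t (g i) (fun z => hits (below (K i) z) (sample X w)) (zz i).
  move=> Omw k l kln; have := OmE w Omw i k l kln.
  have [zz0 zzn zzL Gzz zzm] := zzP i.
  rewrite /bad -ltNge -(hits_slab (K i) (sample X w) (zzm _ _ kln)) natrD addrK.
  exact: ltW.
exists Om; split.
- exact: measurableC.
- rewrite setCK.
  apply: le_trans (measure_bigsetU_le _ _ _ _) _ => //.
  apply: (@le_trans _ _ (\sum_(j <- enum {: I * ('I_n.+1 * 'I_n.+1)}) (2 * expR (- t ^+ 2))%:E)%E).
    by apply: lee_sum => j _; exact: PBad.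
  rewrite sumEFin big_const_seq count_predT -cardT !card_prod !card_ord iter_addr_0.
  by rewrite lee_fin -[leLHS]mulr_natl !natrM expr2 mulrA.
- move=> w Omw i j l jl.
  have [zz0 zzn zzL Gzz zzm] := zzP i.
  apply: (quantile_dev (n := n) (N := nobs (K i) (sample X w)) (g := g i)
    (L := wlen (K i)) (cnt := fun z => hits (below (K i) z) (sample X w))
    (G := fun z => law f (below (K i) z)) (zz := zz i)) => //.
  + by apply: (law_le1 muE); exact: measurable_below.
  + by move=> a b _ ab _; exact: (law_below_mono muE).
  + exact: law_below0.
  + exact: pstat0.
  + by move=> k; exact: pstat_itv.
  + by move=> a b ab; exact: pstat_mono.
  + exact: hits_below0.
  + exact: hits_below_len.
  + by move=> z k kN; rewrite pstat_le.
  + exact: bal.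
(* The pair (0, n) is the slab that fills the whole wedge. *)
- move=> w Omw i; have := bal w i Omw 0%N n; rewrite leq0n leqnn => /(_ isT).
  have [zz0 zzn zzL Gzz zzm] := zzP i.
  rewrite -!Gzz// zz0 zzn hits_below0 hits_below_len law_below0 !subr0; exact.
Qed.

End good_event.

(** * Conditional critical values *)

Section measurable_statistics.
Context {R : realType}.

Lemma measurable_invr : measurable_fun [set: R] (fun x : R => x^-1).
Proof.
have -> : [set: R] = [set x : R | x != 0] `|` [set 0].
  by apply/seteqP; split=> x //= _; have [->|] := eqVneq x 0; [right|left].
apply/measurable_funU => //.
- by apply: open_measurable; exact: open_neq.
split; last exact: measurable_fun_set1.
apply: open_continuous_measurable_fun; first exact: open_neq.
by move=> x; rewrite inE /=; exact: inv_continuous.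
Qed.

Lemma measurable_beta : measurable_fun [set: R] (@beta_score R).
Proof.
apply: measurable_funM; last exact: measurable_indic.
by apply: measurable_funB => //; exact: measurable_funM.
Qed.

Context {d : nat} {disp : measure_display} {T : measurableType disp}
  (P : probability T R) (n : nat) (X : 'I_n -> {RV P >-> 'rV[R]_d}).

Lemma measurable_fun_le_sets (h : T -> R) :
  (forall r, measurable [set w | h w <= r]) -> measurable_fun setT h.
Proof.
move=> mh; apply: (measurability (@RGenOInfty.G R)) => [|/= _ [_] [r] -> <-].
  exact: RGenOInfty.measurableE.
rewrite setTI (_ : _ @^-1` _ = ~` [set w | h w <= r]); first exact: measurableC.
by apply/seteqP; split=> w /=; rewrite in_itv/= andbT ltNge => /negP.
Qed.

Context (K : wedge R d) (f : 'rV[R]_d -> R).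

Lemma measurable_cst_set (b : bool) : measurable [set _ : T | b].
Proof.
case: b; first by rewrite (_ : [set _ | _] = setT)//; apply/seteqP; split.
by rewrite (_ : [set _ | _] = set0)//; apply/seteqP; split.
Qed.

Lemma measurable_nobs (Q : pred nat) : measurable [set w | Q (nobs K (sample X w))].
Proof.
under eq_set do rewrite -hits_below_len.
by apply: (measurable_hits X Q); exact: measurable_below.
Qed.

Lemma measurable_pstat j : measurable_fun setT (fun w => pstat K (sample X w) j).
Proof.
apply: measurable_fun_le_sets => r; case: j => [|j].
  under eq_set do rewrite pstat0.
  exact: measurable_cst_set.
rewrite (_ : [set _ | _] =
  ([set w | (fun k => (j < k)%N) (nobs K (sample X w))] `&`
   [set w | (fun k => (j < k)%N) (hits (below K r) (sample X w))]) `|`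
  ([set w | (fun k => ~~ (j < k)%N) (nobs K (sample X w))] `&` [set w | 0 <= r])); last first.
  apply/seteqP; split=> w /=.
    have [jN|jN] := ltnP j (nobs K (sample X w)).
      by rewrite pstat_le//; left.
    by rewrite pstat_default ?ltnS//; right.
  move=> [[jN]|[jN]]; first by rewrite pstat_le.
  by rewrite pstat_default// ltnNge.
apply: measurableU; apply: measurableI.
- exact: (measurable_nobs (fun k => (j < k)%N)).
- by apply: (measurable_hits X (fun k => (j < k)%N)); exact: measurable_below.
- exact: (measurable_nobs (fun k => ~~ (j < k)%N)).
- exact: measurable_cst_set.
Qed.

Lemma measurable_law_pstat j : (forall a b, a <= b -> law f (below K a) <= law f (below K b)) ->
  measurable_fun setT (fun w => law f (below K (pstat K (sample X w) j))).
Proof.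
move=> Gm; apply: (measurableT_comp (f := fun z => law f (below K z)) _ (measurable_pstat j)).
by apply: nondecreasing_measurable.
Qed.

(* The range of summation of TUstat is random; freezing the number N of
   observations in the wedge makes it a measurable function. *)
Definition TUstat_at (N j k : nat) (w : T) : R :=
  let u l := law f (below K (pstat K (sample X w) l)) / law f (below K (pstat K (sample X w) N)) in
  \sum_(j.+1 <= l < k) beta_score ((u l - u j) / (u k - u j)).

Lemma TUstatE N j k w : nobs K (sample X w) = N -> (j < k <= N)%N ->
  TUstat f K (sample X w) j k = TUstat_at N j k w.
Proof.
move=> wN /andP[jk kN]; rewrite /TUstat /TUstat_at big_nat [RHS]big_nat.
apply: eq_bigr => l /andP[jl lk].
have jN : (j <= N)%N by rewrite (leq_trans _ kN)// ltnW.
have lN : (l <= N)%N by rewrite (leq_trans _ kN)// ltnW.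
by rewrite !Ftilde_pstat ?wN.
Qed.

Lemma measurable_TUstat_at N j k :
  (forall a b, a <= b -> law f (below K a) <= law f (below K b)) ->
  measurable_fun setT (TUstat_at N j k).
Proof.
move=> Gm.
have mu l : measurable_fun setT (fun w : T => law f (below K (pstat K (sample X w) l)) /
    law f (below K (pstat K (sample X w) N))).
  apply: measurable_funM; first exact: measurable_law_pstat.
  by apply: (measurableT_comp measurable_invr); exact: measurable_law_pstat.
apply: measurable_sum => l; apply: (measurableT_comp measurable_beta).
apply: measurable_funM; first by apply: measurable_funB.
by apply: (measurableT_comp measurable_invr); apply: measurable_funB.
Qed.

Definition Tstat_at (N : nat) (w : T) : R :=
  \sum_(1 <= j < N) beta_score (pstat K (sample X w) j ^+ d / pstat K (sample X w) N ^+ d).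

Lemma measurable_Tstat_at N : measurable_fun setT (Tstat_at N).
Proof.
apply: measurable_sum => j; apply: (measurableT_comp measurable_beta).
apply: measurable_funM; first by apply: measurable_funX; exact: measurable_pstat.
apply: (measurableT_comp measurable_invr).
by apply: measurable_funX; exact: measurable_pstat.
Qed.

End measurable_statistics.

Section kappa_bound.
Context {R : realType} {d : nat} {disp : measure_display} {T : measurableType disp}
  (P : probability T R) (n : nat) (X : 'I_n -> {RV P >-> 'rV[R]_d})
  (f : 'rV[R]_d -> R) (I : finType) (K : I -> wedge R d).
Hypothesis Gm : forall i a b, a <= b -> law f (below (K i) a) <= law f (below (K i) b).

Lemma measurable_counts nu : measurable [set w | counts K (sample X w) = nu].
Proof.
rewrite (_ : [set w | _] = \bigcap_(i in [set: I]) [set w | (fun k => k == nu i) (nobs (K i) (sample X w))]).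
  by apply: fin_bigcap_measurable => // i _; exact: (measurable_nobs X (K i) (fun k => k == nu i)).
apply/seteqP; split=> w /=.
  by move=> <- i _ /=; rewrite ffunE.
by move=> H; apply/ffunP => i; rewrite ffunE; have /eqP := H i Logic.I.
Qed.

(** Natural indices replace ordinals whose bound depends on the sample; this allows freezing the
    counts. *)
Lemma maxstat_leP (x : 'I_n -> 'rV[R]_d) (a : R) :
  (maxstat f K x <= a%:E)%E <->
  forall i j k, (j < k <= nobs (K i) x)%N -> (1 < k - j)%N ->
    Num.sqrt (3 / (k - j - 1)%N%:R) * `|TUstat f (K i) x j k|
     - Gamma_penalty ((k - j)%N%:R / (n%:R - 1)) <= a.
Proof.
split=> [/maxstat_le H i j k /andP[jk kN] kj1|H].
  have jN : (j < (nobs (K i) x).+1)%N by rewrite ltnS (leq_trans _ kN)// ltnW.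
  exact: (H i (Ordinal jN, Ordinal (kN : (k < (nobs (K i) x).+1)%N))).
apply/maxstat_le => i [[j /= jN] [k /= kN]] jk; apply: H => //.
by apply/andP; split; [rewrite -subn_gt0 (ltn_trans _ jk)|rewrite -ltnS].
Qed.

Lemma measurable_counts_maxstat nu (a : R) :
  measurable [set w | counts K (sample X w) = nu /\ (maxstat f K (sample X w) <= a%:E)%E].
Proof.
pose s i (jk : 'I_(nu i).+1 * 'I_(nu i).+1) (w : T) : R :=
  Num.sqrt (3 / (jk.2 - jk.1 - 1)%N%:R) * `|TUstat_at X (K i) f (nu i) jk.1 jk.2 w|
     - Gamma_penalty ((jk.2 - jk.1)%N%:R / (n%:R - 1)).
rewrite (_ : [set w | _] = [set w | counts K (sample X w) = nu] `&`
  \bigcap_(i in [set: I]) \bigcap_(jk in [set jk : 'I_(nu i).+1 * 'I_(nu i).+1 | (1 < jk.2 - jk.1)%N])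
    [set w | s i jk w <= a]); last first.
  apply/seteqP; split=> w /= [cw H]; split=> //.
    move=> i _ [[j /= jN] [k /= kN]] jk; rewrite /s /=.
    have wN : nobs (K i) (sample X w) = nu i by rewrite -cw ffunE.
    have jkN : (j < k <= nu i)%N by apply/andP; split; [rewrite -subn_gt0 (ltn_trans _ jk)|rewrite -ltnS].
    rewrite -(TUstatE _ wN jkN); move/maxstat_leP: H; apply => //.
    by rewrite wN.
  apply/maxstat_leP => i j k jkN jk.
  have wN : nobs (K i) (sample X w) = nu i by rewrite -cw ffunE.
  rewrite wN in jkN; have /andP[jk' kN] := jkN.
  have jN : (j < (nu i).+1)%N by rewrite ltnS (leq_trans _ kN)// ltnW.
  have := H i Logic.I (Ordinal jN, Ordinal (kN : (k < (nu i).+1)%N)) jk.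
  by rewrite /s /= -(TUstatE _ wN jkN).
apply: measurableI; first exact: measurable_counts.
apply: fin_bigcap_measurable => // i _; apply: fin_bigcap_measurable => // jk _.
apply: measurable_le_set; last exact: measurable_cst.
apply: measurable_funB; last exact: measurable_cst.
apply: measurable_funM; first exact: measurable_cst.
by apply: measurableT_comp => //; apply: measurable_TUstat_at; exact: Gm.
Qed.

End kappa_bound.

Lemma sum_measure_disjoint d (T : measurableType d) (R : realType)
    (mu : {measure set T -> \bar R}) (I : choiceType) (s : seq I) (Q : pred I) (F : I -> set T) :
  uniq s -> (forall i, measurable (F i)) ->
  (forall i j, i != j -> F i `&` F j = set0) ->
  (\sum_(i <- s | Q i) mu (F i) = mu (\big[setU/set0]_(i <- s | Q i) F i))%E.
Proof.
move=> us mF dF; elim: s us => [|i s IH] /=; first by rewrite !big_nil measure0.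
move=> /andP[ins us]; rewrite !big_cons; case: ifP => _; last exact: IH.
rewrite measureU//; [by rewrite IH|exact: bigsetU_measurable|].
rewrite -subset0 => w [Fi]; rewrite -bigcup_seq_cond => -[j /= /andP[js _] Fj].
have ij : i != j by apply: contraNneq ins => ->.
by have : (F i `&` F j) w by []; rewrite dF.
Qed.

Section conditional_quantile.
Context {R : realType} {d : nat} {disp : measure_display} {T : measurableType disp}
  (P : probability T R) (n : nat) (X : 'I_n -> {RV P >-> 'rV[R]_d})
  (f : 'rV[R]_d -> R) (I : finType) (K : I -> wedge R d).
Hypothesis Gm : forall i a b, a <= b -> law f (below (K i) a) <= law f (below (K i) b).
Context (alpha a : R).
Hypothesis alpha0 : (0 : R) < alpha.
Hypothesis a0 : (0 : R) <= a.

Let cnts w := counts K (sample X w).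
Let toN (eta : {ffun I -> 'I_n.+1}) : {ffun I -> nat} := [ffun i => eta i : nat].

Lemma nobs_le (L : wedge R d) (x : 'I_n -> 'rV[R]_d) : (nobs L x <= n)%N.
Proof.
rewrite /nobs /obs_in size_sort size_map size_filter.
by rewrite (leq_trans (count_size _ _))// size_enum_ord.
Qed.

(** Each count is at most n, so conditioning on the counts amounts to finite sums over [eta]. *)
Lemma counts_bounded w : exists eta, cnts w = toN eta.
Proof.
exists [ffun i => inord (nobs (K i) (sample X w))].
by apply/ffunP => i; rewrite !ffunE inordK// ltnS nobs_le.
Qed.

Let toN_inj : injective toN.
Proof.
by move=> x y /ffunP H; apply/ffunP => i; apply: val_inj; have := H i; rewrite !ffunE.
Qed.

(** If the set under the infimum is unbounded below, [inf] takes the default value 0, and 0 <= a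
    suffices. *)
Lemma kappa_le nu : 1 - alpha <= cond_cdf f K X nu a -> kappa f K X alpha nu <= a.
Proof.
move=> h; rewrite /kappa.
have [hi|/inf_out->//] := pselect (has_inf [set t | 1 - alpha <= cond_cdf f K X nu t]).
by apply: ge_inf => //; case: hi.
Qed.

Let Nset eta := [set w | cnts w = toN eta].
Let Eset eta := [set w | cnts w = toN eta /\ (maxstat f K (sample X w) <= a%:E)%E].

(* Averaging over the counts: if the conditional probability of exceeding a is
   larger than alpha on a set of counts, then this set has probability at most
   P(exceeding a) / alpha. *)
Lemma conditional_markov (Om : set T) (delta : R) : measurable Om ->
  (P (~` Om) <= delta%:E)%E ->
  (forall w, Om w -> (maxstat f K (sample X w) <= a%:E)%E) ->
  measurable [set w | 1 - alpha <= cond_cdf f K X (cnts w) a] /\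
  (P (~` [set w | (1 - alpha <= cond_cdf f K X (cnts w) a)%R]) <= (delta / alpha)%:E)%E.
Proof.
move=> mOm POm OmM.
have mN eta : measurable (Nset eta) by exact: measurable_counts.
have mE eta : measurable (Eset eta) by exact: measurable_counts_maxstat.
pose bad eta := cond_cdf f K X (toN eta) a < 1 - alpha.
set Good := [set w | _].
have badE : ~` Good = \big[setU/set0]_(eta | bad eta) Nset eta.
  rewrite -bigcup_seq_cond; apply/seteqP; split=> w /=.
    rewrite /Good/= => /negP; rewrite -ltNge => h.
    have [eta eE] := counts_bounded w; exists eta => //=.
    by rewrite mem_index_enum/= /bad -eE.
  move=> [eta /= /andP[_ h] eE]; rewrite /Good/= => h'.
  by move: h; rewrite /bad -eE ltNge h'.
have mU : measurable (\big[setU/set0]_(eta | bad eta) Nset eta) by exact: bigsetU_measurable.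
split; first by rewrite -[Good]setCK badE; exact: measurableC.
rewrite badE.
(* For bad counts the conditional probability of a maximum above a exceeds alpha, and such a maximum
   occurs only outside Om. *)
have step eta : bad eta -> (alpha%:E * P (Nset eta) <= P (Nset eta `&` ~` Om))%E.
  move=> beta.
  have fN : P (Nset eta) = (fine (P (Nset eta)))%:E by rewrite fineK// fin_num_measure.
  have fE : P (Eset eta) = (fine (P (Eset eta)))%:E by rewrite fineK// fin_num_measure.
  have EN : Eset eta `<=` Nset eta by move=> w [].
  apply: (@le_trans _ _ (P (Nset eta `\` Eset eta))); last first.
    apply: le_measure; rewrite ?inE.
    - exact: measurableD.
    - by apply: measurableI => //; exact: measurableC.
    - by move=> w [Nw nE]; split=> // Ow; apply: nE; split=> //; exact: OmM.
  have Nlt : (P (Nset eta) < +oo)%E by rewrite fN ltry.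
  have -> : P (Nset eta `\` Eset eta) = (fine (P (Nset eta)) - fine (P (Eset eta)))%:E.
    apply: etrans (measureD (mN eta) (mE eta) Nlt) _.
    by rewrite (setIidr EN) EFinB; congr (_ - _)%E.
  rewrite [in leLHS]fN -EFinM lee_fin.
  have N0 : 0 <= fine (P (Nset eta)) by rewrite fine_ge0.
  have E0 : fine (P (Eset eta)) <= fine (P (Nset eta)).
    by rewrite fine_le ?fin_num_measure// le_measure ?inE.
  move: beta; rewrite /bad /cond_cdf -/(Eset eta) -/(Nset eta).
  have [Nz|Nz] := eqVneq (fine (P (Nset eta))) 0.
    by move=> _; rewrite Nz mulr0 sub0r oppr_ge0 -[X in _ <= X]Nz.
  have {}N0 : 0 < fine (P (Nset eta)) by rewrite lt_neqAle eq_sym Nz.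
  by rewrite ltr_pdivrMr//; lra.
have dN eta eta' : eta != eta' -> Nset eta `&` Nset eta' = set0.
  move=> ne; rewrite -subset0 => w [/= h h'].
  by move/eqP: ne; apply; apply: toN_inj; rewrite -h -h'.
have H : (alpha%:E * P (\big[setU/set0]_(eta | bad eta) Nset eta) <= P (~` Om))%E.
  apply: (@le_trans _ _ (alpha%:E * \sum_(eta | bad eta) P (Nset eta))%E).
    rewrite lee_wpmul2l ?lee_fin ?(ltW alpha0)//.
    exact: measure_bigsetU_le.
  rewrite ge0_sume_distrr; last by move=> eta _; exact: measure_ge0.
  apply: (@le_trans _ _ (\sum_(eta | bad eta) P (Nset eta `&` ~` Om))%E).
    by apply: lee_sum => eta; exact: step.
  rewrite (sum_measure_disjoint P _ (F := fun eta => Nset eta `&` ~` Om)).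
  - apply: le_measure; rewrite ?inE.
    + by apply: bigsetU_measurable => eta _; apply: measurableI => //; exact: measurableC.
    + exact: measurableC.
    + by move=> w; rewrite -bigcup_seq_cond => -[eta _ []].
  - exact: index_enum_uniq.
  - by move=> eta; apply: measurableI => //; exact: measurableC.
  - move=> eta eta' ne; rewrite setIACA dN// set0I//.
have {}H := le_trans H POm.
have fB : P (\big[setU/set0]_(eta | bad eta) Nset eta) =
    (fine (P (\big[setU/set0]_(eta | bad eta) Nset eta)))%:E by rewrite fineK// fin_num_measure.
move: H; rewrite fB -EFinM !lee_fin ler_pdivlMr// mulrC//.
Qed.

(** For fixed counts the critical value is a constant and T_K a sum over a fixed range; the event is
    a finite union over the vectors of counts. *)
Lemma measurable_rejects (near : pred I) :
  measurable [set w | forall i, near i -> rejects f K X alpha w i].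
Proof.
pose crit (nu : {ffun I -> nat}) i : R :=
  Num.sqrt (((nu i)%:R - 1) / 3) * (kappa f K X alpha nu + Gamma_penalty ((nu i)%:R / (n%:R - 1))).
have cE w eta i : cnts w = toN eta -> nobs (K i) (sample X w) = toN eta i.
  by move=> <-; rewrite ffunE.
rewrite (_ : [set w | _] = \big[setU/set0]_(eta : {ffun I -> 'I_n.+1}) (Nset eta `&`
   \bigcap_(i in [set i | near i]) ([set w | (fun k => (2 <= k)%N) (nobs (K i) (sample X w))] `&`
      [set w | Tstat_at X (K i) (toN eta i) w < - crit (toN eta) i]))); last first.
  rewrite -bigcup_seq; apply/seteqP; split=> w /=.
    move=> H; have [eta eE] := counts_bounded w; exists eta; first by rewrite /= mem_index_enum.
    split=> // i /= ni; have [h1 h2] := H i ni; split=> //=.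
    by move: h2; rewrite /critval /Tstat -/(cnts w) eE (cE _ _ _ eE).
  move=> [eta _ [eE H]] i ni; have [h1 h2] := H i ni; split=> //.
  by move: h2; rewrite /= /critval /Tstat -/(cnts w) eE (cE _ _ _ eE).
apply: bigsetU_measurable => eta _; apply: measurableI; first exact: measurable_counts.
apply: fin_bigcap_measurable => // i _; apply: measurableI.
  exact: (measurable_nobs X (K i) (fun k => (2 <= k)%N)).
apply: measurable_lt_set; first exact: measurable_Tstat_at.
exact: measurable_cst.
Qed.

(** Failure requires either the complement of Om, of mass delta, or counts whose conditional
    critical value may exceed a, of mass delta / alpha. *)
Lemma rejects_prob (near : pred I) (Om : set T) (delta : R) : measurable Om ->
  (P (~` Om) <= delta%:E)%E ->
  (forall w, Om w -> (maxstat f K (sample X w) <= a%:E)%E) ->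
  (forall w, Om w -> forall i, near i -> let N := nobs (K i) (sample X w) in
    (2 <= N)%N /\ Tstat (K i) (sample X w) <
      - (Num.sqrt ((N%:R - 1) / 3) * (a + Gamma_penalty (N%:R / (n%:R - 1))))) ->
  ((1 - (delta + delta / alpha))%:E <=
    P [set w | forall i, near i -> rejects f K X alpha w i])%E.
Proof.
move=> mOm POm OmM OmT.
have [mG PG] := conditional_markov mOm POm OmM.
set S := [set w | _].
have mS : measurable S := measurable_rejects near.
set Good := [set w | _] in mG PG.
have sub : ~` S `<=` ~` Om `|` ~` Good.
  move=> w; rewrite /setC/= => nS; have [Ow|nO] := pselect (Om w); last by left.
  right => Gw; apply: nS => i ni; have [N2 h] := OmT w Ow i ni; split=> //.
  apply: lt_le_trans h _; rewrite lerN2 /critval ler_wpM2l ?sqrtr_ge0// lerD2r.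
  exact: kappa_le.
have : (P (~` S) <= (delta + delta / alpha)%:E)%E.
  apply: (@le_trans _ _ (P (~` Om `|` ~` Good))).
    by apply: le_measure; rewrite ?inE//; [exact: measurableC|apply: measurableU; exact: measurableC].
  apply: le_trans (measureU2 _ _ _) _; try exact: measurableC.
  by rewrite EFinD leeD.
have fS : P S = (fine (P S))%:E by rewrite fineK// fin_num_measure.
rewrite probability_setC// fS -EFinB !lee_fin; lra.
Qed.

End conditional_quantile.

(** * Asymptotics and the size of the family *)

Section elementary_asymptotics.
Context {R : realType}.
Implicit Types (A eps : R) (n k : nat).

Lemma ln_ge_near A : \forall n \near \oo, A <= ln (n%:R : R).
Proof.
pose m := (Num.truncn (expR A)).+1; exists m => // n /= mn.
have eA : expR A < m%:R.
  by have /andP[] := truncn_itv (ltW (expR_gt0 A)).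
have n0 : 0 < n%:R :> R by rewrite ltr0n (leq_trans _ mn).
rewrite -ler_expR lnK ?posrE// (le_trans (ltW eA))// ler_nat//.
Qed.

Lemma expR_ln_nat n : (0 < n)%N -> expR (ln n%:R) = n%:R :> R.
Proof. by move=> n0; rewrite lnK// posrE ltr0n. Qed.

Lemma ln_nat_le n : ln (n%:R : R) <= n%:R.
Proof.
case: n => [|n]; first by rewrite ln0.
by rewrite ltW// ln_sublinear// ltr0n.
Qed.

(** With t = ln n, n = e^t >= t^(k+1) / (k+1)!, so the quotient is at most (k+1)! / t. *)
Lemma ln_pow_near k eps : 0 < eps -> \forall n \near \oo, ln (n%:R : R) ^+ k / n%:R <= eps.
Proof.
move=> e0; near=> n.
have n0 : (0 < n)%N by near: n; exists 1%N.
have t0 : 1 <= ln (n%:R : R) by near: n; exact: ln_ge_near.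
have te : (k.+1)`!%:R / eps <= ln (n%:R : R) by near: n; exact: ln_ge_near.
set t := ln _ in t0 te *.
have tp : 0 < t by lra.
have nE : (n%:R : R) = expR t by rewrite expR_ln_nat.
have n0' : 0 < n%:R :> R by rewrite ltr0n.
have h : t ^+ k.+1 / (k.+1)`!%:R <= n%:R.
  by rewrite nE; apply: le_trans (expR_ge1Dxn k (ltW tp)); rewrite lerDr.
have f0 : 0 < (k.+1)`!%:R :> R by rewrite ltr0n fact_gt0.
rewrite ler_pdivrMr//; rewrite ler_pdivrMr// exprS in h.
rewrite ler_pdivrMr// in te.
rewrite -(ler_pM2l tp); apply: (le_trans h).
rewrite mulrC mulrA ler_wpM2r// ltW//.
Unshelve. all: by end_near.
Qed.

Lemma cos_near (y : R) : y < 1 ->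
  exists2 rho : R, 0 < rho & forall x, `|x| < rho -> y <= cos x.
Proof.
move=> y1; apply: near0_radius.
have : cos x @[x --> (0 : R)] --> cos (0 : R) by exact: continuous_cos.
rewrite cos0 => /cvgr_ge; exact.
Qed.

Lemma sin_bounds : exists2 rho : R, 0 < rho &
  forall x, 0 < x < rho -> x / 2 <= sin x <= x /\ 1 / 2 <= cos x.
Proof.
have [rho rho0 H] := @cos_near (1 / 2) ltac:(lra).
exists rho => // x /andP[x0 xr].
have cx : 1 / 2 <= cos x by apply: H; rewrite gtr0_norm.
have [|y /andP[]] := @MVT R sin cos 0 x x0 (fun y _ => is_derive_sin y).
  by apply: continuous_subspaceT; exact: continuous_sin.
rewrite !bnd_simp => y0 yx; rewrite sin0 !subr0 => sE.
have cy : 1 / 2 <= cos y by apply: H; rewrite gtr0_norm// (lt_trans yx).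
split=> //; rewrite sE; apply/andP; split.
  by have := ler_wpM2r (ltW x0) cy; lra.
by rewrite -[leRHS]mul1r ler_wpM2r ?(ltW x0)// cos_le1.
Qed.

Lemma tan_bounds : exists2 rho : R, 0 < rho &
  forall x, 0 < x < rho -> x / 2 <= tan x <= 2 * x.
Proof.
have [rho rho0 H] := sin_bounds; exists rho => // x xr.
have [/andP[s1 s2] c1] := H x xr; have /andP[x0 _] := xr.
have c0 : 0 < cos x by lra.
rewrite /tan ler_pdivlMr// ler_pdivrMr//; apply/andP; split.
  apply: le_trans s1; rewrite -[leRHS]mulr1 ler_wpM2l ?cos_le1// ltW// divr_gt0//.
have : 2 * x * (1 / 2) <= 2 * x * cos x by rewrite ler_wpM2l// ?mulr_ge0// ltW.
lra.
Qed.

Lemma wlength_pow d (C1 : R) n : (1 < n)%N -> 0 < C1 -> 0 <= ln (n%:R : R) ->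
  n%:R * Defs.wlength d C1 n ^+ (d + 4) = C1 ^+ (d + 4) * ln n%:R ^+ (d + 5).
Proof.
move=> n1 C10 t0; rewrite /Defs.wlength /lscale.
have n0 : 0 < n%:R :> R by rewrite ltr0n ltnW.
have h : ((ln n%:R / n%:R) `^ (d%:R + 4)^-1) ^+ (d + 4) = ln n%:R / n%:R :> R.
  have d4 : d%:R + 4 != 0 :> R by rewrite gt_eqF// ltr_wpDl.
  by rewrite -powR_mulrn ?powR_ge0// -powRrM natrD mulVf// powRr1// divr_ge0.
rewrite exprMn h exprMn (addnS d 4) exprSr; field.
by rewrite gt_eqF.
Qed.

(** A number in (0, 1] only grows under an exponent at most 1. The bound keeps the grid polynomial
    in n. *)
Lemma wlength_ge d (C1 : R) n : (1 < n)%N -> 0 < C1 -> 1 <= ln (n%:R : R) ->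
  C1 / n%:R <= Defs.wlength d C1 n.
Proof.
move=> n1 C10 t1; rewrite /Defs.wlength /lscale -mulrA ler_wpM2l ?(ltW C10)//.
have n0 : 0 < n%:R :> R by rewrite ltr0n ltnW.
set t := ln _ in t1 *.
have t0 : 0 < t by lra.
have tn0 : 0 < t / n%:R by rewrite divr_gt0.
have tn1 : t / n%:R <= 1 by rewrite ler_pdivrMr// mul1r ln_nat_le.
have h : t / n%:R <= (t / n%:R) `^ (d%:R + 4)^-1.
  have d4 : 1 <= d%:R + 4 :> R by have : 0 <= d%:R :> R by []; lra.
  have := ge1r_powR (a := (t / n%:R) `^ (d%:R + 4)^-1) (r := d%:R + 4) _ d4.
  have d4n : d%:R + 4 != 0 :> R by rewrite gt_eqF// (lt_le_trans _ d4).
  rewrite -powRrM mulVf// powRr1 ?(ltW tn0)//.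
  apply; rewrite powR_gt0//=.
  apply: (@le_trans _ _ (1 `^ (d%:R + 4)^-1)); last by rewrite powR1.
  apply: ge0_ler_powR; rewrite ?nnegrE ?(ltW tn0)//.
apply: (@le_trans _ _ (t / n%:R)).
  by rewrite -[leLHS]mul1r ler_wpM2r ?invr_ge0 ?(ltW n0).
by apply: (le_trans h); rewrite ler_peMl ?powR_ge0.
Qed.

Lemma wlength_near d (C1 : R) k eps : 0 < C1 -> 0 < eps ->
  \forall n \near \oo, ln n%:R ^+ k * Defs.wlength d C1 n <= eps.
Proof.
move=> C10 e0; near=> n.
have n1 : (1 < n)%N by near: n; exists 2%N.
have t1 : 1 <= ln (n%:R : R) by near: n; exact: ln_ge_near.
have n0 : 0 < n%:R :> R by rewrite ltr0n ltnW.
have t0 : 0 <= ln (n%:R : R) by lra.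
have C4 : 0 < C1 ^+ (d + 4) by rewrite exprn_gt0.
have L0 : 0 <= Defs.wlength d C1 n by rewrite /Defs.wlength !mulr_ge0 ?powR_ge0 ?(ltW C10).
have tL0 : 0 <= ln n%:R ^+ k * Defs.wlength d C1 n := mulr_ge0 (exprn_ge0 _ t0) L0.
rewrite -(@ler_pXn2r _ (d + 4)) ?addn_gt0 ?orbT ?nnegrE ?tL0 ?(ltW e0)//.
have -> : (ln n%:R ^+ k * Defs.wlength d C1 n) ^+ (d + 4) =
    C1 ^+ (d + 4) * (ln n%:R ^+ (k * (d + 4) + (d + 5)) / n%:R).
  rewrite exprMn -exprM; have := wlength_pow d n1 C10 t0 => h.
  have -> : Defs.wlength d C1 n ^+ (d + 4) = C1 ^+ (d + 4) * ln n%:R ^+ (d + 5) / n%:R.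
    by rewrite -h [RHS]mulrAC mulfV ?mul1r// gt_eqF.
  by rewrite (exprD _ (k * (d + 4)) (d + 5)) !mulrA; congr (_ / _); rewrite -!mulrA mulrCA.
rewrite mulrC -ler_pdivlMr//; near: n; apply: ln_pow_near.
by rewrite divr_gt0 ?exprn_gt0.
Unshelve. all: by end_near.
Qed.

End elementary_asymptotics.

(** * Polynomial bound on the number of wedges *)

Section directions.
Context {R : realType} {d : nat}.
Implicit Types (e v : 'rV[R]_d) (es : seq 'rV[R]_d).

Lemma cos_angle e v : enorm e = 1 -> 0 < enorm v ->
  [/\ 0 <= angle v e, angle v e <= pi & enorm v * cos (angle v e) = dot v e].
Proof.
move=> e1 v0; rewrite /angle e1 mulr1.
have h : -1 <= dot v e / enorm v <= 1.
  rewrite -ler_norml normrM normfV (gtr0_norm v0) ler_pdivrMr// mul1r.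
  by rewrite (le_trans (cauchy_schwarz _ _))// e1 mulr1.
split; [exact: acos_ge0|exact: acos_lepi|].
by rewrite acosK ?in_itv//= mulrC divfK// gt_eqF.
Qed.

(** Cut [-1, 1]^d into cells of side eta: two vectors in one cell differ by less than eta in every
    coordinate. *)
Lemma pigeonhole_size es (eta : R) : 0 < eta -> uniq es ->
  {in es, forall e i, `|e 0 i| <= 1} ->
  {in es &, forall e e', e != e' -> exists i, eta <= `|e 0 i - e' 0 i|} ->
  (size es <= (Num.truncn (2 / eta)).+1 ^ d)%N.
Proof.
move=> eta0 ues es1 esd; set M := Num.truncn _.
pose h e : {ffun 'I_d -> 'I_M.+1} := [ffun i => inord (Num.truncn ((e 0 i + 1) / eta))].
have hinj : {in es &, injective h}.
  move=> e e' ein e'in hee; apply/eqP/negPn/negP => ne.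
  have [i] := esd _ _ ein e'in ne; rewrite leNgt => /negP; apply.
  have hb (x : 'rV[R]_d) : x \in es -> 0 <= (x 0 i + 1) / eta <= 2 / eta.
    move=> xin; have := es1 _ xin i; rewrite ler_norml => /andP[x1 x2].
    by rewrite divr_ge0 ?(ltW eta0)//= ?ler_pM2r ?invr_gt0//; lra.
  have hM (x : 'rV[R]_d) : x \in es -> (Num.truncn ((x 0 i + 1) / eta)%R < M.+1)%N.
    by move=> xin; rewrite ltnS; apply: le_truncn; case/andP: (hb _ xin).
  have : nat_of_ord (h e i) = nat_of_ord (h e' i) by rewrite hee.
  rewrite !ffunE /= !inordK ?hM// => E.
  have /andP[a1 a2] := truncn_itv (proj1 (andP (hb _ ein))).
  have /andP[b1 b2] := truncn_itv (proj1 (andP (hb _ e'in))).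
  rewrite E in a1 a2; rewrite -natr1 in a2 b2.
  have : `|(e 0 i + 1) / eta - (e' 0 i + 1) / eta| < 1 by rewrite ltr_norml; apply/andP; split; lra.
  rewrite -mulrBl normrM normfV (gtr0_norm eta0) ltr_pdivrMr// mul1r.
  by rewrite (_ : e 0 i + 1 - (e' 0 i + 1) = e 0 i - e' 0 i)//; ring.
rewrite -(size_map h) -(_ : #|{ffun 'I_d -> 'I_M.+1}| = M.+1 ^ d)%N; last first.
  by rewrite card_ffun !card_ord.
rewrite -(card_uniqP _) ?map_inj_in_uniq// max_card//.
Qed.

End directions.

Section counting.
Context {R : realType} {d : nat}.
Implicit Types (e : 'rV[R]_d) (es : seq 'rV[R]_d) (n : nat).

Lemma angleC e e' : angle e e' = angle e' e.
Proof. by rewrite /angle dotC [enorm e * _]mulrC. Qed.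

(** The squared chord is 2 - 2 cos(angle) >= 4 sin(delta/2)^2, and the hypothesis on the sine bounds
    this below by (delta/2)^2. *)
Lemma angle_dist e e' (delta : R) : enorm e = 1 -> enorm e' = 1 ->
  0 <= delta <= pi -> delta / 4 <= sin (delta / 2) -> delta <= angle e e' ->
  delta / 2 <= enorm (e - e').
Proof.
move=> e1 e'1 /andP[d0 dpi] ds da.
have [a0 api aE] := cos_angle e'1 (ltac:(by rewrite e1) : 0 < enorm e).
rewrite e1 mul1r in aE.
have de : dot e e' <= cos delta.
  rewrite -aE leNgt; apply/negP; rewrite ltr_cos ?in_itv/= ?a0 ?d0//.
  by rewrite ltNge da.
have cE : cos delta = 1 - 2 * sin (delta / 2) ^+ 2.
  have -> : delta = (delta / 2) *+ 2 by rewrite -[RHS]mulr_natr divfK.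
  rewrite cos_mulr2n cos2sin2 mulr2n [(delta / 2) *+ 2 / 2](_ : _ = delta / 2); first ring.
  by rewrite -mulr_natr mulfK.
rewrite -ler_sqr ?nnegrE ?enorm_ge0 ?divr_ge0//.
rewrite enorm_sqr dotBl ![dot _ (e - e')]dotC !dotBl -!enorm_sqr e1 e'1 expr1n (dotC e' e).
have : (delta / 4) ^+ 2 <= sin (delta / 2) ^+ 2.
  by rewrite lerXn2r// nnegrE ?(le_trans _ ds)// divr_ge0.
rewrite !exprMn; lra.
Qed.

Lemma size_directions (C2 eps : R) n es : (0 < d)%N -> 0 < eps ->
  0 < wphi C2 n < pi / 2 -> wphi C2 n <= 1 ->
  wphi C2 n / 2 <= sin (wphi C2 n) ->
  greedy_directions C2 eps n es ->
  (size es <= (Num.truncn (2 / (wphi C2 n / (2 * Num.sqrt d%:R)))).+1 ^ d)%N.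
Proof.
move=> d0 eps0; set phi := wphi C2 n => /andP[phi0 phipi] phi1 phis [unit ues pes _].
have sd1 : 1 <= Num.sqrt d%:R :> R by rewrite -[leLHS]sqrtr1 ler_wsqrtr// ler1n.
have sd0 : 0 < Num.sqrt d%:R :> R by lra.
have eta0 : 0 < phi / (2 * Num.sqrt d%:R) by rewrite divr_gt0// mulr_gt0.
apply: pigeonhole_size => //.
  by move=> e /unit e1 i; rewrite -e1 coord_le_enorm.
have dist : {in es &, forall e e', e != e' -> phi <= enorm (e - e')}.
  move=> e e' ein e'in ne; have e1 := unit _ ein; have e'1 := unit _ e'in.
  (* In dimension 1 the separation is 0 and says nothing; but distinct unit vectors are 1 and -1, at
     distance 2. *)
  have [d1|dn1] := eqVneq d 1%N.
    have ord_eq (i j : 'I_d) : i = j.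
      by apply/val_inj => /=; case: i => i; case: j => j /=; rewrite {1 2}d1 !ltnS !leqn0 => /eqP -> /eqP ->.
    have sq (x : 'rV[R]_d) (i : 'I_d) : enorm x = 1 -> (x 0 i - 1) * (x 0 i + 1) = 0.
      move=> x1; have : dot x x = 1 by rewrite -enorm_sqr x1 expr1n.
      rewrite /dot (bigD1 i)//= big1 ?addr0 => [h|j /eqP ij]; last by exfalso; apply: ij; exact: ord_eq.
      by rewrite mulrDr mulrBl mulr1 mul1r h; ring.
    pose i := Ordinal d0.
    have nei : e 0 i != e' 0 i.
      by apply: contraNneq ne => h; apply/eqP/rowP => j; rewrite (ord_eq j i).
    apply: le_trans (coord_le_enorm _ i); rewrite !mxE; apply: (le_trans phi1).
    have := sq _ i e1; have := sq _ i e'1.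
    move=> /eqP; rewrite mulf_eq0 subr_eq0 addr_eq0 => /orP[/eqP h|/eqP h] /eqP;
      rewrite mulf_eq0 subr_eq0 addr_eq0 => /orP[/eqP h'|/eqP h']; move: nei; rewrite h h' ?eqxx// => _.
      by rewrite -opprD normrN ger0_norm//; lra.
    by rewrite opprK ger0_norm//; lra.
  have d2 : (2 <= d)%N by rewrite ltn_neqAle eq_sym dn1.
  (* For d >= 2 the factor sqrt(d - 1) is at least 1, so the arctangent is at least phi, and 2 + eps
     exceeds 2. *)
  have sep : phi + phi <= separation d C2 eps n.
    rewrite /separation -/phi.
    have t0 : 0 < tan phi.
      by rewrite -tan0 ltr_tan// ?in_itv/= ?phipi ?andbT//; have := pi_gt0 R; lra.
    have h : phi <= atan (Num.sqrt (d%:R - 1) * tan phi).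
      rewrite -[leLHS]tanK; last by rewrite in_itv/= phipi andbT; have := pi_gt0 R; lra.
      apply: le_atan; rewrite ler_peMl ?(ltW t0)// -[leLHS]sqrtr1 ler_wsqrtr//.
      by rewrite lerBrDr -(natrD _ 1 1) ler_nat.
    have : 0 <= eps * atan (Num.sqrt (d%:R - 1) * tan phi) by rewrite mulr_ge0 ?(ltW eps0)// (le_trans _ h)// ltW.
    lra.
  (* The greedy condition compares a direction with earlier ones only. Symmetry of the angle, with
     equality added for reflexivity, extends it to all pairs. *)
  have sym : all2rel (fun a b => (a == b) || (separation d C2 eps n <= `|angle b a|)) es.
    rewrite -pairwise_all2rel.
    - by apply: sub_pairwise pes => a b ->; rewrite orbT.
    - by move=> a; rewrite eqxx.
    - by move=> a b; rewrite eq_sym angleC.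
  have := allrelP sym _ _ ein e'in; rewrite (negbTE ne)/= angleC.
  have [a0 api _] := cos_angle e'1 (ltac:(by rewrite e1) : 0 < enorm e).
  rewrite ger0_norm// => sepa.
  have -> : phi = (phi + phi) / 2 by field.
  apply: angle_dist => //.
  - by apply/andP; split; [rewrite addr_ge0// ltW|lra].
  - have -> : (phi + phi) / 2 = phi by field.
    have -> : (phi + phi) / 4 = phi / 2 by field.
    exact: phis.
  - exact: le_trans sepa.
move=> e e' ein e'in ne; apply/not_existsP => H.
have : enorm (e - e') <= Num.sqrt d%:R * (phi / (2 * Num.sqrt d%:R)).
  apply: enorm_le_coord; first exact: ltW.
  by move=> i; rewrite !mxE ltW// ltNge; apply/negP; exact: H.
have -> : Num.sqrt d%:R * (phi / (2 * Num.sqrt d%:R)) = phi / 2 by field; rewrite gt_eqF.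
by have := dist _ _ ein e'in ne; lra.
Qed.

Lemma grid_size_le (C1 eps : R) n : (1 < n)%N -> 0 < C1 -> 0 < eps -> 1 <= ln (n%:R : R) ->
  (grid_size d C1 eps n).+1%:R <= n%:R ^+ 2 * (C1^-1 + 3).
Proof.
move=> n1 C10 eps0 t1.
have n0 : 1 <= n%:R :> R by rewrite ler1n ltnW.
have Lge := wlength_ge d n1 C10 t1.
have L0 : 0 < Defs.wlength d C1 n by apply: lt_le_trans Lge; rewrite divr_gt0//; lra.
have step : 2 * (C1 / n%:R) <= grid_step d C1 eps n.
  rewrite /grid_step; apply: ler_pM => //; [by rewrite divr_ge0// ltW|lra].
have step0 : 0 < grid_step d C1 eps n by rewrite /grid_step mulr_gt0//; lra.
set x := 2 * n%:R / grid_step d C1 eps n.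
have x0 : 0 < x by rewrite divr_gt0// mulr_gt0//; lra.
have xn : x <= n%:R ^+ 2 / C1.
  rewrite ler_pdivrMr//.
  have : n%:R ^+ 2 / C1 * (2 * (C1 / n%:R)) <= n%:R ^+ 2 / C1 * grid_step d C1 eps n.
    by rewrite ler_wpM2l// divr_ge0 ?sqr_ge0// ltW.
  have -> : n%:R ^+ 2 / C1 * (2 * (C1 / n%:R)) = 2 * n%:R :> R.
    by field; rewrite !gt_eqF//; lra.
  exact.
have cx : (grid_size d C1 eps n)%:R <= x + 1 :> R.
  rewrite /grid_size natr_absz gtr0_norm ?ceil_gt0//.
  by have := ceil_itv x; rewrite intrB => /andP[h _]; rewrite -lerBlDr ltW.
rewrite -natr1 mulrDr.
have : 1 <= n%:R ^+ 2 :> R by rewrite exprn_ege1.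
lra.
Qed.

End counting.

(** The exponent 3 d is 2 d for the vertices, of order n^2 in each coordinate, plus d for the
    directions, of order at most (log n)^d <= n^d. *)
Lemma card_windex_near {R : realType} (d : nat) (C1 C2 eps : R)
    (dirs : nat -> seq 'rV[R]_d) : (0 < d)%N -> 0 < C1 -> 0 < C2 -> 0 < eps ->
  (\forall n \near \oo, greedy_directions C2 eps n (dirs n)) ->
  exists2 A : R, 0 < A & \forall n \near \oo,
    #|windex C1 eps dirs n|%:R <= A * n%:R ^+ (3 * d).
Proof.
move=> d0 C10 C20 eps0 gd.
have sd0 : 0 < Num.sqrt d%:R :> R by rewrite sqrtr_gt0 ltr0n.
have c1 : 0 < C1^-1 by rewrite invr_gt0.
have c2 : 0 < 8 * Num.sqrt d%:R / C2 by rewrite divr_gt0// mulr_gt0.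
exists ((C1^-1 + 3) ^+ d * (8 * Num.sqrt d%:R / C2 + 1) ^+ d).
  by rewrite mulr_gt0// exprn_gt0//; lra.
have [rho rho0 sb] := @sin_bounds R.
have rho'0 : 0 < Num.min rho 1 by rewrite lt_min rho0 ltr01.
near=> n.
have n1 : (1 < n)%N by near: n; exists 2%N.
have t1 : 1 <= ln (n%:R : R) by near: n; exact: ln_ge_near.
have tC : C2 / Num.min rho 1 <= ln (n%:R : R) by near: n; exact: ln_ge_near.
have gn : greedy_directions C2 eps n (dirs n) by near: n; exact: gd.
set t := ln _ in t1 tC.
have t0 : 0 < t by lra.
have phiE : wphi C2 n = C2 / 2 / t by [].
have phi0 : 0 < wphi C2 n by rewrite phiE !divr_gt0.
have phis : wphi C2 n <= Num.min rho 1 / 2.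
  rewrite phiE ler_pdivrMr//; rewrite ler_pdivrMr// in tC; lra.
have phirho : wphi C2 n < rho.
  by have : Num.min rho 1 <= rho by [rewrite ge_min lexx]; lra.
have phi1 : wphi C2 n <= 1 / 2.
  by have : Num.min rho 1 <= 1 by [rewrite ge_min lexx orbT]; lra.
have pi2 := pi_ge2 R.
have [/andP[s1 _] _] := sb (wphi C2 n) ltac:(by rewrite phi0).
have sz := size_directions d0 eps0 (ltac:(rewrite phi0/=; lra) : 0 < wphi C2 n < pi / 2)
  (ltac:(lra) : wphi C2 n <= 1) s1 gn.
have gs := @grid_size_le R d C1 eps n n1 C10 eps0 t1.
have n0 : 1 <= n%:R :> R by rewrite ler1n ltnW.
rewrite /windex card_prod card_ffun !card_ord natrM natrX.
have -> : (C1^-1 + 3) ^+ d * (8 * Num.sqrt d%:R / C2 + 1) ^+ d * n%:R ^+ (3 * d) =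
   (n%:R ^+ 2 * (C1^-1 + 3)) ^+ d * ((8 * Num.sqrt d%:R / C2 + 1) * n%:R) ^+ d.
  rewrite -!exprMn exprM -exprMn; congr (_ ^+ d); ring.
apply: ler_pM => //.
  by rewrite lerXn2r ?nnegrE// mulr_ge0 ?sqr_ge0//; lra.
apply: (@le_trans _ _ ((Num.truncn (2 / (wphi C2 n / (2 * Num.sqrt d%:R)))).+1 ^ d)%:R).
  by rewrite ler_nat.
rewrite natrX lerXn2r ?nnegrE//; first by rewrite mulr_ge0//; lra.
have qE : 2 / (wphi C2 n / (2 * Num.sqrt d%:R)) = 8 * Num.sqrt d%:R / C2 * t.
  by rewrite phiE; field; rewrite !gt_eqF.
rewrite qE -[leLHS]natr1 [leRHS]mulrDl [1 * n%:R]mul1r lerD//.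
have q0 : 0 <= 8 * Num.sqrt d%:R / C2 * t by rewrite mulr_ge0// ltW.
have /andP[h _] := truncn_itv q0; apply: (le_trans h).
by rewrite ler_wpM2l ?(ltW c2)// ln_nat_le.
Unshelve. all: by end_near.
Qed.

(** Once ln n >= k + 3, exp(-(ln n)^2) = n^(-ln n) is at most n^(-k-3), which leaves a multiple of
    1/n. *)
Lemma union_bound_near {R : realType} (A eps : R) (k : nat) : 0 < A -> 0 < eps ->
  \forall n \near \oo, A * n%:R ^+ k * n.+1%:R ^+ 2 * (2 * expR (- ln (n%:R : R) ^+ 2)) <= eps.
Proof.
move=> A0 e0; near=> n.
have n1 : (0 < n)%N by near: n; exists 1%N.
have n0 : 0 < n%:R :> R by rewrite ltr0n.
have t1 : (k + 3)%:R <= ln (n%:R : R) by near: n; exact: ln_ge_near.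
have te : 8 * A / eps <= ln (n%:R : R) by near: n; exact: ln_ge_near.
have nn : n.+1%:R ^+ 2 <= 4 * n%:R ^+ 2 :> R.
  have : 1 <= n%:R :> R by rewrite ler1n.
  rewrite -natr1 => h; have : n%:R + 1 <= 2 * n%:R :> R by lra.
  move=> /(lerXn2r 2); rewrite exprMn => h'; apply: le_trans (h' _ _) _; rewrite ?nnegrE ?mulr_ge0 ?addr_ge0//.
  lra.
have key : n%:R ^+ k * n%:R ^+ 2 * expR (- ln (n%:R : R) ^+ 2) <= n%:R^-1.
  rewrite -exprD -{1 3}(expR_ln_nat n1) -expRM_natr -expRD -expRN ler_expR.
  move: t1; rewrite !natrD; set t := ln _ => t1.
  have : 0 <= t * (t - (k%:R + 3)).
    by apply: mulr_ge0; rewrite ?subr_ge0// (le_trans _ t1)// addr_ge0.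
  lra.
apply: (@le_trans _ _ (8 * A * n%:R^-1)).
  have -> : 8 * A * n%:R^-1 = 2 * A * 4 * n%:R^-1 by ring.
  apply: (@le_trans _ _ (2 * A * 4 * (n%:R ^+ k * n%:R ^+ 2 * expR (- ln (n%:R : R) ^+ 2)))).
    have E0 := expR_ge0 (- ln (n%:R : R) ^+ 2).
    have : A * n%:R ^+ k * n.+1%:R ^+ 2 * (2 * expR (- ln (n%:R : R) ^+ 2)) <=
      A * n%:R ^+ k * (4 * n%:R ^+ 2) * (2 * expR (- ln (n%:R : R) ^+ 2)).
      by rewrite ler_wpM2r ?mulr_ge0// ler_wpM2l// mulr_ge0 ?exprn_ge0// ltW.
    lra.
  by rewrite ler_wpM2l// !mulr_ge0// ltW.
rewrite ler_pdivrMr//; rewrite ler_pdivrMr// in te.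
apply: (le_trans te); rewrite mulrC ler_wpM2l ?(ltW e0)// ln_nat_le//.
Unshelve. all: by end_near.
Qed.

(** * Comparison of the signal with the critical value *)

Section final_estimates.
Context {R : realType}.

Lemma Gamma_penalty_le (n N : nat) : (1 < n)%N -> (0 < N)%N -> 1 <= ln (n%:R : R) ->
  Gamma_penalty (N%:R / (n%:R - 1)) <= 2 * ln (n%:R : R) ^+ 2.
Proof.
move=> n1 N0; set t := ln _ => t1; have t0 : 0 < t by lra.
have n0 : 0 < n%:R :> R by rewrite ltr0n ltnW.
have n1' : 0 < n%:R - 1 :> R by rewrite subr_gt0 ltr1n.
have N1 : 1 <= N%:R :> R by rewrite ler1n.
have N0' : 0 < N%:R :> R by rewrite ltr0n.
have tt : 0 <= 2 * t ^+ 2 by rewrite mulr_ge0// sqr_ge0.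
rewrite /Gamma_penalty -[leRHS](ger0_norm tt) -sqrtr_sqr ler_wsqrtr//.
have h : ln (expR 1 / (N%:R / (n%:R - 1))) <= 1 + t.
  rewrite -[1 + t](expRK) ler_ln ?posrE ?divr_gt0 ?expR_gt0//.
  rewrite expRD -[expR t]/(expR (ln n%:R)) lnK ?posrE// ler_wpM2l ?expR_ge0//.
  by rewrite invf_div ler_pdivrMr//; nra.
have : t <= t ^+ 2 by rewrite expr2 ler_peMl ?(ltW t0).
have : t ^+ 2 <= (t ^+ 2) ^+ 2.
  by rewrite [leRHS]expr2 ler_peMl ?sqr_ge0// expr2 -[leLHS]mulr1 ler_pM.
rewrite exprMn; lra.
Qed.

(** The squared drift brings a factor L^4, and A L^4 = n L^(d+4) m w >= C1^(d+4) m cw t^5. Only t^4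
    is required; the spare factor t absorbs the constants k1 and k2. *)
Lemma signal_size (d n : nat) (C1 t L m w cw q k1 k2 : R) :
  0 < C1 -> 1 <= t -> 0 < L <= 1 -> 0 < m -> 0 < cw -> 0 <= n%:R :> R ->
  n%:R * L ^+ (d + 4) = C1 ^+ (d + 4) * t ^+ (d + 5) -> cw / t ^+ d <= w ->
  k1 <= C1 ^+ (d + 4) * (m * cw) * t -> k2 < q ^+ 2 * (C1 ^+ (d + 4) * (m * cw) * t / 2) ->
  k1 * t ^+ 2 <= n%:R * (L ^+ d * (m * w)) /\
  k2 * (t ^+ 2) ^+ 2 < (q * L ^+ 2) ^+ 2 * (n%:R * (L ^+ d * (m * w)) / 2).
Proof.
move=> C10 t1 /andP[L0 L1] m0 cw0 n0 nL wge h1 h2.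
have t0 : 0 < t by lra.
set A := n%:R * (L ^+ d * (m * w)).
have AL : C1 ^+ (d + 4) * (m * cw) * t ^+ 5 <= A * L ^+ 4.
  have -> : A * L ^+ 4 = (n%:R * L ^+ (d + 4)) * (m * w) by rewrite /A (exprD L d 4); ring.
  rewrite nL (exprD t d 5).
  have -> : C1 ^+ (d + 4) * (m * cw) * t ^+ 5 = C1 ^+ (d + 4) * (t ^+ d * t ^+ 5) * (m * (cw / t ^+ d)).
    by field; rewrite gt_eqF// exprn_gt0.
  rewrite ler_wpM2l ?mulr_ge0 ?exprn_ge0 ?(ltW C10) ?(ltW t0)//.
  by rewrite ler_wpM2l// ltW.
have w0 : 0 <= w by apply: le_trans wge; rewrite divr_ge0 ?exprn_ge0 ?(ltW t0)// ltW.
have A0 : 0 <= A by rewrite !mulr_ge0 ?exprn_ge0// ltW.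
have AA : A * L ^+ 4 <= A by rewrite ler_piMr// exprn_ile1// ltW.
set c7 := C1 ^+ (d + 4) * (m * cw) in h1 h2 AL.
have c70 : 0 < c7 by rewrite !mulr_gt0// exprn_gt0.
have t12 : t ^+ 2 * (c7 * t) <= c7 * t ^+ 5.
  have -> : c7 * t ^+ 5 = t ^+ 2 * (c7 * t) * t ^+ 2 by ring.
  rewrite ler_peMr ?exprn_ege1// mulr_ge0 ?sqr_ge0//.
  by rewrite mulr_ge0// ltW.
split.
  have : t ^+ 2 * k1 <= t ^+ 2 * (c7 * t) by rewrite ler_wpM2l ?sqr_ge0.
  lra.
have -> : (q * L ^+ 2) ^+ 2 * (A / 2) = q ^+ 2 * (A * L ^+ 4 / 2) by field.
apply: (@lt_le_trans _ _ (q ^+ 2 * (c7 * t ^+ 5 / 2))); last first.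
  by rewrite ler_wpM2l ?sqr_ge0// ler_pM2r.
have -> : q ^+ 2 * (c7 * t ^+ 5 / 2) = q ^+ 2 * (c7 * t / 2) * (t ^+ 2) ^+ 2 by ring.
by rewrite ltr_pM2r// !exprn_gt0.
Qed.

End final_estimates.

Lemma outward_wedge_signal {R : realType} (d n : nat) (mu : probability 'rV[R]_d R)
    (f : 'rV[R]_d -> R) (K : wedge R d) (x : 'I_n -> 'rV[R]_d) (x0 : 'rV[R]_d)
    (rho m M c' t : R) :
  measurable_fun setT f -> (forall y, 0 <= f y) ->
  (forall A, measurable A -> mu A = (\int[@lebesgue_rV R d]_(y in A) (f y)%:E)%E) ->
  (0 < d)%N -> enorm (wdir K) = 1 -> orthonormal_frame (wdir K) (wframe K) ->
  0 < wlen K -> 0 < tan (wangle K) -> d%:R * tan (wangle K) <= 1 / 10 ->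
  wlen K <= enorm (wvertex K - x0) ->
  9 / 10 * enorm (wvertex K - x0) <= dot (wvertex K - x0) (wdir K) ->
  4 * (enorm (wvertex K - x0) + 2 * wlen K) < rho -> 0 < m -> 0 < M -> 0 < c' -> 1 <= t ->
  (forall x, 0 < enorm (x - x0) < rho -> m <= f x <= M) ->
  (forall x u s, enorm u = 1 -> 0 < enorm (x - x0) -> 4 * enorm (x - x0) < rho ->
    0 <= s <= 3 * enorm (x - x0) -> enorm (x - x0) / 2 <= dot (x - x0) u ->
    f (x + s *: u) + c' * enorm (x - x0) * s <= f x) ->
  quantile_close f K x t ->
  `|(nobs K x)%:R - n%:R * law f (below K (wlen K))| <=
    3 * t * (Num.sqrt (n%:R * law f (below K (wlen K))) + t) ->
  let w := fine (lebesgue_rV (wedge_set (unit_wedge K))) in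
  let A := n%:R * (wlen K ^+ d * (m * w)) in
  (30 * (100 * t)) ^+ 2 <= A ->
  (14 * (100 * t ^+ 2)) ^+ 2 <
    (c' * m / (64 * 64 * d%:R * M ^+ 2) * wlen K ^+ 2) ^+ 2 * (A / 2) ->
  (12 <= nobs K x)%N /\ Tstat K x < - (12 * (100 * t ^+ 2) * Num.sqrt (nobs K x)%:R).
Proof.
move=> mf f0 muE d0 e1 eB L0 tn0 tn1 vL ve vrho m0 M0 c'0 t1 fb fd uQ NG w A HA HK.
have bnd := wedge_bounds d0 e1 eB L0 tn0 tn1 vL ve vrho fb.
have dec := wedge_decrease d0 e1 eB L0 tn0 tn1 vL ve vrho c'0 fd.
have w0 : 0 < w.
  have t1' : tan (wangle K) <= 1.
    have : 1 <= d%:R :> R by rewrite ler1n.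
    move=> d1; apply: le_trans (_ : d%:R * tan (wangle K) <= 1); last by lra.
    by rewrite ler_peMl// ltW.
  have := vol_unit_wedge_ge d0 e1 eB (introT andP (conj tn0 t1')).
  have Wfin : lebesgue_rV (wedge_set (unit_wedge K)) \is a fin_num.
    by rewrite ge0_fin_numE// vol_unit_wedge_lty.
  rewrite -(fineK Wfin) lee_fin; apply: lt_le_trans.
  by rewrite exprn_gt0// divr_gt0// mulr_gt0// sqrtr_gt0 ltr0n.
apply: (@Tstat_near_mode R d n f K x (bint f K) t m M w c') => //.
- by move=> z zL; exact: (law_below_bint mf f0 muE zL).
- move=> z zL; have /andP[z0 z1] := zL; apply/andP; split.
    apply: (bint_ge mf f0 muE d0 e1 eB zL (ltW m0)) => y yW.
    by have /andP[] := bnd y z yW (introT andP (conj (ltW z0) z1)).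
  apply: (bint_le mf f0 muE d0 e1 eB zL) => y yW.
  by have /andP[] := bnd y z yW (introT andP (conj (ltW z0) z1)).
- move=> z z' z0 zz zL.
  have zle : 0 < z <= wlen K by rewrite z0 (le_trans zz).
  have zle' : 0 < z' <= wlen K by rewrite zL (lt_le_trans z0).
  have a0 : 0 <= c' * wlen K / 4 * (z' - z).
    by rewrite mulr_ge0 ?subr_ge0// divr_ge0// mulr_ge0// ltW.
  have cL : 0 <= c' * wlen K / 2 by rewrite divr_ge0// mulr_ge0// ltW.
  apply: (bint_slope mf f0 muE d0 e1 eB zle zle' a0) => y yW.
    have := dec y z z' yW (ltW z0) zz zL; apply: le_trans; rewrite lerDl.
    have /unit_wedgeP[p0 _ _] := yW.
    by rewrite mulr_ge0 ?(ltW p0)// mulr_ge0// subr_ge0.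
  (* P_e y > 1/2 turns the ray slope c' L / 2 into c' L / 4. *)
  move=> y2; have := dec y z z' yW (ltW z0) zz zL; apply: le_trans; rewrite lerD2l.
  have : c' * wlen K / 2 * (z' - z) * (1 / 2) <= c' * wlen K / 2 * (z' - z) * dot y (wdir K).
    by rewrite ler_wpM2l ?(ltW y2)// mulr_ge0// subr_ge0.
  lra.
- by move=> z z' _ zz _; exact: (law_below_mono muE).
- exact: law_below0.
Qed.

Lemma near_mode_signal {R : realType} (d : nat) (mu : probability 'rV[R]_d R)
    (f : 'rV[R]_d -> R) (x0 : 'rV[R]_d) (c C1 C2 B : R) :
  measurable_fun setT f -> (forall y, 0 <= f y) ->
  (forall S, measurable S -> mu S = (\int[@lebesgue_rV R d]_(y in S) (f y)%:E)%E) ->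
  (0 < d)%N -> 0 < c -> 0 < C1 -> 0 < C2 -> radial_shape f c x0 ->
  \forall n \near \oo, forall (K : wedge R d) (x : 'I_n -> 'rV[R]_d),
    wlen K = Defs.wlength d C1 n -> wangle K = wphi C2 n ->
    enorm (wdir K) = 1 -> orthonormal_frame (wdir K) (wframe K) ->
    wlen K <= enorm (wvertex K - x0) ->
    enorm (wvertex K - x0) <= Defs.mscale n * wlen K ->
    angle (wvertex K - x0) (wdir K) <= B / ln n%:R ->
    quantile_close f K x (ln n%:R) ->
    `|(nobs K x)%:R - n%:R * law f (below K (wlen K))| <=
      3 * ln n%:R * (Num.sqrt (n%:R * law f (below K (wlen K))) + ln n%:R) ->
    (12 <= nobs K x)%N /\
    Tstat K x < - (12 * (100 * ln n%:R ^+ 2) * Num.sqrt (nobs K x)%:R).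
Proof.
move=> mf f0 muE d0 c0 C10 C20 shape.
have [rho [m [M0 [c' [rho0 m0 c'0 fb0 fd]]]]] := radial_shape_decrease d0 c0 f0 shape.
pose M := Num.max M0 1.
have M0' : 0 < M by rewrite lt_max ltr01 orbT.
have fb x : 0 < enorm (x - x0) < rho -> m <= f x <= M.
  by move=> /fb0/andP[-> h]; rewrite le_max h.
have [rt rt0 tanb] := @tan_bounds R.
have [rc rc0 cosb] := @cos_near R (9 / 10) ltac:(lra).
have d0' : 0 < d%:R :> R by rewrite ltr0n.
have sd0 : 0 < Num.sqrt d%:R :> R by rewrite sqrtr_gt0.
pose q := c' * m / (64 * 64 * d%:R * M ^+ 2).
have q0 : 0 < q by rewrite !(divr_gt0, mulr_gt0, exprn_gt0).
(* From the cube in the unit wedge: tan phi >= phi / 2 = C2 / (4 t), divided by 2 sqrt d. *)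
pose cw := (C2 / (8 * Num.sqrt d%:R)) ^+ d.
have cw0 : 0 < cw by rewrite exprn_gt0// divr_gt0// mulr_gt0.
pose c7 := C1 ^+ (d + 4) * (m * cw).
have c70 : 0 < c7 by rewrite !mulr_gt0// exprn_gt0.
near=> n => K x KL Kphi Kdir Kframe nm1 nm2 nm3 KQ KN.
have n1 : (1 < n)%N by near: n; exists 2%N.
have t1 : 1 <= ln (n%:R : R) by near: n; exact: ln_ge_near.
have hphi : C2 / rt <= ln (n%:R : R) by near: n; exact: ln_ge_near.
have hphi' : 10 * d%:R * C2 <= ln (n%:R : R) by near: n; exact: ln_ge_near.
have hang : 2 * B / rc <= ln (n%:R : R) by near: n; exact: ln_ge_near.
have hang0 : B / rc + 1 <= ln (n%:R : R) by near: n; exact: ln_ge_near.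
(* As m_n = t^(5/2) <= t^3, this places the wedge near the mode: 4 (t^3 L + 2 L) <= 12 t^3 L <
   rho. *)
have hL : ln n%:R ^+ 3 * Defs.wlength d C1 n <= Num.min 1 (rho / 13).
  by near: n; apply: wlength_near => //; rewrite lt_min ltr01 divr_gt0.
have hk1 : (30 * 100) ^+ 2 / c7 <= ln (n%:R : R) by near: n; exact: ln_ge_near.
(* The factor 4 in place of 2 yields the strict inequality. *)
have hk2 : (14 * 100) ^+ 2 * 4 / (q ^+ 2 * c7) <= ln (n%:R : R) by near: n; exact: ln_ge_near.
have t0 : 0 < ln (n%:R : R) by exact: lt_le_trans t1.
have nL := wlength_pow d n1 C10 (ltW t0).
have Lge := wlength_ge d n1 C10 t1.
set t := ln _ in t1 t0 hphi hphi' hang hang0 hL hk1 hk2 nL nm3 KQ KN *.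
have n0 : (0 < n)%N by rewrite ltnW.
rewrite -KL in hL nL Lge.
set L := wlen K in hL nL Lge nm1 nm2 KN KL.
have L0 : 0 < L by apply: lt_le_trans Lge; rewrite divr_gt0// ltr0n.
have tL : L <= t ^+ 3 * L by rewrite ler_peMl ?exprn_ege1// ltW.
have L1 : L <= 1 by apply: (le_trans tL); apply: (le_trans hL); rewrite ge_min lexx.
have tLrho : t ^+ 3 * L <= rho / 13.
  by apply: (le_trans hL); rewrite ge_min lexx orbT.
have phiE : wangle K = C2 / 2 / t by rewrite Kphi.
set phi := wangle K in phiE.
have phi0 : 0 < phi by rewrite phiE !divr_gt0.
have phirt : phi < rt.
  rewrite phiE ltr_pdivrMr//; apply: (@lt_le_trans _ _ C2); last first.
    by rewrite mulrC -ler_pdivrMr.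
  by clear -C20; lra.
have /andP[tn1 tn2] := tanb phi (introT andP (conj phi0 phirt)).
have dphi : d%:R * (2 * phi) <= 1 / 10.
  have -> : d%:R * (2 * phi) = d%:R * C2 / t by rewrite phiE; field; rewrite gt_eqF.
  by rewrite ler_pdivrMr//; clear -hphi'; lra.
set v := wvertex K in nm1 nm2 nm3.
have v0 : 0 < enorm (v - x0) by apply: lt_le_trans nm1.
have [an0 anpi anE] := cos_angle Kdir v0.
have ve : 9 / 10 * enorm (v - x0) <= dot (v - x0) (wdir K).
  rewrite -anE mulrC ler_wpM2l ?enorm_ge0// cosb// ger0_norm//.
  apply: (le_lt_trans nm3); rewrite ltr_pdivrMr// mulrC -ltr_pdivrMr//.
  by clear -hang0; lra.
have vL : enorm (v - x0) <= t ^+ 3 * L.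
  apply: (le_trans nm2); rewrite ler_wpM2r ?(ltW L0)//.
  by rewrite /Defs.mscale -powR_mulrn ?(ltW t0)//; apply: ler_powR => //; clear; lra.
have vrho : 4 * (enorm (v - x0) + 2 * L) < rho.
  by clear -vL tL tLrho rho0; lra.
have tan0' : 0 < tan phi by apply: lt_le_trans tn1; rewrite divr_gt0.
have tan1' : d%:R * tan phi <= 1 / 10 by apply: le_trans dphi; rewrite ler_wpM2l.
have tanle1 : tan phi <= 1.
  apply: (@le_trans _ _ (d%:R * tan phi)); last by clear -tan1'; lra.
  by rewrite ler_peMl ?(ltW tan0')// ler1n.
have wge : cw / t ^+ d <= fine (lebesgue_rV (wedge_set (unit_wedge K))).
  have Wfin : lebesgue_rV (wedge_set (unit_wedge K)) \is a fin_num.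
    by rewrite ge0_fin_numE// (vol_unit_wedge_lty d0 Kdir Kframe).
  rewrite -lee_fin fineK//.
  apply: le_trans (vol_unit_wedge_ge d0 Kdir Kframe _); last by rewrite tan0' tanle1.
  rewrite lee_fin /cw -expr_div_n lerXn2r ?nnegrE//.
  - by apply: ltW; rewrite ?divr_gt0 ?mulr_gt0 //.
  - by apply: ltW; apply: divr_gt0; [exact: tan0'|rewrite mulr_gt0].
  rewrite ler_pdivlMr ?mulr_gt0//; apply: le_trans tn1.
  rewrite le_eqVlt; apply/orP; left; apply/eqP; rewrite phiE.
  by field; rewrite (gt_eqF t0) (gt_eqF sd0).
have h1 : (30 * 100) ^+ 2 <= c7 * t.
  by move: hk1; rewrite ler_pdivrMr// (mulrC t).
have h2 : (14 * 100) ^+ 2 < q ^+ 2 * (c7 * t / 2).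
  move: hk2; rewrite (ler_pdivrMr _ _ (mulr_gt0 (exprn_gt0 2 q0) c70)).
  have : 0 < (14 * 100) ^+ 2 :> R by rewrite exprn_gt0// mulr_gt0.
  set k := (14 * 100) ^+ 2; clearbody k; clear; lra.
have [hA hK] := @signal_size R d n C1 t L m _ cw q _ _
  C10 t1 (introT andP (conj L0 L1)) m0 cw0 (ler0n _ _) nL wge h1 h2.
apply: (outward_wedge_signal mf f0 muE d0 Kdir Kframe L0 tan0' tan1'
  nm1 ve vrho m0 M0' c'0 t1 fb fd KQ KN).
- by rewrite mulrA exprMn.
- by rewrite mulrA exprMn.
Unshelve. all: by end_near.
Qed.

Theorem theorem3p3 (R : realType) (d : nat) (d_gt0 : (0 < d)%N)
    (disp : nat -> measure_display)
    (T : forall n, measurableType (disp n))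
    (P : forall n, probability (T n) R)
    (X : forall n, 'I_n -> {RV (P n) >-> 'rV[R]_d})
    (f : 'rV[R]_d -> R)
    (X_indep : forall n, independent_RV (@X n))
    (X_density : forall n (i : 'I_n), has_density (@X n i) f)
    (alpha c c1 C1 C2 eps B : R)
    (alpha_gt0 : 0 < alpha) (alpha_lt1 : alpha < 1)
    (c_gt0 : 0 < c) (c1_gt0 : 0 < c1)
    (C1_gt0 : 0 < C1) (C2_gt0 : 0 < C2) (eps_gt0 : 0 < eps) (B_gt0 : 0 < B)
    (f_modes : forall x0, is_mode f x0 -> 0 < f x0 <= c1)
    (f_shape : forall x0, is_mode f x0 -> radial_shape f c x0)
    (frame : 'rV[R]_d -> 'rV[R]_d -> 'M[R]_(d.-1, d))
    (frame_orth : forall v e, enorm e = 1 -> orthonormal_frame e (frame v e))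
    (dirs : nat -> seq 'rV[R]_d)
    (dirs_greedy : \forall n \near \oo, greedy_directions C2 eps n (dirs n))
    (C_large : Dconst d ^+ 2 / c ^+ 2 * (c1 / (d%:R + 4)) <
               C1 ^+ (d + 4) * C2 ^+ d.-1) :
  forall x0, is_mode f x0 ->
    P n [set w | forall i : windex C1 eps dirs n,
                   near_mode C2 frame B x0 i ->
                   rejects f (@wedge_of R d C1 C2 eps frame dirs n)
                     (@X n) alpha w i]
      @[n --> \oo] --> 1%E.
Proof.
move=> x0 x0mode.
(* Every observation has the law with density f; n = 1 is the smallest sample that contains one. *)
have [mf f0 _] := @X_density 1%N ord0.
have mu1E A : measurable A -> distribution (P 1%N) (@X 1%N ord0) A =
    (\int[@lebesgue_rV R d]_(y in A) (f y)%:E)%E.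
  by have [_ _ h] := @X_density 1%N ord0; exact: h.
have signal := near_mode_signal B mf f0 mu1E d_gt0 c_gt0 C1_gt0 C2_gt0 (f_shape _ x0mode).
have [A A0 cardA] := card_windex_near d_gt0 C1_gt0 C2_gt0 eps_gt0 dirs_greedy.
have Gm (K : wedge R d) a b : a <= b -> law f (below K a) <= law f (below K b).
  exact: (law_below_mono mu1E).
have a10 : 0 < 1 + alpha^-1 by rewrite addr_gt0// invr_gt0.
pose S n := [set w | forall i : windex C1 eps dirs n, near_mode C2 frame B x0 i ->
      rejects f (@wedge_of R d C1 C2 eps frame dirs n) (@X n) alpha w i].
have mS n : measurable (S n).
  exact: (measurable_rejects (@X n) f (@wedge_of R d C1 C2 eps frame dirs n) alpha
    (@near_mode R d C1 C2 eps frame dirs B x0 n)).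
have key (e : R) : 0 < e -> \forall n \near \oo, ((1 - e)%:E <= P n (S n))%E.
  move=> e0; have e'0 : 0 < e / (1 + alpha^-1) by rewrite divr_gt0.
  near=> n.
  have n1 : (1 < n)%N by near: n; exists 2%N.
  have gn : greedy_directions C2 eps n (dirs n) by near: n; exact: dirs_greedy.
  have t1 : 1 <= ln (n%:R : R) by near: n; exact: ln_ge_near.
  have cA : #|windex C1 eps dirs n|%:R <= A * n%:R ^+ (3 * d) by near: n; exact: cardA.
  have ub : A * n%:R ^+ (3 * d) * n.+1%:R ^+ 2 * (2 * expR (- ln (n%:R : R) ^+ 2)) <=
      e / (1 + alpha^-1) by near: n; exact: union_bound_near.
  have sig : forall (K : wedge R d) (x : 'I_n -> 'rV[R]_d),
    wlen K = Defs.wlength d C1 n -> wangle K = wphi C2 n ->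
    enorm (wdir K) = 1 -> orthonormal_frame (wdir K) (wframe K) ->
    wlen K <= enorm (wvertex K - x0) ->
    enorm (wvertex K - x0) <= Defs.mscale n * wlen K ->
    angle (wvertex K - x0) (wdir K) <= B / ln n%:R ->
    quantile_close f K x (ln n%:R) ->
    `|(nobs K x)%:R - n%:R * law f (below K (wlen K))| <=
      3 * ln n%:R * (Num.sqrt (n%:R * law f (below K (wlen K))) + ln n%:R) ->
    (12 <= nobs K x)%N /\
    Tstat K x < - (12 * (100 * ln n%:R ^+ 2) * Num.sqrt (nobs K x)%:R).
    by near: n.
  have n0 : (0 < n)%N by rewrite ltnW.
  set t := ln _ in t1 ub.
  pose K := @wedge_of R d C1 C2 eps frame dirs n.
  have [unit _ _ _] := gn.
  have Kdir i : enorm (wdir (K i)) = 1 by apply: unit; rewrite mem_nth.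
  have Kframe i : orthonormal_frame (wdir (K i)) (wframe (K i)).
    by apply: frame_orth; exact: Kdir.
  have Klen i : 0 < wlen (K i).
    by apply: lt_le_trans (wlength_ge d n1 C1_gt0 t1); rewrite divr_gt0// ltr0n.
  have [Om [mOm POm OmQ OmN]] :=
    good_event n0 d_gt0 (@X_indep n) (@X_density n) Kdir Kframe Klen t1.
  set delta := #|windex C1 eps dirs n|%:R * n.+1%:R ^+ 2 * (2 * expR (- t ^+ 2)) in POm.
  have delta_e : delta <= e / (1 + alpha^-1).
    apply: le_trans ub; rewrite /delta.
    by rewrite ler_wpM2r ?mulr_ge0 ?expR_ge0// ler_wpM2r// sqr_ge0.
  have [a aE] : exists a, a = 1000 * t ^+ 2 by exists (1000 * t ^+ 2).
  have a10E : a = 10 * (100 * t ^+ 2) by rewrite aE mulrA -natrM.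
  have a0 : 0 <= a by rewrite aE; exact: mulr_ge0 (ler0n _ _) (sqr_ge0 _).
  have Omax w : Om w -> (maxstat f K (sample (X n) w) <= (a)%:E)%E.
    move=> Ow; apply/maxstat_leP => i j k jk kj; rewrite lerBlDr.
    apply: (@le_trans _ _ a); last by rewrite lerDl sqrtr_ge0.
    rewrite aE; apply: (TUstat_scaled t1 _ (OmQ w Ow i) f0) => // r s rs.
    by apply: Gm; exact: pstat_mono.
  have OmT w : Om w -> forall i, near_mode C2 frame B x0 i ->
      let N := nobs (K i) (sample (X n) w) in
      (2 <= N)%N /\ Tstat (K i) (sample (X n) w) <
      - (Num.sqrt ((N%:R - 1) / 3) * (a + Gamma_penalty (N%:R / (n%:R - 1)))).
    move=> Ow i /and3P[nm1 nm2 nm3] /=.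
    have [N12 HT] := sig (K i) (sample (X n) w) erefl erefl (Kdir i) (Kframe i) nm1 nm2 nm3
      (OmQ w Ow i) (OmN w Ow i).
    split; first exact: leq_trans N12.
    apply: (lt_le_trans HT); rewrite lerN2.
    set N := nobs _ _ in N12 HT *.
    have G := Gamma_penalty_le n1 (leq_trans (isT : (0 < 12)%N) N12) t1.
    have N1 : 1 <= N%:R :> R by rewrite ler1n (leq_trans _ N12).
    (* The sum 1000 t^2 + 2 t^2 of the bounds for [kappa] and the penalty is below 1200 t^2, and (N
       - 1) / 3 <= N. *)
    rewrite mulrC; apply: ler_pM; rewrite ?sqrtr_ge0//.
    - by rewrite addr_ge0// sqrtr_ge0.
    - have := sqr_ge0 t; rewrite a10E -/t in G *; clear -G; lra.
    - by rewrite ler_wsqrtr//; clear -N1; lra.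
  apply: le_trans (rejects_prob (fun i => Gm (K i)) alpha_gt0 a0 mOm POm Omax OmT).
  rewrite lee_fin lerB//.
  have -> : delta + delta / alpha = delta * (1 + alpha^-1) by ring.
  by rewrite -ler_pdivlMr.
have PE n : P n (S n) = (fine (P n (S n)))%:E by rewrite fineK// fin_num_measure.
rewrite -/(S _); under eq_fun do rewrite PE.
apply/fine_cvgP; split; first by apply: nearW => n; rewrite /= -PE fin_num_measure.
apply/cvgrPdist_le => e e0; near=> n.
have h1 : ((1 - e)%:E <= P n (S n))%E by near: n; exact: key.
have h2 : (P n (S n) <= 1)%E by exact: probability_le1.
move: h1 h2; rewrite PE /= !lee_fin => h1 h2.
by rewrite ger0_norm ?subr_ge0//; lra.
Unshelve. all: by end_near.
Qed.
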